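(* Let $I$ be a non-empty open interval of $\mathbb{R}$ and let $\lambda_1,\lambda_2$ be probability measures on $\mathcal{B}_I$ of finite mean. (i) Let $g:I\to\mathbb{R}$ be bounded and Borel and let $f:I\to\mathbb{R}$ be strictly convex with $\int f^+\,d\lambda_2<\infty$. Assume that $\pi$ is a martingale transport of $\lambda_1$ to $\lambda_2$ that maximizes $\int(g\otimes f)\,d\nu$ over all martingale transports $\nu$ of $\lambda_1$ to $\lambda_2$. Then $\pi$ is a $<_g$-curtain martingale transport of $\lambda_1$ to $\lambda_2$, where $<_g$ is the relation on $I$ for which $a<_gb$ iff $g(a)<g(b)$; in particular, if $g$ is injective on a set that carries $\lambda_1$, then $\pi$ is a curtain martingale transport of $\lambda_1$ to $\lambda_2$. (ii) Suppose now that $\lambda_1$ has a finite support and let $\pi$ be a curtain martingale transport of $\lambda_1$ to $\lambda_2$. Then, for any strictly concave $f:I\to\mathbb{R}$ with $\int f^-\,d\lambda_2<\infty$, there exists a bounded Borel $g:I\to\mathbb{R}$, injective on $\operatorname{supp}(\lambda_1)$ and vanishing off $\operatorname{supp}(\lambda_1)$, such that $\pi$ uniquely maximizes $\int(g\otimes f)\,d\nu$ over all martingale transports $\nu$ of $\lambda_1$ to $\lambda_2$.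
   Context: $\mathcal{B}_A$ denotes the Borel $\sigma$-field of $A$. $X_1,X_2$ are the canonical projections of $I^2$ onto the first and second coordinate. For $g,f:I\to\mathbb{R}$, $(g\otimes f)(x,y):=g(x)f(y)$ for $(x,y)\in I^2$. A set carries a measure if its complement has measure zero. A martingale transport of $\lambda_1$ to $\lambda_2$ is a probability measure $\nu$ on $\mathcal{B}_{I^2}$ with first marginal $\lambda_1$, second marginal $\lambda_2$ and $E_\nu[X_2\mid X_1]=X_1$ $\nu$-a.s. For a relation $R$ on $I$, an $R$-curtain martingale transport of $\lambda_1$ to $\lambda_2$ is a martingale transport $\nu$ of $\lambda_1$ to $\lambda_2$ for which there exists $\Gamma\in\mathcal{B}_{I^2}$ that carries $\nu$ and such that one cannot have $\{(x',y'),(x,y_1),(x,y_2)\}\subset\Gamma$ with $xRx'$ and $y_1<y'<y_2$. A curtain martingale transport of $\lambda_1$ to $\lambda_2$ is a martingale transport $\nu$ of $\lambda_1$ to $\lambda_2$ for which there exists $\Gamma\in\mathcal{B}_{I^2}$ that carries $\nu$ and such that one cannot have $\{(x,y),(x,y_1),(x,y_2),(x',y'),(x',y_1'),(x',y_2')\}\subset\Gamma$ with $x\ne x'$, $y_1<y'<y_2$ and $y_1'<y<y_2'$. *)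

(* Defs.v *)
From HB Require Import structures.
From mathcomp Require Import all_boot all_order all_algebra.
From mathcomp Require Import all_classical all_reals all_analysis.

Set Implicit Arguments.
Unset Strict Implicit.
Unset Printing Implicit Defensive.

Import Order.TTheory GRing.Theory Num.Theory.
Import numFieldNormedType.Exports.

Local Open Scope classical_set_scope.
Local Open Scope ring_scope.

(* For a Borel set I of the real line, the probability measures on the Borel
   sets of I (resp. of I x I) are encoded as the probability measures on the
   Borel sets of R (resp. of R x R) that are carried by I (resp. I `*` I), and
   the Borel sets of I as the Borel sets of R included in I. Functions on I are
   functions on R of which only the values on I matter. *)

Definition carries d (T : measurableType d) (R : realType)
    (mu : set T -> \bar R) (A : set T) : Prop :=
  measurable A /\ mu (~` A) = 0%E.

Definition strictly_convex_on (R : realType) (I : set R) (f : R -> R) : Prop :=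
  forall x y t : R, I x -> I y -> x != y -> 0 < t < 1 ->
    f (t * x + (1 - t) * y) < t * f x + (1 - t) * f y.

Definition strictly_concave_on (R : realType) (I : set R) (f : R -> R) : Prop :=
  forall x y t : R, I x -> I y -> x != y -> 0 < t < 1 ->
    t * f x + (1 - t) * f y < f (t * x + (1 - t) * y).

Definition tensor (R : realType) (g f : R -> R) (z : R * R) : R :=
  g z.1 * f z.2.

(* The support in the relative topology of the open set I: an endpoint of I is
   never a point of the support. *)
Definition msupport (R : realType) (I : set R)
    (mu : set (measurableTypeR R) -> \bar R) : set R :=
  [set x | I x /\ forall U : set R, open U -> U x -> (0 < mu U)%E].

(* Z is a version of the conditional expectation E_P[Y | X]. *)
Definition is_cond_exp d d' (T : measurableType d) (T' : measurableType d')
    (R : realType) (P : probability T R) (Y : T -> R) (X : T -> T')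
    (Z : T -> R) : Prop :=
  [/\ P.-integrable setT (EFin \o Y),
      P.-integrable setT (EFin \o Z),
      (forall B : set (measurableTypeR R), measurable B ->
         g_sigma_algebra_preimage X (Z @^-1` B))
    & forall A : set T, g_sigma_algebra_preimage X A ->
        (\int[P]_(w in A) (Z w)%:E = \int[P]_(w in A) (Y w)%:E)%E].

Notation prob1 R := (probability (measurableTypeR R) R).
Notation prob2 R := (probability (prod (measurableTypeR R) (measurableTypeR R)) R).

(* The equality E_nu[X_2 | X_1] = X_1 nu-a.s. says that the first projection is
   a version of the conditional expectation. *)
Definition martingale_transport (R : realType) (I : set R) (l1 l2 : prob1 R)
    (nu : prob2 R) : Prop :=
  [/\ carries nu (I `*` I),
      (forall A, measurable A -> pushforward nu fst A = l1 A),
      (forall A, measurable A -> pushforward nu snd A = l2 A)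
    & is_cond_exp nu snd fst fst].

Definition R_curtain (R : realType) (I : set R) (rel : R -> R -> Prop)
    (l1 l2 : prob1 R) (nu : prob2 R) : Prop :=
  martingale_transport I l1 l2 nu /\
  exists Gam : set (measurableTypeR R * measurableTypeR R),
    [/\ Gam `<=` I `*` I, carries nu Gam
      & forall x x' y1 y' y2 : R,
          Gam (x', y') -> Gam (x, y1) -> Gam (x, y2) ->
          rel x x' -> ~ (y1 < y' < y2)].

Definition curtain (R : realType) (I : set R) (l1 l2 : prob1 R)
    (nu : prob2 R) : Prop :=
  martingale_transport I l1 l2 nu /\
  exists Gam : set (measurableTypeR R * measurableTypeR R),
    [/\ Gam `<=` I `*` I, carries nu Gam
      & forall x x' y y1 y2 y' y1' y2' : R,
          Gam (x, y) -> Gam (x, y1) -> Gam (x, y2) ->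
          Gam (x', y') -> Gam (x', y1') -> Gam (x', y2') ->
          x != x' -> ~ (y1 < y' < y2 /\ y1' < y < y2')].

Definition maximizes (R : realType) (I : set R) (l1 l2 : prob1 R)
    (h : R * R -> R) (pi : prob2 R) : Prop :=
  martingale_transport I l1 l2 pi /\
  forall nu : prob2 R, martingale_transport I l1 l2 nu ->
    (\int[nu]_(z in I `*` I) (h z)%:E <= \int[pi]_(z in I `*` I) (h z)%:E)%E.

(* Two measures are compared on measurable sets only, since a measure of the
   library is a function on all sets. *)
Definition uniquely_maximizes (R : realType) (I : set R) (l1 l2 : prob1 R)
    (h : R * R -> R) (pi : prob2 R) : Prop :=
  maximizes I l1 l2 h pi /\
  forall nu : prob2 R, maximizes I l1 l2 h nu ->
    forall A, measurable A -> nu A = pi A.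

(* Main.v *)
Require Import Defs.
From HB Require Import structures.
From mathcomp Require Import all_boot all_order all_algebra.
From mathcomp Require Import all_classical all_reals all_analysis.
From mathcomp Require Import measurable_realfun.
From mathcomp Require Import ring lra.

Set Implicit Arguments.
Unset Strict Implicit.
Unset Printing Implicit Defensive.

Import Order.TTheory GRing.Theory Num.Theory.
Import numFieldNormedType.Exports.

Local Open Scope classical_set_scope.
Local Open Scope ring_scope.

(* (i) If (x', y'), (x, y1), (x, y2) with y1 < y' < y2 and g x < g x' could not
   be avoided by a set carrying pi, mass near (x', y') could be exchanged with
   mass near (x, y1) and (x, y2) so that the result is again a martingale
   transport; as f is strictly convex, spreading the mass over the larger g x'
   and contracting it over the smaller g x increases the integral.

   (ii) For a curtain carried by Gam, say that x' is nested in x if some point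
   of the fibre of Gam over x' lies strictly between two points of the fibre
   over x. This is a strict partial order; let g be an injective map to nat that
   increases along it. For every layer G = {g >= k} the image of pi restricted
   to G x I is smallest in the convex order among all martingale transports:
   this is checked on the functions y |-> max (y - t) 0, and passes to f through
   maxima of tangents. Summing over k shows that pi is a maximizer. If nu is
   another one, so is (pi + nu) / 2, and by (i) pi and nu are carried by a
   common set with the same nesting property; the comparison then works in both
   directions, so pi and nu agree on hinge functions over each atom of l1, hence
   agree. *)

(** * Expectations *)

(** All martingale transports give the same integral to functions of one coordinate and to bounded
    functions of [z.1] times affine functions of [z.2]. Both halves live on this freedom. In (i) it
    lets [g] be replaced by [g - r] and [f] by [f] minus a chord, so that every term of an exchange
    has a definite sign. In (ii) it makes a hinge comparable in a fibre that lies on one side of the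
    kink, where the hinge is affine. The obstacle in (i) is that an exchange has to respect both
    marginals and all fibre barycentres at once. Disintegration is avoided: conditional statements
    are tested against functions of [z.1], and the fibre weights come from Radon-Nikodym densities.
    The forbidden configurations are uncountably many, but each is caught by rational heights [q1],
    [q2] and a rational level [r] of [g], hence by one of countably many null sets. Applying (i)
    within (ii) costs only a sign: [g] with concave [f] and [- g] with convex [- f] have the same
    tensor. *)

Definition L1 d (T : measurableType d) (R : realType)
    (mu : {measure set T -> \bar R}) (f : T -> R) : Prop :=
  mu.-integrable setT (EFin \o f).

(** [fine] turns an infinite integral into 0, so additivity and monotonicity ask for [L1]. *)
Definition Ex d (T : measurableType d) (R : realType)
    (mu : {measure set T -> \bar R}) (f : T -> R) : R :=
  fine (\int[mu]_t (f t)%:E).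

Section expectation.
Context d (T : measurableType d) (R : realType).
Variable mu : {finite_measure set T -> \bar R}.
Implicit Types (f g h : T -> R) (c : R).

Lemma ExE f : L1 mu f -> (\int[mu]_t (f t)%:E)%E = (Ex mu f)%:E.
Proof. by move=> f1; rewrite fineK//; exact: integrable_fin_num f1. Qed.

Lemma L1_measurable f : L1 mu f -> measurable_fun setT f.
Proof. by move=> /measurable_int/measurable_EFinP. Qed.

Lemma L1_eq f g : f =1 g -> L1 mu f -> L1 mu g.
Proof. by move=> /funext ->. Qed.

Lemma Ex_eq f g : f =1 g -> Ex mu f = Ex mu g.
Proof. by move=> /funext ->. Qed.

Lemma L1_le f g : measurable_fun setT f -> L1 mu g ->
  (forall t, `|f t| <= g t) -> L1 mu f.
Proof.
move=> mf g1 fg; apply: (le_integrable measurableT _ _ g1).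
  exact/measurable_EFinP.
by move=> t _; rewrite /= lee_fin (le_trans (fg t))// ler_norm.
Qed.

Lemma L1_cst c : L1 mu (cst c).
Proof. exact: finite_measure_integrable_cst. Qed.

Lemma L1D f g : L1 mu f -> L1 mu g -> L1 mu (fun t => f t + g t).
Proof. by move=> f1 g1; exact: (integrableD measurableT f1 g1). Qed.

Lemma L1B f g : L1 mu f -> L1 mu g -> L1 mu (fun t => f t - g t).
Proof. by move=> f1 g1; exact: (integrableB measurableT f1 g1). Qed.

Lemma L1Z c f : L1 mu f -> L1 mu (fun t => c * f t).
Proof. by move=> f1; exact: (integrableZl measurableT _ f1). Qed.

Lemma L1N f : L1 mu f -> L1 mu (fun t => - f t).
Proof. by move=> /(L1Z (-1)); apply: L1_eq => t; rewrite mulN1r. Qed.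

Lemma L1_norm f : L1 mu f -> L1 mu (fun t => `|f t|).
Proof. by move=> f1; exact: integrable_norm. Qed.

Lemma L1M c f g : measurable_fun setT f -> (forall t, `|f t| <= c) ->
  L1 mu g -> L1 mu (fun t => f t * g t).
Proof.
move=> mf fc g1; apply: (L1_le (g := fun t => c * `|g t|)).
- by apply: measurable_funM => //; exact: L1_measurable.
- exact/L1Z/L1_norm.
- by move=> t; rewrite normrM ler_wpM2r.
Qed.

Lemma L1_bounded c f : measurable_fun setT f -> (forall t, `|f t| <= c) ->
  L1 mu f.
Proof. by move=> mf fc; exact: L1_le mf (L1_cst c) fc. Qed.

Lemma L1_indic (A : set T) : measurable A -> L1 mu \1_A.
Proof. by move=> mA; exact: integrable_indic. Qed.

Lemma L1_sum (J : Type) (s : seq J) (F : J -> T -> R) :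
  (forall j, L1 mu (F j)) -> L1 mu (fun t => \sum_(j <- s) F j t).
Proof.
move=> F1; elim: s => [|j s IH].
  by apply: L1_eq (L1_cst 0) => t; rewrite big_nil.
by apply: L1_eq (L1D (F1 j) IH) => t; rewrite big_cons.
Qed.

Lemma ExD f g : L1 mu f -> L1 mu g ->
  Ex mu (fun t => f t + g t) = Ex mu f + Ex mu g.
Proof. by move=> f1 g1; exact: RintegralD. Qed.

Lemma ExB f g : L1 mu f -> L1 mu g ->
  Ex mu (fun t => f t - g t) = Ex mu f - Ex mu g.
Proof. by move=> f1 g1; exact: RintegralB. Qed.

Lemma ExZ c f : L1 mu f -> Ex mu (fun t => c * f t) = c * Ex mu f.
Proof. by move=> f1; exact: RintegralZl. Qed.

Lemma Ex_sum (J : Type) (s : seq J) (F : J -> T -> R) :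
  (forall j, L1 mu (F j)) ->
  Ex mu (fun t => \sum_(j <- s) F j t) = \sum_(j <- s) Ex mu (F j).
Proof.
move=> F1; elim: s => [|j s IH].
  rewrite big_nil -[RHS](mul0r (Ex mu (cst 0))) -ExZ; last exact: L1_cst.
  by apply: Ex_eq => t; rewrite big_nil mul0r.
rewrite big_cons -IH -ExD//; last exact: L1_sum.
by apply: Ex_eq => t; rewrite big_cons.
Qed.

Lemma Ex_ge0 f : (forall t, 0 <= f t) -> 0 <= Ex mu f.
Proof. by move=> f0; exact: Rintegral_ge0. Qed.

Lemma Ex_le f g : L1 mu f -> L1 mu g -> (forall t, f t <= g t) ->
  Ex mu f <= Ex mu g.
Proof. by move=> f1 g1 fg; exact: le_Rintegral. Qed.

Lemma Ex_indic (A : set T) : measurable A -> Ex mu \1_A = fine (mu A).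
Proof. by move=> mA; rewrite /Ex integral_indic// setIT. Qed.

Lemma Ex_ae f g : measurable_fun setT f -> measurable_fun setT g ->
  {ae mu, forall t, f t = g t} -> Ex mu f = Ex mu g.
Proof.
move=> mf mg fg; rewrite /Ex; congr fine; apply: ae_eq_integral => //.
- exact/measurable_EFinP.
- exact/measurable_EFinP.
- by apply: filterS fg => t /= ->.
Qed.

Lemma L1_ae f g : measurable_fun setT f -> L1 mu g ->
  {ae mu, forall t, f t = g t} -> L1 mu f.
Proof.
move=> mf g1 fg; have mf' : measurable_fun setT (EFin \o f).
  exact/measurable_EFinP.
move/integrableP : g1 => [mg g1]; apply/integrableP; split=> //.
rewrite (_ : (\int[mu]_x _)%E = (\int[mu]_x `|(EFin \o g) x|)%E)//.
apply: ae_eq_integral => //; [exact: measurableT_comp|exact: measurableT_comp|].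
by apply: filterS fg => t /= ->.
Qed.

Lemma Ex_ge0_eq0 f : L1 mu f -> (forall t, 0 <= f t) -> Ex mu f = 0 ->
  {ae mu, forall t, f t = 0}.
Proof.
move=> f1 f0 Ef0.
have mf : measurable_fun setT (EFin \o f) by exact: measurable_int f1.
have : (\int[mu]_t `|(EFin \o f) t|)%E = 0%E.
  rewrite -[RHS]/((0 : R)%:E) -Ef0 -(ExE f1).
  by apply: eq_integral => t _ /=; rewrite ger0_norm.
move=> /(ae_eq_integral_abs mu measurableT mf).
by apply: filterS => t /= /(_ Logic.I)[].
Qed.

Lemma Ex_eq0_null f (A : set T) : measurable A -> L1 mu f ->
  (forall t, 0 <= f t) -> (forall t, A t -> 0 < f t) -> Ex mu f = 0 ->
  mu A = 0%E.
Proof.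
move=> mA f1 f0 fA Ef0; have [N [mN N0 sN]] := Ex_ge0_eq0 f1 f0 Ef0.
apply: (subset_measure0 mA mN _ N0) => t At; apply: sN => /= ft0.
by have := fA _ At; rewrite ft0 ltxx.
Qed.

End expectation.

(** * Weighted measures, their images, and products *)

Section weighted.
Context d (T : measurableType d) (R : realType).
Variable mu : {finite_measure set T -> \bar R}.

(** [W] is the measure with density [w]. Its integration formula needs no approximation by simple
    functions: the Radon-Nikodym derivative of [W] and the function [w] have the same integral over
    every measurable set, so they agree almost everywhere, and the change of variables for the
    derivative applies. *)
Lemma weighted_measure (w : T -> R) : L1 mu w -> (forall t, 0 <= w t) ->
  exists2 W : {finite_measure set T -> \bar R}, W `<< mu &
  forall phi : T -> \bar R, measurable_fun setT phi ->
    (forall t, (0 <= phi t)%E) ->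
    (\int[W]_t phi t = \int[mu]_t (phi t * (w t)%:E))%E.
Proof.
move=> w1 w0.
pose nu A := (\int[mu]_(t in A) (w t)%:E)%E.
have nu0 : nu set0 = 0%E by rewrite /nu integral_set0.
have nu_ge0 A : (0 <= nu A)%E by apply: integral_ge0 => t _; rewrite lee_fin.
have mw : measurable_fun setT (EFin \o w) by exact: measurable_int w1.
have snu : semi_sigma_additive nu.
  by apply: semi_sigma_additive_nng_induced => // t; rewrite lee_fin.
pose mnu := isMeasure.Build _ _ _ nu nu0 nu_ge0 snu.
pose nuM : {measure set T -> \bar R} := HB.pack nu mnu.
have fnu : fin_num_fun nu.
  move=> A mA; apply: integrable_fin_num => //.
  exact: (integrableS measurableT mA (@subsetT _ A) w1).
pose mf := Measure_isFinite.Build _ _ _ nuM fnu.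
pose W : {finite_measure set T -> \bar R} := HB.pack nu mnu mf.
have Wmu : W `<< mu.
  apply/null_content_dominatesP => A mA A0.
  by apply: null_set_integral => //; exact: measurable_funTS.
exists W => // phi mphi phi0.
rewrite -(Radon_Nikodym_SigmaFinite.change_of_variables Wmu)//.
have mf0 := measurable_int _ (Radon_Nikodym_SigmaFinite.f_integrable Wmu).
apply: ae_eq_integral => //.
- exact: emeasurable_funM.
- exact: emeasurable_funM.
have : ae_eq mu setT (Radon_Nikodym_SigmaFinite.f W mu) (EFin \o w).
  apply: integral_ae_eq => //.
    exact: Radon_Nikodym_SigmaFinite.f_integrable.
  by move=> A _ mA; rewrite -Radon_Nikodym_SigmaFinite.f_integral.
by apply: filterS => t /= H _; rewrite H.
Qed.

Context d' (T' : measurableType d').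

(** This is the image under [m] of the measure with density [w]. The weighted formula covers
    nonnegative functions only, so [h] is split into positive and negative parts; a nonnegative [w]
    commutes with the splitting. *)
Lemma transport_measure (m : T -> T') (w : T -> R) :
  measurable_fun setT m -> L1 mu w -> (forall t, 0 <= w t) ->
  exists W : {measure set T' -> \bar R},
  forall h : T' -> R, measurable_fun setT h ->
    L1 mu (fun t => h (m t) * w t) ->
    L1 W h /\ Ex W h = Ex mu (fun t => h (m t) * w t).
Proof.
move=> mm w1 w0; have [W0 _ W0E] := weighted_measure w1 w0.
pose m' : {mfun T >-> T'} := HB.pack m (isMeasurableFun.Build _ _ _ _ m mm).
have W0m (phi : T' -> \bar R) : measurable_fun setT phi ->
    (forall t, (0 <= phi t)%E) ->
    (\int[pushforward W0 m']_t phi t =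
     \int[mu]_t (phi (m t) * (w t)%:E))%E.
  move=> mphi phi0; rewrite ge0_integral_pushforward// preimage_setT.
  by rewrite W0E//=; exact: measurableT_comp.
exists (pushforward W0 m') => h mh h1.
have mh' : measurable_fun setT (EFin \o h) by exact/measurable_EFinP.
have absE : (\int[pushforward W0 m']_t `|(h t)%:E| =
    \int[mu]_t `|(h (m t) * w t)%:E|)%E.
  rewrite W0m//; last exact: measurableT_comp.
  by apply: eq_integral => t _ /=; rewrite -EFinM normrM (ger0_norm (w0 t)).
split.
  apply/integrableP; split=> //.
  by rewrite absE; move/integrableP : h1 => [].
pose k t := h (m t) * w t.
have posE : (\int[pushforward W0 m']_t ((EFin \o h)^\+ t) =
    \int[mu]_t ((EFin \o k)^\+ t))%E.
  rewrite W0m//; last exact: measurable_funepos.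
  apply: eq_integral => t _; rewrite !funeposE /=.
  rewrite maxe_pMl ?lee_fin//.
  by rewrite mul0e -EFinM.
have negE : (\int[pushforward W0 m']_t ((EFin \o h)^\- t) =
    \int[mu]_t ((EFin \o k)^\- t))%E.
  rewrite W0m//; last exact: measurable_funeneg.
  apply: eq_integral => t _; rewrite !funenegE /=.
  rewrite maxe_pMl ?lee_fin//.
  by rewrite mul0e -EFinM mulNr.
suff intE : (\int[pushforward W0 m']_t (h t)%:E = \int[mu]_t (k t)%:E)%E.
  exact: (congr1 fine intE).
apply: (etrans (integralE _ _ (EFin \o h))).
by apply: (etrans _ (esym (integralE _ _ (EFin \o k)))); rewrite posE negE.
Unshelve. exact: mm.
Qed.

(** Rearranged transports are built as sums of such images, one per piece of mass: three in the
    exchange, two in the half-sum. *)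
Lemma transport_measures (J : Type) (s : seq J) (m : J -> T -> T')
    (w : J -> T -> R) :
  (forall j, measurable_fun setT (m j)) -> (forall j, L1 mu (w j)) ->
  (forall j t, 0 <= w j t) ->
  exists W : {measure set T' -> \bar R},
  forall h : T' -> R, measurable_fun setT h ->
    (forall j, L1 mu (fun t => h (m j t) * w j t)) ->
    L1 W h /\ Ex W h = \sum_(j <- s) Ex mu (fun t => h (m j t) * w j t).
Proof.
move=> mm w1 w0; elim: s => [|j s [W WE]].
  exists mzero => h mh h1; rewrite big_nil /L1 /Ex.
  rewrite (eq_measure_integral mzero)//; split; last by rewrite integral_measure_zero.
  apply/integrableP; split; first exact/measurable_EFinP.
  by rewrite integral_measure_zero.
have [W' W'E] := transport_measure (mm j) (w1 j) (w0 j).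
exists (measure_add W' W) => h mh h1; rewrite big_cons.
have [hW' <-] := W'E h mh (h1 j); have [hW <-] := WE h mh h1.
have hint : L1 (measure_add W' W) h.
  apply/integrableP; split; first exact/measurable_EFinP.
  rewrite ge0_integral_measure_add//; last first.
    by apply/measurableT_comp => //; exact/measurable_EFinP.
  by apply: lte_add_pinfty; [case/integrableP : hW'|case/integrableP : hW].
split=> //; rewrite /Ex integral_measure_add// fineD//.
- exact: (integrable_fin_num measurableT hW').
- exact: (integrable_fin_num measurableT hW).
Qed.

End weighted.

Lemma L1_product d1 d2 (T1 : measurableType d1) (T2 : measurableType d2)
    (R : realType) (P1 : probability T1 R) (P2 : probability T2 R)
    (u : T1 -> R) (v : T2 -> R) : L1 P1 u -> L1 P2 v ->
  let P : probability (T1 * T2)%type R := (P1 \x P2)%E in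
  L1 P (fun t => u t.1 * v t.2) /\
  Ex P (fun t => u t.1 * v t.2) = Ex P1 u * Ex P2 v.
Proof.
move=> u1 v1 P.
have mu := L1_measurable u1; have mv := L1_measurable v1.
have muv : measurable_fun setT (fun t : T1 * T2 => u t.1 * v t.2).
  by apply: measurable_funM; exact: measurableT_comp.
have int_uv : (P1 \x P2)%E.-integrable setT
    (EFin \o (fun t : T1 * T2 => u t.1 * v t.2)).
  apply/integrable12ltyP; first exact/measurable_EFinP.
  rewrite (_ : (\int[P1]_x _)%E = (\int[P1]_x (`|u x| * Ex P2 (fun y => `|v y|))%:E)%E).
    rewrite [X in (X < _)%E](@ExE _ _ _ _ (fun x => `|u x| * Ex P2 (fun y => `|v y|))) ?ltry//.
    apply: L1_eq (L1Z (Ex P2 (fun y => `|v y|)) (L1_norm u1)) => t.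
    by rewrite mulrC.
  apply: eq_integral => x _; rewrite -(ExZ `|u x| (L1_norm v1)) -ExE.
    by apply: eq_integral => y _ /=; rewrite normrM.
  exact/L1Z/L1_norm.
split=> //; rewrite /Ex -(integral12_prod_meas1 int_uv) /fubini_F /=.
rewrite (_ : (\int[P1]_x _)%E = (\int[P1]_x (Ex P2 v * u x)%:E)%E).
  rewrite (@ExE _ _ _ _ (fun x => Ex P2 v * u x)); last exact: L1Z.
  by rewrite /= ExZ// mulrC.
apply: eq_integral => x _; rewrite mulrC -ExZ// -ExE//; exact: L1Z.
Qed.

Local Notation RR R := (measurableTypeR R * measurableTypeR R)%type.

(** * Marginals and conditional expectations *)

Section marginal.
Context d d' (T : measurableType d) (T' : measurableType d') (R : realType).
Variables (nu : probability T R) (l : probability T' R) (X : T -> T').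
Hypothesis mX : measurable_fun setT X.
Hypothesis nuX : forall A, measurable A -> pushforward nu X A = l A.

Lemma L1_marginal (h : T' -> R) : L1 l h ->
  L1 nu (h \o X) /\ Ex nu (h \o X) = Ex l h.
Proof.
move=> h1; have mh := L1_measurable h1.
pose X' : {mfun T >-> T'} := HB.pack X (isMeasurableFun.Build _ _ _ _ X mX).
have lE (f : T' -> \bar R) : (\int[pushforward nu X']_t f t = \int[l]_t f t)%E.
  by apply: eq_measure_integral => A mA _; exact: nuX.
have hX1 : L1 nu (h \o X).
  apply/integrableP; split; first exact/measurable_EFinP/measurableT_comp.
  move/integrableP : h1 => [_]; rewrite -lE ge0_integral_pushforward//.
  by apply: measurableT_comp => //; exact/measurable_EFinP.
split=> //; rewrite /Ex -lE integral_pushforward//.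
exact/measurable_EFinP.
Unshelve. all: exact: mX.
Qed.

(** [D] is the conditional expectation of [h] as a function of the value of [X]: the Radon-Nikodym
    derivative with respect to [l] of the image under [X] of the measure with density [h]. For
    nonnegative [p] both integrands are nonnegative with equal integrals, so integrability passes
    from one to the other. *)
Lemma cond_exp_ge0 (h : T -> R) : L1 nu h -> (forall t, 0 <= h t) ->
  exists D : T' -> R, [/\ measurable_fun setT D, (forall x, 0 <= D x) &
    forall p : T' -> R, measurable_fun setT p -> (forall x, 0 <= p x) ->
      L1 nu (fun t => p (X t) * h t) ->
      L1 nu (fun t => p (X t) * D (X t)) /\
      Ex nu (fun t => p (X t) * h t) = Ex nu (fun t => p (X t) * D (X t))].
Proof.
move=> h1 h0; have [W0 W0nu W0E] := weighted_measure h1 h0.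
pose X' : {mfun T >-> T'} := HB.pack X (isMeasurableFun.Build _ _ _ _ X mX).
have mXA A : measurable A -> measurable (X @^-1` A).
  by move=> mA; rewrite -[X in measurable X]setTI; exact: mX.
have lE (f : T' -> \bar R) : (\int[pushforward nu X']_t f t = \int[l]_t f t)%E.
  by apply: eq_measure_integral => A mA _; exact: nuX.
have finW : fin_num_fun (pushforward W0 X').
  by move=> A mA; apply: fin_num_measure; exact: mXA.
pose W' : {finite_measure set T' -> \bar R} :=
  HB.pack (pushforward W0 X') (Measure_isFinite.Build _ _ _ _ finW).
pose W := W' mX mX mX mX.
have Wl : W `<< l.
  apply/null_content_dominatesP => A mA A0.
  have : W0 (X @^-1` A) = 0%E.
    move/null_content_dominatesP : W0nu; apply; first exact: mXA.
    exact: (etrans (nuX mA) A0).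
  by [].
pose D x := fine (Radon_Nikodym_SigmaFinite.f W l x).
have DE x : (D x)%:E = Radon_Nikodym_SigmaFinite.f W l x.
  by rewrite fineK// Radon_Nikodym_SigmaFinite.f_fin_num.
have mD : measurable_fun setT D.
  apply/measurable_EFinP.
  rewrite (_ : EFin \o D = Radon_Nikodym_SigmaFinite.f W l); last exact/funext.
  exact: measurable_int (Radon_Nikodym_SigmaFinite.f_integrable Wl).
have D0 x : 0 <= D x by rewrite fine_ge0// Radon_Nikodym_SigmaFinite.f_ge0.
exists D; split=> // p mp p0 ph1.
have mpE : measurable_fun setT (EFin \o p) by exact/measurable_EFinP.
have intE : (\int[nu]_t (p (X t) * h t)%:E = \int[nu]_t (p (X t) * D (X t))%:E)%E.
  transitivity (\int[W]_x (p x)%:E)%E.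
    rewrite ge0_integral_pushforward//; last by move=> x _; rewrite lee_fin.
    rewrite preimage_setT W0E//=; last by move=> t; rewrite lee_fin.
    exact: measurableT_comp.
  rewrite -(Radon_Nikodym_SigmaFinite.change_of_variables Wl)//.
  rewrite -lE ge0_integral_pushforward//.
  - by rewrite preimage_setT; apply: eq_integral => t _ /=; rewrite -DE.
  - apply: emeasurable_funM => //.
    exact: measurable_int (Radon_Nikodym_SigmaFinite.f_integrable Wl).
  - by move=> x _; rewrite -DE -EFinM lee_fin mulr_ge0.
split; last exact: (congr1 fine intE).
apply/integrableP; split.
  by apply/measurable_EFinP/measurable_funM; exact: measurableT_comp.
move/integrableP : ph1 => [_].
under eq_integral do rewrite /= ger0_norm ?mulr_ge0//.
under [in X in _ -> X]eq_integral do rewrite /= ger0_norm ?mulr_ge0//.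
by rewrite intE.
Unshelve. all: exact: mX.
Qed.

End marginal.

(** * Martingale transports *)

Lemma Ex_setE d (T : measurableType d) (R : realType)
    (mu : {finite_measure set T -> \bar R}) (A : set T) (h : T -> R) :
  measurable A -> L1 mu h ->
  (\int[mu]_(t in A) (h t)%:E)%E = (Ex mu (fun t => \1_A t * h t))%:E.
Proof.
move=> mA h1; rewrite -ExE; last first.
  apply: (L1M (c := 1)) h1 => // t; rewrite indicE.
  by case: (_ \in _); rewrite ?normr1 ?normr0.
rewrite integral_mkcond; apply: eq_integral => t _.
rewrite patchE indicE; case: (_ \in _); rewrite ?mul1r ?mul0r//.
Qed.

Section martingale_transport.
Variables (R : realType) (I : set R) (l1 l2 : prob1 R) (nu : prob2 R).

Section destruct.
Hypothesis nu_mt : martingale_transport I l1 l2 nu.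

Lemma mt_carries : measurable (I `*` I) /\ nu (~` (I `*` I)) = 0%E.
Proof. by case: nu_mt. Qed.

Lemma mt_fst (A : set (measurableTypeR R)) : measurable A ->
  pushforward nu fst A = l1 A.
Proof. by case: nu_mt => _ + _ _; apply. Qed.

Lemma mt_snd (A : set (measurableTypeR R)) : measurable A ->
  pushforward nu snd A = l2 A.
Proof. by case: nu_mt => _ _ + _; apply. Qed.

Lemma mt_L1_fst : L1 nu (fun z : RR R => z.1 : R).
Proof. by case: nu_mt => _ _ _ []. Qed.

Lemma mt_L1_snd : L1 nu (fun z : RR R => z.2 : R).
Proof. by case: nu_mt => _ _ _ []. Qed.

Lemma mt_martingale (A : set (measurableTypeR R)) : measurable A ->
  Ex nu (fun z : RR R => \1_A z.1 * z.1) =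
  Ex nu (fun z : RR R => \1_A z.1 * z.2).
Proof.
move=> mA; case: nu_mt => _ _ _ [_ _ _ H].
have mA' : measurable (fst @^-1` A : set (RR R)).
  by rewrite -[X in measurable X]setTI; exact: measurable_fst.
have : (\int[nu]_(w in fst @^-1` A) (w.1)%:E =
    \int[nu]_(w in fst @^-1` A) (w.2)%:E)%E.
  by apply: H; exists A => //; rewrite setTI.
by rewrite (Ex_setE mA' mt_L1_fst) (Ex_setE mA' mt_L1_snd) => -[].
Qed.

Lemma mt_L1_comp_snd (h : R -> R) : L1 l2 (h : measurableTypeR R -> R) ->
  L1 nu (fun z : RR R => h z.2) /\
  Ex nu (fun z : RR R => h z.2) = Ex l2 (h : measurableTypeR R -> R).
Proof. by move=> h1; exact: (L1_marginal measurable_snd mt_snd h1). Qed.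

Lemma mt_L1_comp_fst (h : R -> R) : L1 l1 (h : measurableTypeR R -> R) ->
  L1 nu (fun z : RR R => h z.1) /\
  Ex nu (fun z : RR R => h z.1) = Ex l1 (h : measurableTypeR R -> R).
Proof. by move=> h1; exact: (L1_marginal measurable_fst mt_fst h1). Qed.

End destruct.

(** The marginals alone put [nu] on the square of [I], whose complement is covered by two null
    strips. For the conditional expectation, every event generated by [fst] is the preimage of a
    Borel set [A], so testing on these is enough. *)
Lemma mt_intro : carries l1 I -> carries l2 I ->
  (forall A : set (measurableTypeR R), measurable A ->
    pushforward nu fst A = l1 A) ->
  (forall A : set (measurableTypeR R), measurable A ->
    pushforward nu snd A = l2 A) ->
  L1 nu (fun z : RR R => z.1 : R) -> L1 nu (fun z : RR R => z.2 : R) ->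
  (forall A : set (measurableTypeR R), measurable A ->
    Ex nu (fun z : RR R => \1_A z.1 * z.1) =
    Ex nu (fun z : RR R => \1_A z.1 * z.2)) ->
  martingale_transport I l1 l2 nu.
Proof.
move=> [mI1 l1I] [mI2 l2I] nu1 nu2 L1fst L1snd mart.
have mII : measurable (I `*` I : set (RR R)) by exact: measurableX.
split=> //.
- split=> //.
  have mf : measurable (fst @^-1` (~` I) : set (RR R)).
    rewrite -[X in measurable X]setTI; apply: measurable_fst => //.
    exact: measurableC.
  have ms : measurable (snd @^-1` (~` I) : set (RR R)).
    rewrite -[X in measurable X]setTI; apply: measurable_snd => //.
    exact: measurableC.
  apply/negligibleP; first exact: measurableC.
  apply: (@negligibleS _ _ _ _
    (fst @^-1` (~` I) `|` snd @^-1` (~` I) : set (RR R))).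
    move=> [x y] /= /not_andP[]; by [left|right].
  apply: negligibleU; apply/negligibleP => //.
    by have := nu1 _ (measurableC mI1); rewrite l1I.
  by have := nu2 _ (measurableC mI1); rewrite l2I.
- split=> //.
    by move=> B mB; exists B => //; rewrite setTI.
  move=> _ [A mA <-]; rewrite setTI.
  have mA' : measurable (fst @^-1` A : set (RR R)).
    by rewrite -[X in measurable X]setTI; exact: measurable_fst.
  by rewrite (Ex_setE mA' L1fst) (Ex_setE mA' L1snd); congr (_%:E); exact: mart.
Qed.

End martingale_transport.

Definition bdm d (T : measurableType d) (R : realType) (f : T -> R) : Prop :=
  measurable_fun setT f /\ exists c, forall t, `|f t| <= c.

Section bounded_measurable.
Context d (T : measurableType d) (R : realType).
Implicit Types f g : T -> R.

Lemma bdm_cst (c : R) : bdm (fun _ : T => c).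
Proof. by split=> //; exists `|c|. Qed.

Lemma bdmD f g : bdm f -> bdm g -> bdm (fun t => f t + g t).
Proof.
move=> [mf [a fa]] [mg [b gb]]; split; first exact: measurable_funD.
by exists (a + b) => t; rewrite (le_trans (ler_normD _ _))// lerD.
Qed.

Lemma bdmM f g : bdm f -> bdm g -> bdm (fun t => f t * g t).
Proof.
move=> [mf [a fa]] [mg [b gb]]; split; first exact: measurable_funM.
by exists (a * b) => t; rewrite normrM ler_pM.
Qed.

Lemma bdmN f : bdm f -> bdm (fun t => - f t).
Proof.
move=> [mf [a fa]]; split; first exact: measurableT_comp.
by exists a => t; rewrite normrN.
Qed.

Lemma bdmB f g : bdm f -> bdm g -> bdm (fun t => f t - g t).
Proof. by move=> bf bg; apply: bdmD => //; exact: bdmN. Qed.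

Lemma bdm_indic (A : set T) : measurable A -> bdm (\1_A : T -> R).
Proof.
move=> mA; split=> //; exists 1 => t.
by rewrite indicE; case: (_ \in _); rewrite ?normr1 ?normr0.
Qed.

Lemma bdm_comp d' (T' : measurableType d') (X : T' -> T) f :
  measurable_fun setT X -> bdm f -> bdm (f \o X).
Proof.
move=> mX [mf [a fa]]; split; first exact: measurableT_comp.
by exists a => t; exact: fa.
Qed.

Variable mu : {finite_measure set T -> \bar R}.

Lemma L1_bdm f : bdm f -> L1 mu f.
Proof. by move=> [mf [c fc]]; exact: L1_bounded mf fc. Qed.

Lemma L1_bdmM f g : bdm f -> L1 mu g -> L1 mu (fun t => f t * g t).
Proof. by move=> [mf [c fc]]; exact: L1M mf fc. Qed.

End bounded_measurable.

Lemma Ex_cst d (T : measurableType d) (R : realType) (P : probability T R)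
  (c : R) : Ex P (fun=> c) = c.
Proof. by rewrite /Ex integral_cst// [X in (_ * X)%E](probability_setT P) mule1. Qed.

Lemma probability_of_measure d (T : measurableType d) (R : realType)
    (mu : {measure set T -> \bar R}) : mu setT = 1%E ->
  exists P : probability T R, forall h : T -> R,
    (L1 mu h -> L1 P h) /\ Ex P h = Ex mu h.
Proof.
move=> mu1.
pose m A := mu A.
pose mx := isMeasure.Build _ _ _ m (measure0 mu) (measure_ge0 mu)
  (@measure_semi_sigma_additive _ _ _ mu).
pose mM : {measure set T -> \bar R} := HB.pack m mx.
pose P : probability T R :=
  HB.pack m mx (Measure_isProbability.Build _ _ _ mM mu1).
have PE (h : T -> \bar R) : (\int[P]_t h t = \int[mu]_t h t)%E.
  exact: eq_measure_integral.
exists P => h; rewrite /Ex PE; split=> // /integrableP[mh h1].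
Qed.

(** * Exchanging mass under a maximizer *)

Section swap.
Variables (R : realType) (I : set R) (l1 l2 : prob1 R) (pi : prob2 R).
Hypotheses (l1_I : carries l1 I) (l2_I : carries l2 I).
Hypotheses (l1_mean : L1 l1 (fun x => x : R)) (l2_mean : L1 l2 (fun x => x : R)).
Hypothesis pi_mt : martingale_transport I l1 l2 pi.
Variables (q1 q2 : R) (th rL rU : RR R -> R).
Hypotheses (q12 : q1 < q2) (bth : bdm th) (brL : bdm rL) (brU : bdm rU).
Hypotheses (th0 : forall z, 0 <= th z) (rL0 : forall z, 0 <= rL z)
  (rU0 : forall z, 0 <= rU z) (le1 : forall z, th z + rL z + rU z <= 1).
Hypotheses (thq : forall z, th z != 0 -> q1 <= z.2 <= q2)
  (rLq : forall z, rL z != 0 -> z.2 <= q1)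
  (rUq : forall z, rU z != 0 -> q2 <= z.2).
Hypotheses (ML_gt0 : 0 < Ex pi rL) (MU_gt0 : 0 < Ex pi rU)
  (M_E : Ex pi th = Ex pi rL + Ex pi rU).
Hypothesis bal : forall p : measurableTypeR R -> R, bdm p ->
  Ex pi th * (Ex pi (fun z => p z.1 * z.2 * rL z) +
              Ex pi (fun z => p z.1 * z.2 * rU z)) =
  Ex pi (fun z => z.2 * th z) *
   (Ex pi (fun z => p z.1 * rL z) + Ex pi (fun z => p z.1 * rU z)).

(* Part of the mass th, which lies between q1 and q2, is exchanged with part of
   the mass rL + rU, which lies outside: rL + rU is sent to the second marginal
   of th, while th splits every y between the second marginals of rL and rU,
   with weights that keep the barycentre at y. All four pieces are images of
   weighted copies of pi \x pi. The hypothesis bal says that, given the first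
   coordinate, the mean of rL + rU is the mean of th. *)
Lemma swap_transport : exists (nu : prob2 R) (al be : RR R -> R),
 [/\ martingale_transport I l1 l2 nu,
    [/\ bdm al, bdm be & forall z, 0 <= al z /\ 0 <= be z],
    (forall z, th z = 0 -> al z = 0 /\ be z = 0),
    (forall p : measurableTypeR R -> R, bdm p ->
      Ex nu (fun z => p z.1 * z.2) = Ex pi (fun z => p z.1 * z.2)) &
    forall p q : measurableTypeR R -> R, bdm p -> measurable_fun setT q ->
      L1 pi (fun z => q z.2) ->
      Ex nu (fun z => p z.1 * q z.2) = Ex pi (fun z => p z.1 * q z.2)
        - Ex pi (fun z => p z.1 * q z.2 * th z)
        - Ex pi (fun z => p z.1 * q z.2 * rL z)
        - Ex pi (fun z => p z.1 * q z.2 * rU z)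
        + (Ex pi (fun z => p z.1 * rL z) + Ex pi (fun z => p z.1 * rU z))
            * Ex pi (fun z => q z.2 * th z) / Ex pi th
        + Ex pi (fun z => p z.1 * al z) * Ex pi (fun z => q z.2 * rL z)
        + Ex pi (fun z => p z.1 * be z) * Ex pi (fun z => q z.2 * rU z)].
Proof.
set M := Ex pi th; set ML := Ex pi rL; set MU := Ex pi rU.
have M_gt0 : 0 < M by rewrite /M M_E addr_gt0.
have L1y : L1 pi (fun z => z.2 : R) := mt_L1_snd pi_mt.
have L1p2 (p : measurableTypeR R -> R) (q : RR R -> R) : bdm p -> L1 pi q ->
    L1 pi (fun z => p z.1 * q z).
  move=> bp; apply: L1_bdmM; exact: (bdm_comp measurable_fst bp).
have L1r (q r : RR R -> R) : L1 pi q -> bdm r -> L1 pi (fun z => q z * r z).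
  by move=> q1' br; apply: L1_eq (L1_bdmM br q1') => z; rewrite mulrC.
set YL := Ex pi (fun z => z.2 * rL z); set YU := Ex pi (fun z => z.2 * rU z).
(* [l] and [h] are the mean heights of the masses [rL] and [rU]. As [l <= q1] and [q2 <= h], every
   height between [q1] and [q2] is a convex combination of them. *)
have [l lE] : exists l, l = YL / ML by exists (YL / ML).
have [h hE] : exists h, h = YU / MU by exists (YU / MU).
have l_le : l <= q1.
  rewrite lE ler_pdivrMr// -ExZ; last exact: L1_bdm.
  apply: Ex_le; [exact: L1r|exact/L1Z/L1_bdm|move=> z].
  have [->|/rLq zq] := eqVneq (rL z) 0; first by rewrite !mulr0.
  by rewrite ler_wpM2r.
have h_ge : q2 <= h.
  rewrite hE ler_pdivlMr// -ExZ; last exact: L1_bdm.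
  apply: Ex_le; [exact/L1Z/L1_bdm|exact: L1r|move=> z].
  have [->|/rUq zq] := eqVneq (rU z) 0; first by rewrite !mulr0.
  by rewrite ler_wpM2r.
have q12' := q12; have hl : 0 < h - l by lra.
(* The barycentric coordinates of [z.2] between [l] and [h], scaled by [th z] and by the masses
   [ML], [MU] they will multiply: [thE] and [thyE] then say that mass and mean height are kept point
   by point. *)
pose al z := th z * (h - z.2) / ((h - l) * ML).
pose be z := th z * (z.2 - l) / ((h - l) * MU).
have cL : 0 < (h - l) * ML by rewrite mulr_gt0.
have cU : 0 < (h - l) * MU by rewrite mulr_gt0.
have al0 z : 0 <= al z.
  rewrite /al; have [->|/thq/andP[? ?]] := eqVneq (th z) 0; first by rewrite !mul0r.
  by rewrite divr_ge0 ?(ltW cL)// mulr_ge0//; lra.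
have be0 z : 0 <= be z.
  rewrite /be; have [->|/thq/andP[? ?]] := eqVneq (th z) 0; first by rewrite !mul0r.
  by rewrite divr_ge0 ?(ltW cU)// mulr_ge0//; lra.
have th1 z : th z <= 1 by have := le1 z; have := rL0 z; have := rU0 z; lra.
have bal_ : bdm al.
  split.
    apply: measurable_funM => //; apply: measurable_funM; first by case: bth.
    by apply: measurable_funB => //; exact: measurable_snd.
  exists ((h - q1) / ((h - l) * ML)) => z; rewrite ger0_norm// /al.
  rewrite ler_pM2r ?invr_gt0//.
  have [->|/thq/andP[? ?]] := eqVneq (th z) 0; first by rewrite mul0r; lra.
  rewrite -[leRHS]mul1r ler_pM//; lra.
have bbe_ : bdm be.
  split.
    apply: measurable_funM => //; apply: measurable_funM; first by case: bth.
    by apply: measurable_funB => //; exact: measurable_snd.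
  exists ((q2 - l) / ((h - l) * MU)) => z; rewrite ger0_norm// /be.
  rewrite ler_pM2r ?invr_gt0//.
  have [->|/thq/andP[? ?]] := eqVneq (th z) 0; first by rewrite mul0r; lra.
  rewrite -[leRHS]mul1r ler_pM//; lra.
have thE z : al z * ML + be z * MU = th z.
  by rewrite /al /be; field; rewrite ?gt_eqF.
have thyE z : al z * YL + be z * YU = th z * z.2.
  rewrite (_ : YL = l * ML); last by rewrite lE divfK// gt_eqF.
  rewrite (_ : YU = h * MU); last by rewrite hE divfK// gt_eqF.
  by rewrite /al /be; field; rewrite ?gt_eqF.
have pthE (p : measurableTypeR R -> R) : bdm p ->
    Ex pi (fun z => p z.1 * al z) * ML + Ex pi (fun z => p z.1 * be z) * MU =
    Ex pi (fun z => p z.1 * th z).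
  move=> bp; rewrite mulrC [X in _ + X]mulrC -!ExZ; do ?exact/L1p2/L1_bdm.
  rewrite -ExD; do ?exact/L1Z/L1p2/L1_bdm.
  by apply: Ex_eq => z; rewrite -thE; ring.
have pthyE (p : measurableTypeR R -> R) : bdm p ->
    Ex pi (fun z => p z.1 * al z) * YL + Ex pi (fun z => p z.1 * be z) * YU =
    Ex pi (fun z => p z.1 * z.2 * th z).
  move=> bp; rewrite mulrC [X in _ + X]mulrC -!ExZ; do ?exact/L1p2/L1_bdm.
  rewrite -ExD; do ?exact/L1Z/L1p2/L1_bdm.
  apply: Ex_eq => z; have := thyE z; set a := YL; set b := YU => E.
  by rewrite -mulrA (mulrC (z.2 : R)) -E; ring.
(* The masses [rL] and [rU] have to be used up exactly for the second marginal to survive. [bal] at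
   [p = 1] says that [th] and [rL + rU] have the same mean height; together with equal total masses
   this forces both total weights to be 1. *)
have [Eal Ebe] : Ex pi al = 1 /\ Ex pi be = 1.
  have E1 := pthE _ (bdm_cst _ 1); have E2 := pthyE _ (bdm_cst _ 1).
  have E3 := bal (bdm_cst _ 1).
  have e1 f : Ex pi (fun z => 1 * f z) = Ex pi f.
    by apply: Ex_eq => z; rewrite mul1r.
  have e2 f : Ex pi (fun z : RR R => 1 * z.2 * f z) = Ex pi (fun z => z.2 * f z).
    by apply: Ex_eq => z; rewrite mul1r.
  move: E1 E2 E3; rewrite !e1 !e2 -/YL -/YU -/M -/ML -/MU.
  rewrite (_ : YL = l * ML); last by rewrite lE divfK// gt_eqF.
  rewrite (_ : YU = h * MU); last by rewrite hE divfK// gt_eqF.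
  have MME : M = ML + MU by exact: M_E.
  set Y := Ex pi (fun z => z.2 * th z).
  set a := Ex pi al; set b := Ex pi be => E1 E2 E3.
  have {}E3 : l * ML + h * MU = Y.
    by apply: (mulfI (lt0r_neq0 M_gt0)); rewrite E3 -MME mulrC.
  have Eb : (b - 1) * ((h - l) * MU) = 0.
    have -> : (b - 1) * ((h - l) * MU) = (a * (l * ML) + b * (h * MU)) -
      (l * ML + h * MU) - l * (a * ML + b * MU - (ML + MU)) by ring.
    by rewrite E2 E1 E3 MME !subrr mulr0 subr0.
  have {}Eb : b = 1.
    by move/eqP : Eb; rewrite mulf_eq0 (gt_eqF cU) orbF subr_eq0 => /eqP.
  split=> //; apply: (mulIf (lt0r_neq0 ML_gt0)); rewrite -/ML.
  by move: E1; rewrite Eb MME !mul1r => /addIr.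
pose Pi : probability (RR R * RR R)%type R := (pi \x pi)%E.
(* With two independent points of [pi]: piece 0 leaves the untouched mass in place, piece 1 keeps
   the abscissa of [rL + rU] and takes a height from [th], the last piece keeps the abscissa of [th]
   and takes a height from [rL] or [rU]. *)
pose m (j : nat) (t : RR R * RR R) : RR R := match j with
  | 0%N => t.1 | 1%N => (t.1.1, t.2.2) | _ => (t.2.1, t.1.2) end.
pose w (j : nat) (t : RR R * RR R) : R := match j with
  | 0%N => 1 - th t.1 - rL t.1 - rU t.1
  | 1%N => (rL t.1 + rU t.1) * (th t.2 / M)
  | _ => rL t.1 * al t.2 + rU t.1 * be t.2 end.
have mm j : measurable_fun setT (m j).
  case: j => [|[|j]] /=; first exact: measurable_fst.
  - apply/measurable_fun_pairP; split.
      exact: (measurableT_comp measurable_fst measurable_fst).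
    exact: (measurableT_comp measurable_snd measurable_snd).
  - apply/measurable_fun_pairP; split.
      exact: (measurableT_comp measurable_fst measurable_snd).
    exact: (measurableT_comp measurable_snd measurable_fst).
have bfst (f : RR R -> R) : bdm f -> bdm (fun t : RR R * RR R => f t.1).
  exact: (bdm_comp measurable_fst).
have bsnd (f : RR R -> R) : bdm f -> bdm (fun t : RR R * RR R => f t.2).
  exact: (bdm_comp measurable_snd).
have bw j : bdm (w j).
  case: j => [|[|j]] /=.
  - apply: bdmB; last exact: bfst.
    apply: bdmB; last exact: bfst.
    apply: bdmB; last exact: bfst.
    exact: bdm_cst.
  - apply: bdmM; first by apply: bdmD; exact: bfst.
    by apply: bdmM; [exact: bsnd|exact: bdm_cst].
  - by apply: bdmD; apply: bdmM; [exact: bfst|exact: bsnd|exact: bfst|exact: bsnd].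
have w0 j t : 0 <= w j t.
  case: j => [|[|j]] /=.
  - by have := le1 t.1; lra.
  - by rewrite mulr_ge0 ?addr_ge0 ?divr_ge0 ?(ltW M_gt0).
  - by rewrite addr_ge0// mulr_ge0.
have [W WE] := @transport_measures _ _ _ Pi _ _ _ [:: 0; 1; 2]%N m w mm
  (fun j => L1_bdm _ (bw j)) w0.
(* Product functions suffice to check the new measure: constant [q] gives the first marginal,
   constant [p] the second, and [q] the identity gives the martingale property. *)
have Wpq (p q : measurableTypeR R -> R) : bdm p -> measurable_fun setT q ->
    L1 pi (fun z => q z.2) -> let H z := p z.1 * q z.2 in
    L1 W H /\ Ex W H = Ex pi H - Ex pi (fun z => H z * th z)
        - Ex pi (fun z => H z * rL z) - Ex pi (fun z => H z * rU z)
        + (Ex pi (fun z => p z.1 * rL z) + Ex pi (fun z => p z.1 * rU z))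
            * Ex pi (fun z => q z.2 * th z) / Ex pi th
        + Ex pi (fun z => p z.1 * al z) * Ex pi (fun z => q z.2 * rL z)
        + Ex pi (fun z => p z.1 * be z) * Ex pi (fun z => q z.2 * rU z).
  move=> bp mq q1' H.
  have bp1 : bdm (fun z : RR R => p z.1) by exact: (bdm_comp measurable_fst bp).
  have mH : measurable_fun setT H.
    apply: measurable_funM; first by case: bp1.
    exact: (measurableT_comp mq measurable_snd).
  have H1 : L1 pi H by exact: L1p2.
  have b0 : bdm (fun z => 1 - th z - rL z - rU z).
    by do 3 (apply: bdmB => //); exact: bdm_cst.
  have [P0 E0] := L1_product (L1r _ _ H1 b0) (L1_cst pi 1).
  have [P1 E1] := L1_product (L1_bdm pi (bdmM bp1 (bdmD brL brU)))
    (L1r _ _ q1' (bdmM bth (bdm_cst _ M^-1))).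
  have [P2 E2] := L1_product (L1r _ _ q1' brL) (L1_bdm pi (bdmM bp1 bal_)).
  have [P3 E3] := L1_product (L1r _ _ q1' brU) (L1_bdm pi (bdmM bp1 bbe_)).
  have L1j j : L1 Pi (fun t => H (m j t) * w j t).
    case: j => [|[|j]] /=.
    - by apply: L1_eq P0 => t; rewrite /= mulr1.
    - by apply: L1_eq P1 => t; rewrite /H /=; ring.
    - by apply: L1_eq (L1D P2 P3) => t; rewrite /H /=; ring.
  have [HW ->] := WE H mH L1j; split=> //.
  rewrite !big_cons big_nil addr0.
  have -> : Ex Pi (fun t => H (m 0%N t) * w 0%N t) = Ex pi H -
      Ex pi (fun z => H z * th z) - Ex pi (fun z => H z * rL z) -
      Ex pi (fun z => H z * rU z).
    rewrite -!ExB; do ?[exact: L1r | exact: H1 | apply: L1B].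
    transitivity (Ex pi (fun z => H z * (1 - th z - rL z - rU z)) * Ex pi (cst 1)).
      by rewrite -E0; apply: Ex_eq => t; rewrite /= mulr1.
    rewrite (_ : Ex pi (cst 1) = 1) ?mulr1; first by apply: Ex_eq => z; ring.
    exact: Ex_cst.
  rewrite -!addrA; congr (_ + _); rewrite !addrA.
  have -> : Ex Pi (fun t => H (m 1%N t) * w 1%N t) =
     (Ex pi (fun z => p z.1 * rL z) + Ex pi (fun z => p z.1 * rU z))
            * Ex pi (fun z => q z.2 * th z) / Ex pi th.
    rewrite -ExD; do ?exact/L1p2/L1_bdm.
    rewrite -mulrA [X in _ * X]mulrC -ExZ; last exact: L1r.
    rewrite (Ex_eq pi (g := fun z => p z.1 * (rL z + rU z))); last first.
      by move=> z; ring.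
    rewrite [X in _ = _ * X](Ex_eq pi (g := fun z => q z.2 * (th z * M^-1))); last first.
      by move=> z; rewrite -/M; ring.
    by rewrite -E1; apply: Ex_eq => t; rewrite /H /=; ring.
  rewrite -[RHS]addrA; congr (_ + _).
  rewrite [X in _ = X + _]mulrC [X in _ = _ + X]mulrC -E2 -E3 -ExD//.
  by apply: Ex_eq => t; rewrite /H /=; ring.
have MM : M / M = 1 by rewrite divff// gt_eqF.
have MME : M = ML + MU by exact: M_E.
have e1 f : Ex pi (fun z => 1 * f z) = Ex pi f.
  by apply: Ex_eq => z; rewrite mul1r.
have E1st (p : measurableTypeR R -> R) : bdm p ->
    L1 W (fun z => p z.1 * 1) /\
    Ex W (fun z => p z.1 * 1) = Ex pi (fun z => p z.1).
  move=> bp; have [H1 ->] := Wpq p (fun=> 1) bp (measurable_cst _) (L1_cst pi 1).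
  split=> //.
  have e2 f : Ex pi (fun z => p z.1 * 1 * f z) = Ex pi (fun z => p z.1 * f z).
    by apply: Ex_eq => z; rewrite mulr1.
  rewrite !e2 !e1 -/M -/ML -/MU -(mulrA _ M) MM mulr1 -pthE//.
  have -> : Ex pi (fun z => p z.1 * 1) = Ex pi (fun z => p z.1).
    by apply: Ex_eq => z; rewrite mulr1.
  ring.
have E2nd (q : measurableTypeR R -> R) : measurable_fun setT q ->
    L1 pi (fun z => q z.2) ->
    Ex W (fun z => 1 * q z.2) = Ex pi (fun z => q z.2).
  move=> mq q1'; have [_ ->] := Wpq (fun=> 1) q (bdm_cst _ 1) mq q1'.
  have e2 f : Ex pi (fun z => 1 * q z.2 * f z) = Ex pi (fun z => q z.2 * f z).
    by apply: Ex_eq => z; rewrite mul1r.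
  rewrite !e2 !e1 -/M -/ML -/MU Eal Ebe -MME (mulrC M) -mulrA MM.
  ring.
have Emart (p : measurableTypeR R -> R) : bdm p ->
    Ex W (fun z => p z.1 * z.2) = Ex pi (fun z => p z.1 * z.2).
  move=> bp; have [_ ->] := Wpq p (fun x => x) bp (@measurable_id _ _ _) L1y.
  rewrite -/YL -/YU -[X in _ + X = _]addr0.
  have := pthyE p bp; have := bal bp; rewrite -/M.
  set u1 := Ex pi (fun z => p z.1 * z.2 * rL z).
  set u2 := Ex pi (fun z => p z.1 * z.2 * rU z).
  set u3 := Ex pi (fun z => p z.1 * z.2 * th z).
  set u4 := Ex pi (fun z => z.2 * th z).
  set u5 := Ex pi _ + Ex pi _ => B1 B2.
  have -> : u5 * u4 / M = u1 + u2.
    by rewrite mulrC (mulrC u5) -B1 mulrA mulVf ?mul1r// gt_eqF.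
  by rewrite -B2; ring.
have [L1W1 EW1] := E1st _ (bdm_cst _ 1).
have W1 : W setT = 1%E.
  have -> : W setT = (\int[W]_z (1 * 1 : R)%:E)%E.
    by rewrite integral_cst// mulr1 mul1e.
  rewrite -[RHS]/((1 : R)%:E) -[in RHS](Ex_cst pi 1) -EW1 fineK//.
  exact: (integrable_fin_num measurableT L1W1).
have [nu nuE] := probability_of_measure W1.
have L1nu h := (nuE h).1; have {nuE}ExnuE h := (nuE h).2.
have nu_fst A : measurable A -> pushforward nu fst A = l1 A.
  move=> mA; have mA' : measurable (fst @^-1` A : set (RR R)).
    by rewrite -[X in measurable X]setTI; exact: measurable_fst.
  rewrite -(mt_fst pi_mt mA) /pushforward.
  rewrite -[LHS]fineK ?fin_num_measure// -[RHS]fineK ?fin_num_measure//.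
  congr (_%:E); rewrite -!Ex_indic//.
  have [_ E] := E1st _ (bdm_indic R mA).
  transitivity (Ex nu (fun z => \1_A z.1 * 1)).
    by apply: Ex_eq => z; rewrite mulr1.
  by rewrite ExnuE E.
have nu_snd A : measurable A -> pushforward nu snd A = l2 A.
  move=> mA; have mA' : measurable (snd @^-1` A : set (RR R)).
    by rewrite -[X in measurable X]setTI; exact: measurable_snd.
  rewrite -(mt_snd pi_mt mA) /pushforward.
  rewrite -[LHS]fineK ?fin_num_measure// -[RHS]fineK ?fin_num_measure//.
  congr (_%:E); rewrite -!Ex_indic//.
  have [mi _] := bdm_indic R mA.
  have E := E2nd _ mi (L1_indic pi mA').
  transitivity (Ex nu (fun z => 1 * \1_A z.2)).
    by apply: Ex_eq => z; rewrite mul1r.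
  by rewrite ExnuE E.
have [nu1 _] := L1_marginal measurable_fst nu_fst l1_mean.
have [nu2 _] := L1_marginal measurable_snd nu_snd l2_mean.
exists nu, al, be; split=> //.
- apply: mt_intro => // A mA.
  have A1 : L1 l1 (fun x => \1_A x * x) by exact: L1_bdmM (bdm_indic R mA) l1_mean.
  have [_ E1] := L1_marginal measurable_fst nu_fst A1.
  have [_ E2] := mt_L1_comp_fst pi_mt A1.
  rewrite [RHS]ExnuE [RHS](Emart _ (bdm_indic R mA)).
  rewrite -[RHS](mt_martingale pi_mt mA).
  exact: etrans E1 (esym E2).
- by move=> z E; rewrite /al /be E !mul0r.
- by move=> p bp; rewrite ExnuE Emart.
- by move=> p q bp mq q1'; rewrite ExnuE; have [_ ->] := Wpq p q bp mq q1'.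
Qed.

End swap.

Section improvement.
Variables (R : realType) (I : set R) (l1 l2 : prob1 R) (pi : prob2 R).
Hypotheses (l1_I : carries l1 I) (l2_I : carries l2 I).
Hypotheses (l1_mean : L1 l1 (fun x => x : R)) (l2_mean : L1 l2 (fun x => x : R)).
Hypothesis pi_mt : martingale_transport I l1 l2 pi.
Variables g f : measurableTypeR R -> R.
Hypotheses (bg : bdm g) (f1 : L1 l2 f).

(** Subtracting [r] from [g] and [c0 + c1 * y] from [f] changes both integrals by the same amount.
    After that, the removed mass had contributed products of opposite signs, while each new pairing
    joins factors of equal sign: low [g] meets the heights of [th], high [g] meets those of [rL] and
    [rU]. The gain is strict because [rL] has positive mass and strict signs. *)
Lemma swap_improves (q1 q2 : R) (th rL rU : RR R -> R) (r c0 c1 : R) :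
  q1 < q2 -> bdm th -> bdm rL -> bdm rU ->
  (forall z, 0 <= th z) -> (forall z, 0 <= rL z) -> (forall z, 0 <= rU z) ->
  (forall z, th z + rL z + rU z <= 1) ->
  (forall z, th z != 0 -> q1 <= z.2 <= q2) ->
  (forall z, rL z != 0 -> z.2 <= q1) -> (forall z, rU z != 0 -> q2 <= z.2) ->
  0 < Ex pi rL -> 0 < Ex pi rU -> Ex pi th = Ex pi rL + Ex pi rU ->
  (forall p : measurableTypeR R -> R, bdm p ->
    Ex pi th * (Ex pi (fun z => p z.1 * z.2 * rL z) +
                Ex pi (fun z => p z.1 * z.2 * rU z)) =
    Ex pi (fun z => z.2 * th z) *
     (Ex pi (fun z => p z.1 * rL z) + Ex pi (fun z => p z.1 * rU z))) ->
  (forall z, th z != 0 -> r <= g z.1 /\ f z.2 <= c0 + c1 * z.2) ->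
  (forall z, rL z != 0 -> g z.1 < r /\ c0 + c1 * z.2 < f z.2) ->
  (forall z, rU z != 0 -> g z.1 < r /\ c0 + c1 * z.2 < f z.2) ->
  exists2 nu : prob2 R, martingale_transport I l1 l2 nu &
    Ex pi (fun z => g z.1 * f z.2) < Ex nu (fun z => g z.1 * f z.2).
Proof.
move=> q12 bth brL brU th0 rL0 rU0 le1 thq rLq rUq ML MU ME bal thg rLg rUg.
have [nu [al [be [nu_mt [bal_ bbe_ ab0] thab nuy nuE]]]] :=
  swap_transport l1_I l2_I l1_mean l2_mean pi_mt q12 bth brL brU th0 rL0 rU0
    le1 thq rLq rUq ML MU ME bal.
exists nu => //.
pose G x := g x - r; pose e y := f y - (c0 + c1 * y).
have bG : bdm G by apply: bdmB => //; exact: bdm_cst.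
have e1 : L1 l2 e.
  exact: L1B f1 (L1D (L1_cst l2 c0) (L1Z c1 l2_mean)).
have mt_facts (mu : prob2 R) : martingale_transport I l1 l2 mu ->
  Ex mu (fun z => g z.1 * f z.2) = Ex mu (fun z => G z.1 * e z.2) +
    r * Ex l2 e + c0 * Ex l1 g + c1 * Ex mu (fun z => g z.1 * z.2).
  move=> mu_mt; have [e1mu <-] := mt_L1_comp_snd mu_mt e1.
  have [g1mu <-] := mt_L1_comp_fst mu_mt (L1_bdm _ bg).
  have y1mu := mt_L1_snd mu_mt.
  have bgmu : bdm (fun z : RR R => g z.1) by exact: (bdm_comp measurable_fst bg).
  have bGmu : bdm (fun z : RR R => G z.1) by exact: (bdm_comp measurable_fst bG).
  have gy := L1_bdmM bgmu y1mu; have Ge := L1_bdmM bGmu e1mu.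
  have H1 := L1D Ge (L1Z r e1mu); have H2 := L1D H1 (L1Z c0 g1mu).
  rewrite -(ExZ r e1mu) -(ExZ c0 g1mu) -(ExZ c1 gy) -(ExD Ge (L1Z r e1mu)).
  rewrite -(ExD H1 (L1Z c0 g1mu)) -(ExD H2 (L1Z c1 gy)).
  by apply: Ex_eq => z; rewrite /G /e; ring.
rewrite (mt_facts pi pi_mt) (mt_facts nu nu_mt) (nuy _ bg) 3!ltrD2r.
have [e1pi _] := mt_L1_comp_snd pi_mt e1.
rewrite (nuE G e bG (L1_measurable e1) e1pi).
have bGpi : bdm (fun z : RR R => G z.1) by exact: (bdm_comp measurable_fst bG).
have Ge := L1_bdmM bGpi e1pi.
have L1r (q s : RR R -> R) : L1 pi q -> bdm s -> L1 pi (fun z => q z * s z).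
  by move=> q1' bs; apply: L1_eq (L1_bdmM bs q1') => z; rewrite mulrC.
have Ex_sgn (h s : RR R -> R) : (forall z, 0 <= s z) ->
    (forall z, s z != 0 -> 0 <= h z) -> 0 <= Ex pi (fun z => h z * s z).
  move=> s0 hs; apply: Ex_ge0 => z; have [->|sz] := eqVneq (s z) 0.
    by rewrite mulr0.
  by rewrite mulr_ge0// hs.
have Ex_sgnN (h s : RR R -> R) : L1 pi h -> bdm s -> (forall z, 0 <= s z) ->
    (forall z, s z != 0 -> h z <= 0) -> Ex pi (fun z => h z * s z) <= 0.
  move=> h1 bs s0 hs; rewrite -oppr_ge0 -mulN1r -ExZ; last exact: L1r.
  rewrite (Ex_eq pi (g := fun z => - h z * s z)); last by move=> z; ring.
  by apply: Ex_sgn => // z /hs; rewrite oppr_ge0.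
have Gpi : L1 pi (fun z => G z.1) by exact: L1_bdm.
have thS z : th z != 0 -> 0 <= G z.1 /\ e z.2 <= 0.
  by move=> /thg[? ?]; rewrite subr_ge0 subr_le0.
have rLS z : rL z != 0 -> G z.1 < 0 /\ 0 < e z.2.
  by move=> /rLg[? ?]; rewrite subr_gt0 subr_lt0.
have rUS z : rU z != 0 -> G z.1 < 0 /\ 0 < e z.2.
  by move=> /rUg[? ?]; rewrite subr_gt0 subr_lt0.
have T1 : Ex pi (fun z => G z.1 * e z.2 * th z) <= 0.
  by apply: Ex_sgnN => // z /thS[? ?]; rewrite mulr_ge0_le0.
have T3 : Ex pi (fun z => G z.1 * e z.2 * rU z) <= 0.
  by apply: Ex_sgnN => // z /rUS[? ?]; rewrite mulr_le0_ge0// ltW.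
have T2 : Ex pi (fun z => G z.1 * e z.2 * rL z) < 0.
  rewrite lt_neqAle; apply/andP; split; last first.
    by apply: Ex_sgnN => // z /rLS[? ?]; rewrite mulr_le0_ge0// ltW.
  apply/eqP => T20; suff : Ex pi rL = 0 by move/eqP; rewrite (gt_eqF ML).
  rewrite -(Ex_cst pi 0); apply: Ex_ae => //; first by case: brL.
  have : Ex pi (fun z => - (G z.1 * e z.2 * rL z)) = 0.
    rewrite (Ex_eq pi (g := fun z => -1 * (G z.1 * e z.2 * rL z))).
      by rewrite ExZ ?T20 ?mulr0//; exact: L1r.
    by move=> z; rewrite mulN1r.
  have Ge0 z : 0 <= - (G z.1 * e z.2 * rL z).
    have [->|/rLS[G0 e0]] := eqVneq (rL z) 0; first by rewrite mulr0 oppr0.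
    by rewrite oppr_ge0 mulr_le0_ge0// mulr_le0_ge0 ?ltW.
  move/(Ex_ge0_eq0 (L1N (L1r _ _ Ge brL)) Ge0); apply: filterS => z /eqP.
  rewrite oppr_eq0 mulf_eq0 => /orP[|/eqP//].
  have [//|/rLS[G0 e0]] := eqVneq (rL z) 0.
  by rewrite mulf_eq0 (lt_eqF G0) (gt_eqF e0).
have T4 : 0 <= (Ex pi (fun z => G z.1 * rL z) + Ex pi (fun z => G z.1 * rU z)) *
    Ex pi (fun z => e z.2 * th z) / Ex pi th.
  rewrite divr_ge0//; last exact: Ex_ge0.
  rewrite mulr_le0// ?ler_wnDl//; apply: Ex_sgnN => // z.
  - by move=> /rLS[? _]; exact: ltW.
  - by move=> /rUS[? _]; exact: ltW.
  - by move=> /thS[].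
have T5 : 0 <= Ex pi (fun z => G z.1 * al z) * Ex pi (fun z => e z.2 * rL z).
  rewrite mulr_ge0//; apply: Ex_sgn => // z.
  - by have [] := ab0 z.
  - move=> az; have : th z != 0 by apply: contra_neq az => /thab[].
    by move=> /thS[].
  - by move=> /rLS[_ ?]; exact: ltW.
have T6 : 0 <= Ex pi (fun z => G z.1 * be z) * Ex pi (fun z => e z.2 * rU z).
  rewrite mulr_ge0//; apply: Ex_sgn => // z.
  - by have [] := ab0 z.
  - move=> az; have : th z != 0 by apply: contra_neq az => /thab[].
    by move=> /thS[].
  - by move=> /rUS[_ ?]; exact: ltW.
move: T1 T2 T3 T4 T5 T6; clear; move=> *; lra.
Qed.

End improvement.

Lemma strictly_convex_chord (R : realType) (I : set R) (f : R -> R) (a b c : R) :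
  strictly_convex_on I f -> I a -> I c -> a < b -> b < c ->
  (c - a) * f b < (c - b) * f a + (b - a) * f c.
Proof.
move=> fconv Ia Ic ab bc; have ca : 0 < c - a by lra.
pose t := (c - b) / (c - a).
have t01 : 0 < t < 1.
  apply/andP; split; first by rewrite divr_gt0// subr_gt0.
  by rewrite ltr_pdivrMr// mul1r; lra.
have := fconv a c t Ia Ic _ t01; rewrite lt_eqF; last exact: lt_trans ab bc.
move=> /(_ isT); rewrite (_ : t * a + (1 - t) * c = b); last first.
  by rewrite /t; field; rewrite gt_eqF.
rewrite -(ltr_pM2l ca); congr (_ < _).
by rewrite /t; field; rewrite gt_eqF.
Qed.

(** The affine function is the chord of [f] over [q1] and [q2]. The signs are the three-point
    inequality with [y] between, to the left or to the right of them. *)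
Lemma strictly_convex_chord_sign (R : realType) (I : set R) (f : R -> R) (q1 q2 : R) :
  strictly_convex_on I f -> I q1 -> I q2 -> q1 < q2 ->
  exists c0 c1 : R, (forall y, q1 <= y <= q2 -> f y <= c0 + c1 * y) /\
    (forall y, I y -> y < q1 \/ q2 < y -> c0 + c1 * y < f y).
Proof.
move=> fconv Iq1 Iq2 q12; have q21 : 0 < q2 - q1 by lra.
pose c1 := (f q2 - f q1) / (q2 - q1).
have c1E : c1 * (q2 - q1) = f q2 - f q1 by rewrite divfK// gt_eqF.
exists (f q1 - c1 * q1), c1; split=> [y /andP[]|y Iy].
  rewrite le_eqVlt => /predU1P[<- _|q1y]; first by rewrite subrK.
  rewrite le_eqVlt => /predU1P[->|yq2]; first by move: c1E; lra.
  have := strictly_convex_chord fconv Iq1 Iq2 q1y yq2.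
  by rewrite -(ler_pM2l q21); nra.
by case=> yq; rewrite -(ltr_pM2l q21);
  [have := strictly_convex_chord fconv Iy Iq2 yq q12|
   have := strictly_convex_chord fconv Iq1 Iy q12 yq]; nra.
Qed.

Section maximality.
Variables (R : realType) (I : set R) (l1 l2 : prob1 R) (pi : prob2 R).
Hypothesis I_itv : is_interval I.
Hypotheses (l1_I : carries l1 I) (l2_I : carries l2 I).
Hypotheses (l1_mean : L1 l1 (fun x => x : R)) (l2_mean : L1 l2 (fun x => x : R)).
Hypothesis pi_mt : martingale_transport I l1 l2 pi.
Variables g f : measurableTypeR R -> R.
Hypotheses (bg : bdm g) (f1 : L1 l2 f) (f_conv : strictly_convex_on I f).
Hypothesis pi_max : forall nu, martingale_transport I l1 l2 nu ->
  Ex nu (fun z => g z.1 * f z.2) <= Ex pi (fun z => g z.1 * f z.2).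

(* If F = {g >= r} x ]q1, q2[ has positive mass and mean height zz, weight the
   points of {g < r} below q1 and above q2 so that, in each fibre, their mean
   height is zz. Exchanging them with F would strictly increase the integral,
   so the weighted mass vanishes: almost every fibre over {g < r} stays above
   q1 or below q2. *)
Lemma maximal_null (q1 q2 r : R) : I q1 -> I q2 -> q1 < q2 ->
  exists N : set (RR R), [/\ measurable N, pi N = 0%E &
    forall x x' y1 y' y2 : R, I y1 -> I y2 -> g x < r -> r <= g x' ->
      y1 < q1 -> q1 < y' < q2 -> q2 < y2 ->
      [\/ N (x', y'), N (x, y1) | N (x, y2)]].
Proof.
move=> Iq1 Iq2 q12; have [mI _] := l1_I.
pose GE : set (measurableTypeR R) := [set x | r <= g x].
pose GL : set (measurableTypeR R) := [set x | g x < r].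
have mg : measurable_fun setT g by case: bg.
have mGE : measurable GE.
  rewrite (_ : GE = setT `&` g @^-1` `[r, +oo[%classic); first exact: mg.
  by apply/seteqP; split=> x /=; rewrite in_itv /= andbT; [move=> ?; split|case].
have mGL : measurable GL.
  rewrite (_ : GL = setT `&` g @^-1` `]-oo, r[%classic); first exact: mg.
  by apply/seteqP; split=> x /=; rewrite in_itv /=; [move=> ?; split|case].
pose Q : set (measurableTypeR R) := `]q1, q2[%classic.
have mQ : measurable Q by exact: measurable_itv.
pose F : set (RR R) := GE `*` Q.
have mF : measurable F by exact: measurableX.
have [F0|F0] := pselect (pi F = 0%E).
  exists F; split=> // x x' y1 y' y2 _ _ _ gx' _ y'q _; apply: Or31.
  by split=> //=; rewrite /Q /= in_itv.
pose L : set (measurableTypeR R) := I `&` `]-oo, q1[%classic.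
pose U : set (measurableTypeR R) := I `&` `]q2, +oo[%classic.
have mL : measurable L by apply: measurableI => //; exact: measurable_itv.
have mU : measurable U by apply: measurableI => //; exact: measurable_itv.
pose pF := Ex pi \1_F.
have pF_gt0 : 0 < pF.
  rewrite /pF Ex_indic// fine_gt0// lt0e measure_ge0 andbT.
  apply/andP; split; first exact/eqP.
  by rewrite -ge0_fin_numE// fin_num_measure.
have y1 := mt_L1_snd pi_mt.
pose zz := Ex pi (fun z => z.2 * \1_F z) / pF.
have yF : L1 pi (fun z => z.2 * \1_F z).
  by apply: L1_eq (L1_bdmM (bdm_indic R mF) y1) => z; rewrite mulrC.
have zz_ge : q1 <= zz.
  rewrite ler_pdivlMr// -ExZ; last exact: L1_indic.
  apply: Ex_le => //; first exact/L1Z/L1_indic.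
  move=> z; rewrite indicE; have [|_] := boolP (z \in F); last by rewrite !mulr0.
  by rewrite inE => -[_ /=]; rewrite /Q /= in_itv /= => /andP[? _]; rewrite !mulr1 ltW.
have zz_le : zz <= q2.
  rewrite ler_pdivrMr// -ExZ; last exact: L1_indic.
  apply: Ex_le => //; first exact/L1Z/L1_indic.
  move=> z; rewrite indicE; have [|_] := boolP (z \in F); last by rewrite !mulr0.
  by rewrite inE => -[_ /=]; rewrite /Q /= in_itv /= => /andP[_ ?]; rewrite !mulr1 ltW.
have bLz : bdm (fun z : RR R => \1_L z.2 : R).
  exact: (bdm_comp measurable_snd (bdm_indic R mL)).
have bUz : bdm (fun z : RR R => \1_U z.2 : R).
  exact: (bdm_comp measurable_snd (bdm_indic R mU)).
(* Distances to [zz], below [q1] and above [q2]. They are nonnegative because the mean height [zz]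
   of [F] lies between [q1] and [q2]. *)
pose hL (z : RR R) : R := \1_L z.2 * (zz - z.2).
pose hU (z : RR R) : R := \1_U z.2 * (z.2 - zz).
have hL1 : L1 pi hL by exact: L1_bdmM bLz (L1B (L1_cst pi zz) y1).
have hU1 : L1 pi hU by exact: L1_bdmM bUz (L1B y1 (L1_cst pi zz)).
have hL0 z : 0 <= hL z.
  rewrite /hL indicE; have [|_] := boolP (z.2 \in L); last by rewrite mul0r.
  rewrite inE => -[_ /=]; rewrite in_itv /= => zq; rewrite mul1r subr_ge0 ltW//.
  exact: lt_le_trans zz_ge.
have hU0 z : 0 <= hU z.
  rewrite /hU indicE; have [|_] := boolP (z.2 \in U); last by rewrite mul0r.
  rewrite inE => -[_ /=]; rewrite in_itv /= andbT => zq; rewrite mul1r subr_ge0 ltW//.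
  exact: le_lt_trans zq.
have [D [mD D0 DE]] := cond_exp_ge0 measurable_fst (mt_fst pi_mt) hL1 hL0.
have [V [mV V0 VE]] := cond_exp_ge0 measurable_fst (mt_fst pi_mt) hU1 hU0.
have CE (h E : RR R -> R) (e : measurableTypeR R -> R) (p : measurableTypeR R -> R) :
    L1 pi h ->
    (forall p : measurableTypeR R -> R, measurable_fun setT p ->
      (forall x, 0 <= p x) -> L1 pi (fun t => p t.1 * h t) ->
      L1 pi (fun t => p t.1 * e t.1) /\
      Ex pi (fun t => p t.1 * h t) = Ex pi (fun t => p t.1 * e t.1)) ->
    bdm p -> (forall x, 0 <= p x) ->
    Ex pi (fun z => p z.1 * h z) = Ex pi (fun z => p z.1 * e z.1).
  move=> h1 H bp p0; have [mp _] := bp.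
  by have [] := H p mp p0 (L1_bdmM (bdm_comp measurable_fst bp) h1).
pose p0 : measurableTypeR R -> R := \1_GL.
have bp0 : bdm p0 by exact: bdm_indic.
have p00 x : 0 <= p0 x by rewrite /p0 indicE.
(* [D] and [V] are the conditional expectations of [hL] and [hU]. The weights [a] below and [b]
   above satisfy [a * D = b * V], which balances each fibre about [zz]. Where [D + V = 0] both
   weights are 0, since division by 0 gives 0. *)
pose a x := V x / (D x + V x); pose b x := D x / (D x + V x).
have a0 x : 0 <= a x by rewrite divr_ge0// addr_ge0.
have b0 x : 0 <= b x by rewrite divr_ge0// addr_ge0.
have ab1 x : a x + b x <= 1.
  rewrite -mulrDl addrC; have [->|DV] := eqVneq (D x + V x) 0.
    by rewrite mul0r.
  by rewrite divff.
have abE x : a x * D x = b x * V x by rewrite /a /b; ring.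
have mDV : measurable_fun setT (fun x => (D x + V x)^-1).
  rewrite (_ : (fun x => _) = fun x => powR (D x + V x) (-1)).
    apply: (measurableT_comp (measurable_powR _)); exact: measurable_funD.
  by apply/funext => x; rewrite powR_inv1// addr_ge0.
have ba : bdm a.
  split; first exact: measurable_funM.
  by exists 1 => x; rewrite ger0_norm//; have := ab1 x; have := b0 x; lra.
have bb : bdm b.
  split; first exact: measurable_funM.
  by exists 1 => x; rewrite ger0_norm//; have := ab1 x; have := a0 x; lra.
have pp x (p q : measurableTypeR R -> R) : (forall x, 0 <= p x) ->
  (forall x, 0 <= q x) -> 0 <= p x * q x by move=> ? ?; exact: mulr_ge0.
have bal (p : measurableTypeR R -> R) : bdm p ->
    Ex pi (fun z => p z.1 * (p0 z.1 * a z.1) * hL z) =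
    Ex pi (fun z => p z.1 * (p0 z.1 * b z.1) * hU z).
  (* Conditional expectations are available against nonnegative functions only: a bounded [p] is
     shifted by its bound [c], and the identity for the constant [c] is subtracted. *)
  have bal0 (q : measurableTypeR R -> R) : bdm q -> (forall x, 0 <= q x) ->
      Ex pi (fun z => q z.1 * (p0 z.1 * a z.1) * hL z) =
      Ex pi (fun z => q z.1 * (p0 z.1 * b z.1) * hU z).
    move=> bq q0.
    rewrite (CE hL hL D (fun x => q x * (p0 x * a x)))//; last 2 first.
    - by apply: bdmM => //; exact: bdmM.
    - by move=> x; rewrite mulr_ge0// mulr_ge0.
    rewrite (CE hU hU V (fun x => q x * (p0 x * b x)))//; last 2 first.
    - by apply: bdmM => //; exact: bdmM.
    - by move=> x; rewrite mulr_ge0// mulr_ge0.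
    apply: Ex_eq => z; have E := abE z.1.
    transitivity (q z.1 * p0 z.1 * (a z.1 * D z.1)); first by rewrite !mulrA.
    by rewrite E !mulrA.
  move=> bp; have [mp [c pc]] := bp.
  have bc : bdm (fun _ : measurableTypeR R => c) by exact: bdm_cst.
  have c0 : 0 <= c by exact: le_trans (pc q1).
  have pc0 x : 0 <= p x + c by have := pc x; rewrite ler_norml => /andP[? _]; lra.
  have := bal0 _ (bdmD bp bc) pc0; have := bal0 _ bc (fun=> c0).
  have L1h (q : measurableTypeR R -> R) (h : RR R -> R) : bdm q -> L1 pi h ->
      L1 pi (fun z => q z.1 * h z).
    by move=> bq h1; exact: L1_bdmM (bdm_comp measurable_fst bq) h1.
  have lin (q : measurableTypeR R -> R) (h : RR R -> R) : bdm q -> L1 pi h ->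
      Ex pi (fun z => (p z.1 + c) * q z.1 * h z) =
      Ex pi (fun z => p z.1 * q z.1 * h z) + Ex pi (fun z => c * q z.1 * h z).
    move=> bq h1; rewrite -ExD.
    - by apply: Ex_eq => z; ring.
    - exact: (L1h (fun x => p x * q x) h (bdmM bp bq) h1).
    - exact: (L1h (fun x => c * q x) h (bdmM bc bq) h1).
  rewrite (lin _ _ (bdmM bp0 ba) hL1) (lin _ _ (bdmM bp0 bb) hU1) => ->.
  by move/addIr.
pose sL (z : RR R) : R := p0 z.1 * a z.1 * \1_L z.2.
pose sU (z : RR R) : R := p0 z.1 * b z.1 * \1_U z.2.
have bp0a : bdm (fun z : RR R => p0 z.1 * a z.1).
  exact: (bdm_comp measurable_fst (bdmM bp0 ba)).
have bp0b : bdm (fun z : RR R => p0 z.1 * b z.1).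
  exact: (bdm_comp measurable_fst (bdmM bp0 bb)).
have bsL : bdm sL by exact: bdmM.
have bsU : bdm sU by exact: bdmM.
have sL0 z : 0 <= sL z by rewrite /sL mulr_ge0 ?indicE// mulr_ge0.
have sU0 z : 0 <= sU z by rewrite /sU mulr_ge0 ?indicE// mulr_ge0.
have sLP z : sL z != 0 -> g z.1 < r /\ L z.2.
  rewrite /sL /p0 !indicE; have [|_] := boolP (z.1 \in GL); last first.
    by rewrite !mul0r eqxx.
  have [|_] := boolP (z.2 \in L); last by rewrite mulr0 eqxx.
  by rewrite !inE.
have sUP z : sU z != 0 -> g z.1 < r /\ U z.2.
  rewrite /sU /p0 !indicE; have [|_] := boolP (z.1 \in GL); last first.
    by rewrite !mul0r eqxx.
  have [|_] := boolP (z.2 \in U); last by rewrite mulr0 eqxx.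
  by rewrite !inE.
have LU y : L y -> U y -> False.
  move=> [_ /=]; rewrite in_itv /= => yq [_ /=]; rewrite in_itv /= andbT => qy.
  by have := lt_trans q12 qy; rewrite ltNge ltW.
have i0 (A : set (measurableTypeR R)) x : 0 <= \1_A x :> R by rewrite indicE.
have i1 (A : set (measurableTypeR R)) x : \1_A x <= 1 :> R.
  by rewrite indicE; case: (x \in A).
have sLU1 z : sL z + sU z <= 1.
  have [a1 b1] : a z.1 <= 1 /\ b z.1 <= 1.
    by split; have := ab1 z.1; [have := b0 z.1|have := a0 z.1]; lra.
  have p01 : p0 z.1 <= 1 by rewrite /p0 indicE; case: (_ \in _).
  have [->|/sLP[_ zL]] := eqVneq (sL z) 0; last first.
    have [->|/sUP[_ /(LU _ zL)//]] := eqVneq (sU z) 0.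
    by rewrite addr0; apply: mulr_ile1 => //; [exact: mulr_ge0|exact: mulr_ile1].
  by rewrite add0r; apply: mulr_ile1 => //; [exact: mulr_ge0|exact: mulr_ile1].
pose K := Ex pi (fun z => p0 z.1 * b z.1 * hU z).
have KE : K = Ex pi (fun z => p0 z.1 * a z.1 * hL z).
  have := bal _ (bdm_cst _ 1).
  have e1 (h : RR R -> R) (q : measurableTypeR R -> R) :
      Ex pi (fun z => 1 * q z.1 * h z) = Ex pi (fun z => q z.1 * h z).
    by apply: Ex_eq => z; rewrite mul1r.
  by rewrite (e1 hL (fun x => p0 x * a x)) (e1 hU (fun x => p0 x * b x)).
have sLhE z : p0 z.1 * a z.1 * hL z = sL z * (zz - z.2) by rewrite /hL /sL mulrA.
have sUhE z : p0 z.1 * b z.1 * hU z = sU z * (z.2 - zz) by rewrite /hU /sU mulrA.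
have L1sL (h : RR R -> R) : L1 pi h -> L1 pi (fun z => sL z * h z) by exact: L1_bdmM.
have L1sU (h : RR R -> R) : L1 pi h -> L1 pi (fun z => sU z * h z) by exact: L1_bdmM.
have Ezero (s h : RR R -> R) : bdm s -> L1 pi h -> (forall z, 0 <= s z) ->
    Ex pi s = 0 -> Ex pi (fun z => s z * h z) = 0.
  move=> bs h1 s0 /(Ex_ge0_eq0 (L1_bdm _ bs) s0) ae0.
  rewrite -[RHS](Ex_cst pi 0); apply: Ex_ae => //.
    exact: L1_measurable (L1_bdmM bs h1).
  by apply: filterS ae0 => z ->; rewrite mul0r.
(* [K] is the common first moment about [zz] of the two weighted masses. If it is nonzero, both
   masses are positive and can be exchanged with the mass on [F]. *)
have K0 : K = 0.
  have [//|Kneq0] := eqVneq K 0; exfalso.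
  have EL : 0 < Ex pi sL.
    rewrite lt_neqAle Ex_ge0// andbT; apply/eqP => /esym EL0; move/eqP : Kneq0; apply.
    rewrite KE (Ex_eq _ sLhE).
    exact: (Ezero sL _ bsL (L1B (L1_cst pi zz) y1) sL0 EL0).
  have EU : 0 < Ex pi sU.
    rewrite lt_neqAle Ex_ge0// andbT; apply/eqP => /esym EU0; move/eqP : Kneq0; apply.
    rewrite /K (Ex_eq _ sUhE).
    exact: (Ezero sU _ bsU (L1B y1 (L1_cst pi zz)) sU0 EU0).
  have [c0 [c1 [cin cout]]] := strictly_convex_chord_sign f_conv Iq1 Iq2 q12.
  pose E0 := Ex pi sL + Ex pi sU.
  have L1s : L1 pi sL by exact: L1_bdm.
  have L1t : L1 pi sU by exact: L1_bdm.
  have E0_gt0 : 0 < E0 by rewrite addr_gt0.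
  have E0_le1 : E0 <= 1.
    rewrite /E0 -ExD// -(Ex_cst pi 1); apply: Ex_le => //.
      exact: L1D.
    exact: L1_cst.
  have pF_le1 : pF <= 1.
    rewrite -(Ex_cst pi 1); apply: Ex_le => //; first exact: L1_indic.
      exact: L1_cst.
  (* Each side is scaled by the total mass of the other, which makes the exchanged masses equal. The
     weights add up to at most 1 because [E0] and [pF] do not exceed 1 and [F] lies over [r <= g]
     while [sL] and [sU] live over [g < r]. *)
  pose th (z : RR R) : R := E0 * \1_F z.
  pose rL (z : RR R) : R := pF * sL z.
  pose rU (z : RR R) : R := pF * sU z.
  have thF z : th z != 0 -> F z.
    by rewrite /th indicE; have [|_] := boolP (z \in F); [rewrite inE|rewrite mulr0 eqxx].
  have rLn z : rL z != 0 -> sL z != 0.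
    by apply: contra_neq => sz; rewrite /rL sz mulr0.
  have rUn z : rU z != 0 -> sU z != 0.
    by apply: contra_neq => sz; rewrite /rU sz mulr0.
  have bth : bdm th by apply: bdmM; [exact: bdm_cst|exact: bdm_indic].
  have brL : bdm rL by apply: bdmM => //; exact: bdm_cst.
  have brU : bdm rU by apply: bdmM => //; exact: bdm_cst.
  have EthE : Ex pi th = E0 * pF by rewrite ExZ//; exact: L1_indic.
  have ErLE : Ex pi rL = pF * Ex pi sL by rewrite ExZ.
  have ErUE : Ex pi rU = pF * Ex pi sU by rewrite ExZ.
  have EythE : Ex pi (fun z => z.2 * th z) = Ex pi th * zz.
    rewrite EthE -mulrA (mulrC pF) /zz divfK ?gt_eqF// -ExZ//.
    by apply: Ex_eq => z; rewrite /th; ring.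
  have [nu nu_mt] : exists2 nu : prob2 R, martingale_transport I l1 l2 nu &
      Ex pi (fun z => g z.1 * f z.2) < Ex nu (fun z => g z.1 * f z.2).
    apply: (swap_improves l1_I l2_I l1_mean l2_mean pi_mt bg f1
      (q1 := q1) (q2 := q2) (th := th) (rL := rL) (rU := rU) (r := r)
      (c0 := c0) (c1 := c1)) => //.
    - by move=> z; rewrite mulr_ge0 ?indicE// ltW.
    - by move=> z; rewrite mulr_ge0// ltW.
    - by move=> z; rewrite mulr_ge0// ltW.
    - move=> z; rewrite /th /rL /rU -addrA -mulrDr indicE.
      have [|_] := boolP (z \in F).
        rewrite inE => -[GEz _]; have [sLz sUz] : sL z = 0 /\ sU z = 0.
          split; apply/eqP; apply: contraT.
            by move=> /sLP[]; rewrite ltNge GEz.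
          by move=> /sUP[]; rewrite ltNge GEz.
        by rewrite sLz sUz addr0 mulr0 addr0 mulr1.
      rewrite mulr0 add0r; apply: mulr_ile1 => //; first exact: ltW.
      exact: addr_ge0.
    - by move=> z /thF[_ /=]; rewrite /Q /= in_itv /= => /andP[? ?]; rewrite !ltW.
    - by move=> z /rLn/sLP[_ [_ /=]]; rewrite in_itv /= => /ltW.
    - by move=> z /rUn/sUP[_ [_ /=]]; rewrite in_itv /= andbT => /ltW.
    - by rewrite ErLE mulr_gt0.
    - by rewrite ErUE mulr_gt0.
    - by rewrite EthE ErLE ErUE -mulrDr mulrC.
    - move=> p bp; rewrite EythE -mulrA; congr (_ * _).
      have bpz : bdm (fun z : RR R => p z.1) by exact: (bdm_comp measurable_fst bp).
      have L1p (s h : RR R -> R) : bdm s -> L1 pi h ->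
          L1 pi (fun z => p z.1 * h z * s z).
        by move=> bs h1; apply: L1_eq (L1_bdmM bs (L1_bdmM bpz h1)) => z; ring.
      have split_h (s : RR R -> R) : bdm s ->
          Ex pi (fun z => p z.1 * (s z * (zz - z.2))) =
          zz * Ex pi (fun z => p z.1 * s z) - Ex pi (fun z => p z.1 * z.2 * s z).
        move=> bs; rewrite -ExZ; last exact: L1_bdmM bpz (L1_bdm _ bs).
        rewrite -ExB; [|exact/L1Z/L1_bdmM/L1_bdm|exact: L1p].
        by apply: Ex_eq => z; ring.
      have E1 : Ex pi (fun z => p z.1 * z.2 * rL z) = pF * Ex pi (fun z => p z.1 * z.2 * sL z).
        by rewrite -ExZ; [apply: Ex_eq => z; rewrite /rL; ring|exact: L1p].
      have E2 : Ex pi (fun z => p z.1 * z.2 * rU z) = pF * Ex pi (fun z => p z.1 * z.2 * sU z).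
        by rewrite -ExZ; [apply: Ex_eq => z; rewrite /rU; ring|exact: L1p].
      have E3 : Ex pi (fun z => p z.1 * rL z) = pF * Ex pi (fun z => p z.1 * sL z).
        rewrite -ExZ; last exact: L1_bdmM bpz (L1_bdm _ bsL).
        by apply: Ex_eq => z; rewrite /rL; ring.
      have E4 : Ex pi (fun z => p z.1 * rU z) = pF * Ex pi (fun z => p z.1 * sU z).
        rewrite -ExZ; last exact: L1_bdmM bpz (L1_bdm _ bsU).
        by apply: Ex_eq => z; rewrite /rU; ring.
      have := bal p bp; have := split_h _ bsL; have := split_h _ bsU.
      have -> : Ex pi (fun z => p z.1 * (sU z * (zz - z.2))) =
          - Ex pi (fun z => p z.1 * (p0 z.1 * b z.1) * hU z).
        rewrite -mulN1r -ExZ.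
          by apply: Ex_eq => z; rewrite /sU /hU; ring.
        by apply: L1_eq (L1_bdmM bpz (L1_bdmM bp0b hU1)) => z; rewrite mulrA.
      have -> : Ex pi (fun z => p z.1 * (sL z * (zz - z.2))) =
          Ex pi (fun z => p z.1 * (p0 z.1 * a z.1) * hL z).
        by apply: Ex_eq => z; rewrite /sL /hL; ring.
      rewrite E1 E2 E3 E4; clear.
      set w1 := Ex _ _; set w2 := Ex _ _; set w3 := Ex _ _; set w4 := Ex _ _.
      set w5 := Ex _ _; set w6 := Ex _ _ => A1 A2 A3.
      have : w3 + w6 = zz * (w5 + w2) by lra.
      nra.
    - move=> z /thF[? /=]; rewrite /Q /= in_itv /= => /andP[? ?].
      by split=> //; apply: cin; rewrite !ltW.
    - move=> z /rLn/sLP[? [? /=]]; rewrite in_itv /= => ?.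
      by split=> //; apply: cout => //; left.
    - move=> z /rUn/sUP[? [? /=]]; rewrite in_itv /= andbT => ?.
      by split=> //; apply: cout => //; right.
  by rewrite ltNge pi_max.
(* Over [S] almost no mass lies below [q1], the conditional expectation of [hL] being 0 there. Off
   [S] the weight [b] is positive, so [K = 0] leaves almost no mass above [q2] in the fibres over
   [g < r]. *)
pose S : set (measurableTypeR R) := [set x | D x = 0].
have mS : measurable S.
  by rewrite -[S]setTI; exact: (mD measurableT [set 0] (measurable_set1 0)).
have mN1 : measurable ((GL `&` S) `*` L) by apply: measurableX => //; exact: measurableI.
have mN2 : measurable ((GL `\` S) `*` U) by apply: measurableX => //; exact: measurableD.
exists ((GL `&` S) `*` L `|` (GL `\` S) `*` U); split.
- exact: measurableU.
- apply: null_set_setU => //.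
    apply: (@Ex_eq0_null _ _ _ pi (fun z => \1_S z.1 * hL z)) => //.
    + exact: L1_bdmM (bdm_comp measurable_fst (bdm_indic R mS)) hL1.
    + by move=> z; rewrite mulr_ge0 ?indicE.
    + move=> z [[_ Sz] Lz]; rewrite indicE mem_set// mul1r /hL indicE mem_set// mul1r.
      rewrite subr_gt0 (lt_le_trans _ zz_ge)//.
      by case: Lz => _ /=; rewrite in_itv.
    + rewrite (CE hL hL D \1_S hL1 DE (bdm_indic R mS)); last first.
        by move=> x; rewrite indicE.
      rewrite -[RHS](Ex_cst pi 0); apply: Ex_eq => z; rewrite indicE.
      have [|_] := boolP (z.1 \in S); last by rewrite mul0r.
      by rewrite inE => ->; rewrite mulr0.
  apply: (@Ex_eq0_null _ _ _ pi (fun z => p0 z.1 * b z.1 * hU z)) => //.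
  + exact: L1_bdmM.
  + by move=> z; rewrite mulr_ge0// mulr_ge0.
  + move=> z [[GLz Sz] Uz]; rewrite /p0 indicE mem_set// mul1r.
    have Dgt : 0 < D z.1 by rewrite lt_neqAle D0 andbT eq_sym; exact/eqP.
    rewrite mulr_gt0//; first by rewrite divr_gt0// ltr_wpDr.
    rewrite /hU indicE mem_set// mul1r subr_gt0 (le_lt_trans zz_le)//.
    by case: Uz => _ /=; rewrite in_itv /= andbT.
- move=> x x' y y' y'' Iy Iy'' gx _ yq _ qy''.
  have [Sx|Sx] := pselect (S x).
    by apply: Or32; left; split=> //; split=> //=; rewrite in_itv.
  by apply: Or33; right; split=> //; split=> //=; rewrite in_itv /= andbT.
Qed.

End maximality.

(** * Subgradients, measurability and integrability of strictly convex functions *)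

Section strictly_convex.
Variables (R : realType) (I : set R) (f : R -> R).
Hypotheses (I_open : open I) (I_itv : is_interval I).
Hypothesis f_conv : strictly_convex_on I f.

Lemma open_ltP (x : R) : I x -> exists2 y, I y & x < y.
Proof.
move=> Ix; have : nbhs x I by exact: open_nbhs_nbhs.
move=> /nbhs_ballP[e /= e0 eI]; exists (x + e / 2); last by lra.
by apply: eI; rewrite /ball /= opprD addNKr normrN gtr0_norm; lra.
Qed.

Lemma open_gtP (x : R) : I x -> exists2 y, I y & y < x.
Proof.
move=> Ix; have : nbhs x I by exact: open_nbhs_nbhs.
move=> /nbhs_ballP[e /= e0 eI]; exists (x - e / 2); last by lra.
by apply: eI; rewrite /ball /= opprB addrC subrK gtr0_norm; lra.
Qed.

(** The slope is the left derivative, that is, the supremum of the slopes of the chords ending at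
    [x]. Openness of [I] gives points on both sides: the set of slopes is nonempty, and any chord to
    the right bounds it. *)
Lemma strictly_convex_subgradient (x : R) : I x ->
  exists p, forall y, I y -> f x + p * (y - x) <= f y.
Proof.
move=> Ix; pose E := [set (f x - f s) / (x - s) | s in [set s | I s /\ s < x]].
have E0 : E !=set0.
  by have [s Is sx] := open_gtP Ix; exists ((f x - f s) / (x - s)), s.
have Eub y : I y -> x < y -> ubound E ((f y - f x) / (y - x)).
  move=> Iy xy _ [s [Is sx] <-]; have := strictly_convex_chord f_conv Is Iy sx xy.
  rewrite ler_pdivrMr ?subr_gt0// mulrAC ler_pdivlMr ?subr_gt0//; nra.
exists (sup E) => y Iy; have [yx|xy|->] := ltgtP y x.
- have : (f x - f y) / (x - y) <= sup E.
    apply: ub_le_sup; last by exists y.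
    by have [z Iz xz] := open_ltP Ix; exists ((f z - f x) / (z - x)); exact: Eub.
  by rewrite ler_pdivrMr ?subr_gt0//; lra.
- have : sup E <= (f y - f x) / (y - x) by apply: ge_sup => //; exact: Eub.
  by rewrite ler_pdivlMr ?subr_gt0//; lra.
- by rewrite subrr mulr0 addr0.
Qed.

(** Convexity makes every set [f < r] an interval, hence Borel. *)
Lemma strictly_convex_measurable :
  measurable_fun (I : set (measurableTypeR R)) (f : measurableTypeR R -> R).
Proof.
move=> mI; apply: (measurability _ (RGenCInfty.measurableE R)) => //.
move=> _ [_ [r ->] <-].
rewrite (_ : _ `&` _ = I `\` [set x | I x /\ f x < r]); last first.
  apply/seteqP; split=> x /=; rewrite in_itv /= andbT.
    by move=> [Ix rf]; split=> // -[_]; rewrite ltNge rf.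
  by move=> [Ix H]; split=> //; rewrite leNgt; apply/negP => ?; exact: H.
apply: measurableD => //; apply: is_interval_measurable.
move=> a c [Ia fa] [Ic fc] b /andP[ab bc].
move: ab; rewrite le_eqVlt => /predU1P[<-//|ab].
move: bc; rewrite le_eqVlt => /predU1P[->//|bc].
split; first by apply: (I_itv Ia Ic); rewrite !ltW.
have ca : 0 < c - a by lra.
have chord := strictly_convex_chord f_conv Ia Ic ab bc.
have h1 : 0 < (c - b) * (r - f a) by rewrite mulr_gt0 ?subr_gt0.
have h2 : 0 < (b - a) * (r - f c) by rewrite mulr_gt0 ?subr_gt0.
by rewrite -(ltr_pM2l ca); lra.
Qed.

(** Integrability is assumed for the positive part only. A supporting line bounds the negative part,
    and it is integrable because [l] has a mean. *)
Lemma strictly_convex_L1 (l : prob1 R) : carries l I ->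
  L1 l (fun x => x : R) -> (\int[l]_(x in I) (f^\+ x)%:E < +oo)%E ->
  L1 l (f \_ I).
Proof.
move=> [mI lI] l1 fp.
have mf : measurable_fun setT (f \_ I : measurableTypeR R -> R).
  apply/(measurable_restrict _ _ _) => //; rewrite setTI.
  exact: strictly_convex_measurable.
have [I0|/set0P[x Ix]] := eqVneq I set0.
  apply: L1_eq (L1_cst l 0) => x.
  by rewrite patchE I0 in_set0.
have [p px] := strictly_convex_subgradient Ix.
pose A y := `|f x + p * (y - x)|.
have A1 : L1 l (A : measurableTypeR R -> R).
  apply: L1_norm; apply: (L1D (L1_cst l (f x))).
  by apply: L1Z; apply: (L1B l1); exact: L1_cst.
have fp1 : L1 l ((f^\+ \_ I) : measurableTypeR R -> R).
  apply/integrableP; split.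
    apply/measurable_EFinP.
    apply/(measurable_restrict _ _ _) => //; rewrite setTI.
    exact: (measurable_funrpos strictly_convex_measurable).
  apply: le_lt_trans fp; rewrite [leRHS]integral_mkcond.
  rewrite (_ : (\int[l]_x _)%E = (\int[l]_x ((fun x => (f^\+ x)%:E) \_ I) x)%E)//.
  apply: eq_integral => y _; rewrite /= !patchE; case: (_ \in _) => /=.
    by rewrite ger0_norm// funrpos_ge0.
  by rewrite normr0.
apply: (L1_le mf (L1D fp1 A1)) => y /=; rewrite !patchE.
have [|_] := boolP (y \in I); last by rewrite normr0 add0r /A.
rewrite inE => Iy; have := px y Iy; rewrite /A => H.
have [fy|fy] := leP 0 (f y).
  by rewrite ger0_norm// /funrpos (max_idPl fy) lerDl.
rewrite /funrpos (max_idPr (ltW fy)) add0r ltr0_norm// -normrN (le_trans _ (ler_norm _))// lerN2//.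
Qed.

End strictly_convex.

Lemma rat_between (R : realType) (x y : R) : x < y ->
  exists q : rat, x < ratr q /\ ratr q < y.
Proof.
by move=> /rat_in_itvoo[q]; rewrite in_itv /= => /andP[]; exists q.
Qed.

Lemma null_countable_union d (T : measurableType d) (R : realType)
    (mu : {measure set T -> \bar R}) (K : countType) (N : K -> set T) :
  (forall k, measurable (N k)) -> (forall k, mu (N k) = 0%E) ->
  exists U : set T, [/\ measurable U, mu U = 0%E & forall k, N k `<=` U].
Proof.
move=> mN N0; pose F n := if unpickle n is Some k then N k else set0.
have mF n : measurable (F n) by rewrite /F; case: unpickle.
exists (\bigcup_n F n); split.
- exact: bigcupT_measurable.
- apply/negligibleP; first exact: bigcupT_measurable.
  apply: negligible_bigcup => n; apply: (negligibleP _ (mF n)).2.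
  by rewrite /F; case: unpickle => [k|]; [exact: N0|exact: measure0].
- by move=> k t Nt; exists (pickle k) => //; rewrite /F pickleK.
Qed.

Section maximality.
Variables (R : realType) (I : set R) (l1 l2 : prob1 R) (pi : prob2 R).
Hypothesis I_itv : is_interval I.
Hypotheses (l1_I : carries l1 I) (l2_I : carries l2 I).
Hypotheses (l1_mean : L1 l1 (fun x => x : R)) (l2_mean : L1 l2 (fun x => x : R)).
Hypothesis pi_mt : martingale_transport I l1 l2 pi.
Variables g f : measurableTypeR R -> R.
Hypotheses (bg : bdm g) (f1 : L1 l2 f) (f_conv : strictly_convex_on I f).
Hypothesis pi_max : forall nu, martingale_transport I l1 l2 nu ->
  Ex nu (fun z => g z.1 * f z.2) <= Ex pi (fun z => g z.1 * f z.2).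

(** A violation leaves room for rationals with [y1 < q1 < y' < q2 < y2] and [g x < r < g x'], so
    removing one null set per rational triple removes all violations. Triples with a height outside
    [I], or in the wrong order, get the empty set; they never occur, as [I] is an interval. *)
Lemma maximal_R_curtain : R_curtain I (fun a b => g a < g b) l1 l2 pi.
Proof.
split=> //.
pose ok (t : rat * rat * rat) (N : set (RR R)) := [/\ measurable N, pi N = 0%E &
  I (ratr t.1.1) -> I (ratr t.1.2) -> (ratr t.1.1 : R) < ratr t.1.2 ->
    forall x x' y1 y' y2 : R, I y1 -> I y2 -> g x < ratr t.2 -> ratr t.2 <= g x' ->
      y1 < ratr t.1.1 -> ratr t.1.1 < y' < ratr t.1.2 -> ratr t.1.2 < y2 ->
      [\/ N (x', y'), N (x, y1) | N (x, y2)]].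
have /choice[N NP] : forall t, exists N, ok t N.
  move=> [[q1 q2] r].
  have [Iq1|Iq1] := pselect (I (ratr q1)); last by exists set0.
  have [Iq2|Iq2] := pselect (I (ratr q2)); last by exists set0.
  have [q12|q12] := pselect ((ratr q1 : R) < ratr q2); last by exists set0.
  have [N [mN N0 NP]] := maximal_null l1_I l2_I l1_mean l2_mean pi_mt bg f1
    f_conv pi_max (ratr r) Iq1 Iq2 q12.
  by exists N; split.
have [U [mU U0 NU]] := null_countable_union (fun t => let: And3 m _ _ := NP t in m)
  (fun t => let: And3 _ n _ := NP t in n).
have [mII II0] := mt_carries pi_mt.
exists ((I `*` I) `\` U); split.
- by move=> z [].
- split; first exact: measurableD.
  apply/negligibleP; first exact/measurableC/measurableD.
  rewrite setDE setCI setCK; apply: negligibleU.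
    by apply/negligibleP => //; exact: measurableC.
  exact/negligibleP.
- move=> x x' y1 y' y2 [[/= Ix' Iy'] N'] [[/= Ix Iy1] N1] [[_ /= Iy2] N2] gxx'.
  move=> /andP[y1y' y'y2].
  have [q1 [yq1 q1y']] := rat_between y1y'.
  have [q2 [y'q2 q2y]] := rat_between y'y2.
  have [r [gxr rgx]] := rat_between gxx'.
  have [_ _ /= H] := NP (q1, q2, r).
  have Iq1 : I (ratr q1) by apply: (I_itv Iy1 Iy'); rewrite !ltW.
  have Iq2 : I (ratr q2) by apply: (I_itv Iy' Iy2); rewrite !ltW.
  have q12 := lt_trans q1y' y'q2.
  have q1q2 : ratr q1 < y' < ratr q2 by rewrite q1y'.
  by have [/NU|/NU|/NU] := H Iq1 Iq2 q12 _ _ _ _ _ Iy1 Iy2 gxr (ltW rgx) yq1 q1q2 q2y.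
Qed.

End maximality.

(** * From functions on the interval to functions on the line *)

Section restriction.
Variables (R : realType) (I : set R) (l1 l2 : prob1 R).
Hypotheses (l1_I : carries l1 I) (l2_I : carries l2 I).

Lemma carried_mean (l : prob1 R) : carries l I ->
  l.-integrable I EFin -> L1 l (fun x => x : R).
Proof.
move=> [mI lI] mean; rewrite /L1.
rewrite (negligible_integrable (measurableC mI))//; last exact/measurable_EFinP.
by rewrite setDE setTI setCK.
Qed.

Lemma restrict_bdm (g : R -> R) :
  [bounded g x | x in I] -> measurable (I : set (measurableTypeR R)) ->
  measurable_fun (I : set (measurableTypeR R)) (g : _ -> measurableTypeR R) ->
  bdm (g \_ I : measurableTypeR R -> R).
Proof.
move=> [M [_ Mg]] mI mg; split.
  by apply/(measurable_restrict _ _ _) => //; rewrite setTI.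
(* Only the numbers above [M] are known to be bounds, whence the added 1; the absolute value covers
   the zero values outside [I]. *)
exists (`|M| + 1) => x; rewrite patchE; case: ifPn => [|_].
  by rewrite inE => Ix; apply: Mg => //; rewrite (le_lt_trans (ler_norm M))// ltrDl.
by rewrite normr0 addr_ge0.
Qed.

(** Extension by 0 outside [I] turns the integral over the square into one over the plane, where the
    calculus of [Ex] applies. *)
Lemma integral_tensor (nu : prob2 R) (g f : R -> R) :
  martingale_transport I l1 l2 nu -> bdm (g \_ I : measurableTypeR R -> R) ->
  L1 l2 (f \_ I : measurableTypeR R -> R) ->
  (\int[nu]_(z in I `*` I) (tensor g f z)%:E =
   (Ex nu (fun z => (g \_ I) z.1 * (f \_ I) z.2))%:E)%E.
Proof.
move=> nu_mt bg f1; have [f1nu _] := mt_L1_comp_snd nu_mt f1.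
rewrite -ExE; last exact: (L1_bdmM (bdm_comp measurable_fst bg) f1nu).
rewrite integral_mkcond; apply: eq_integral => -[x y] _.
rewrite !patchE in_setX /tensor /=.
by case: (x \in I); case: (y \in I); rewrite ?mulr0 ?mul0r.
Qed.

End restriction.

Lemma R_curtain_sub (R : realType) (I : set R) (rel rel' : R -> R -> Prop)
    (l1 l2 : prob1 R) (nu : prob2 R) :
  (forall x x', I x -> I x' -> rel' x x' -> rel x x') ->
  R_curtain I rel l1 l2 nu -> R_curtain I rel' l1 l2 nu.
Proof.
move=> relS [nu_mt [Gam [GI Gnu GP]]]; split=> //; exists Gam; split=> //.
move=> x x' y1 y' y2 G1 G2 G3 xx'; apply: (GP _ _ _ _ _ G1 G2 G3).
by apply: relS xx'; [have [] := GI _ G2|have [] := GI _ G1].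
Qed.

(** Over [A] distinct abscissas have distinct values of [g]. Of the two nestings that a curtain
    forbids jointly, the one placing a point over the larger value inside the fibre over the smaller
    is then already excluded. Fibres outside [A] are dropped from the carrying set. *)
Lemma R_curtain_curtain (R : realType) (I : set R) (g : R -> R)
    (l1 l2 : prob1 R) (nu : prob2 R) (A : set R) :
  carries l1 A -> set_inj A g ->
  R_curtain I (fun a b => g a < g b) l1 l2 nu -> curtain I l1 l2 nu.
Proof.
move=> [mA l1A] g_inj [nu_mt [Gam [GI [mG G0] GP]]]; split=> //.
have mA' : measurable (fst @^-1` A : set (RR R)).
  by rewrite -[X in measurable X]setTI; exact: measurable_fst.
exists (Gam `&` fst @^-1` A); split.
- by move=> z [/GI].
- split; first exact: measurableI.
  apply/negligibleP; first exact/measurableC/measurableI.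
  rewrite setCI; apply: negligibleU; apply/negligibleP => //.
  - exact: measurableC.
  - exact: measurableC.
  - by have := mt_fst nu_mt (measurableC mA); rewrite l1A.
- move=> x x' y y1 y2 y' y1' y2' [G1 /= Ax] [G2 _] [G3 _] [G1' /= Ax'] [G2' _].
  move=> [G3' _] xx' [yy yy']; have [gxx'|gx'x|gxx'] := ltgtP (g x) (g x').
  + exact: GP G1' G2 G3 gxx' yy.
  + exact: GP G1 G2' G3' gx'x yy'.
  + by move/eqP : xx'; apply; apply: g_inj gxx'; exact: mem_set.
Qed.

Section maximizers.
Variables (R : realType) (I : set R) (l1 l2 : prob1 R).
Hypotheses (I_open : open I) (I_itv : is_interval I).
Hypotheses (l1_I : carries l1 I) (l2_I : carries l2 I).
Hypotheses (l1_mean : l1.-integrable I EFin) (l2_mean : l2.-integrable I EFin).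

Lemma maximizes_R_curtain (g f : R -> R) (pi : prob2 R) :
  [bounded g x | x in I] ->
  measurable_fun (I : set (measurableTypeR R)) (g : _ -> measurableTypeR R) ->
  strictly_convex_on I f ->
  (\int[l2]_(x in I) (f^\+ x)%:E < +oo)%E ->
  maximizes I l1 l2 (tensor g f) pi ->
  R_curtain I (fun a b => g a < g b) l1 l2 pi.
Proof.
move=> gb mg f_conv fp [pi_mt pi_max].
have [mI _] := l1_I; have bg := restrict_bdm gb mI mg.
have l1m := carried_mean l1_I l1_mean; have l2m := carried_mean l2_I l2_mean.
have f1 := strictly_convex_L1 I_open I_itv f_conv l2_I l2m fp.
apply: (@R_curtain_sub _ _ (fun a b => (g \_ I) a < (g \_ I) b)).
  by move=> x x' Ix Ix'; rewrite !patchE !mem_set.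
apply: (maximal_R_curtain I_itv l1_I l2_I l1m l2m pi_mt bg f1).
  move=> x y t Ix Iy xy t01; rewrite !patchE !mem_set//; first exact: f_conv.
  move/andP : t01 => [t0 t1].
  have [xy'|yx] := leP x y.
    by apply: (I_itv Ix Iy); apply/andP; split; nra.
  by apply: (I_itv Iy Ix); apply/andP; split; nra.
move=> nu nu_mt; rewrite -lee_fin.
rewrite -(integral_tensor nu_mt bg f1) -(integral_tensor pi_mt bg f1).
exact: pi_max.
Qed.

End maximizers.

(** * Hinge functions and the convex order *)

Definition hinge (R : realType) (t y : R) : R := Num.max (y - t) 0.

Lemma hinge_ge0 (R : realType) (t y : R) : 0 <= hinge t y.
Proof. by rewrite /hinge le_max lexx orbT. Qed.

Lemma hingeE (R : realType) (t y : R) : t <= y -> hinge t y = y - t.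
Proof. by move=> ty; rewrite /hinge (max_idPl _)// subr_ge0. Qed.

Lemma hinge0 (R : realType) (t y : R) : y <= t -> hinge t y = 0.
Proof. by move=> yt; rewrite /hinge (max_idPr _)// subr_le0. Qed.

Lemma L1_posaffine (R : realType) (l : prob1 R) (c d : R) :
  L1 l (fun x => x : R) -> L1 l (fun x => Num.max (c + d * x) 0).
Proof.
move=> l1.
have A1 : L1 l (fun x => c + d * x) by exact: (L1D (L1_cst l c) (L1Z d l1)).
apply: (L1_le _ (L1_norm A1)).
  by apply: measurable_maxr => //; exact: L1_measurable A1.
move=> x; rewrite ger0_norm ?le_max ?lexx ?orbT//.
by rewrite ge_max ler_norm normr_ge0.
Qed.

Lemma L1_hinge (R : realType) (l : prob1 R) (t : R) :
  L1 l (fun x => x : R) -> L1 l (hinge t).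
Proof.
move=> /(L1_posaffine (- t) 1); apply: L1_eq => x.
by rewrite /hinge mul1r addrC.
Qed.

(* The interior of the convex hull of the fibre of Gam over x. *)
Definition hull (R : realType) (Gam : set (RR R)) (x : R) : set R :=
  [set y | exists y1 y2, [/\ Gam (x, y1), Gam (x, y2) & y1 < y < y2]].

Section transports.
Variables (R : realType) (I : set R) (l1 l2 : prob1 R).
Hypotheses (l1_mean : L1 l1 (fun x => x : R)) (l2_mean : L1 l2 (fun x => x : R)).

Lemma mt_L1_indic (mu : prob2 R) (A : set (measurableTypeR R))
    (q : measurableTypeR R -> R) :
  martingale_transport I l1 l2 mu -> measurable A -> L1 l2 q ->
  L1 mu (fun z => \1_A z.1 * q z.2).
Proof.
move=> mu_mt mA q1; have [q1mu _] := mt_L1_comp_snd mu_mt q1.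
exact: (L1_bdmM (bdm_comp measurable_fst (bdm_indic R mA)) q1mu).
Qed.

(** The martingale property on [A] lets [z.2] be replaced by [z.1], which has law [l1]; so affine
    integrals over [A] do not depend on the transport. *)
Lemma mt_affine (mu : prob2 R) (A : set (measurableTypeR R)) (c d : R) :
  martingale_transport I l1 l2 mu -> measurable A ->
  Ex mu (fun z => \1_A z.1 * (c + d * z.2)) =
  Ex l1 (fun x => \1_A x * (c + d * x)).
Proof.
move=> mu_mt mA; have A1 := mt_L1_indic mu_mt mA (L1_cst l2 1).
have A2 := mt_L1_indic mu_mt mA l2_mean.
have B1 : L1 l1 (fun x => \1_A x * x) by exact: L1_bdmM (bdm_indic R mA) l1_mean.
have B0 : L1 l1 (\1_A : measurableTypeR R -> R) by exact: L1_indic.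
have [_ E0] := mt_L1_comp_fst mu_mt B0; have [_ E1] := mt_L1_comp_fst mu_mt B1.
have -> : Ex l1 (fun x => \1_A x * (c + d * x)) =
    c * Ex l1 \1_A + d * Ex l1 (fun x => \1_A x * x).
  rewrite -!ExZ// -ExD; [|exact: L1Z..].
  by apply: Ex_eq => x; ring.
rewrite -E0 -E1 (mt_martingale mu_mt mA) -ExZ; last first.
  by apply: L1_eq A1 => z; rewrite mulr1.
rewrite -ExZ// -ExD; [|apply: L1_eq (L1Z c A1) => z; by rewrite mulr1|exact: L1Z].
by apply: Ex_eq => z; ring.
Qed.

Variables (pi nu : prob2 R).
Hypotheses (pi_mt : martingale_transport I l1 l2 pi).
Hypotheses (nu_mt : martingale_transport I l1 l2 nu).
Variable Gam : set (RR R).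
Hypothesis pi_Gam : carries pi Gam.

Lemma ae_carried (P : RR R -> Prop) : (forall z, Gam z -> P z) ->
  {ae pi, forall z, P z}.
Proof.
move=> GP; case: pi_Gam => mG G0; exists (~` Gam); split=> //.
  exact: measurableC.
by move=> z /= NP Gz; apply: NP; exact: GP.
Qed.

(** The fibre lies on one side of [t], so for [pi] the hinge is 0 or the affine function [y - t].
    The hinge dominates both everywhere, and their integrals are the same for [nu]: [pi] realises
    equality in Jensen's inequality. *)
Lemma hinge_le_pt (x t : R) : ~ hull Gam x t ->
  Ex pi (fun z => \1_[set x] z.1 * hinge t z.2) <=
  Ex nu (fun z => \1_[set x] z.1 * hinge t z.2).
Proof.
move=> Nt; have mx : measurable ([set x] : set (measurableTypeR R)).
  exact: measurable_set1.
have h1 := L1_hinge t l2_mean.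
have pi1 := mt_L1_indic pi_mt mx h1; have nu1 := mt_L1_indic nu_mt mx h1.
have mpi1 := L1_measurable pi1.
have i0 (z : R) : 0 <= \1_[set x] z :> R by rewrite indicE.
have [lo|/existsNP[y0 /not_implyP[Gy0 /negP]]] :=
    pselect (forall y, Gam (x, y) -> y <= t).
  apply: (@le_trans _ _ 0); last first.
    by apply: Ex_ge0 => z; rewrite mulr_ge0// hinge_ge0.
  rewrite -(Ex_cst pi 0) le_eqVlt; apply/orP; left; apply/eqP.
  apply: Ex_ae => //; apply: ae_carried => -[x' y'] Gz /=; rewrite indicE.
  have [|_] := boolP (x' \in _); last by rewrite mul0r.
  by rewrite inE => /= xx'; rewrite hinge0 ?mulr0//; apply: lo; rewrite -xx'.
rewrite -ltNge => ty0.
have hi y : Gam (x, y) -> t <= y.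
  move=> Gy; rewrite leNgt; apply/negP => yt; apply: Nt.
  by exists y, y0; split=> //; rewrite yt.
have lin1 := L1D (L1_cst l2 (- t)) (L1Z 1 l2_mean).
have plin := mt_L1_indic pi_mt mx lin1.
have -> : Ex pi (fun z => \1_[set x] z.1 * hinge t z.2) =
    Ex pi (fun z => \1_[set x] z.1 * (- t + 1 * z.2)).
  apply: Ex_ae => //; first exact: L1_measurable plin.
  apply: ae_carried => -[x' y'] Gz /=; rewrite indicE.
  have [|_] := boolP (x' \in _); last by rewrite !mul0r.
  rewrite inE => /= xx'; rewrite !mul1r hingeE; first by rewrite addrC.
  by apply: hi; rewrite -xx'.
rewrite (mt_affine _ _ pi_mt mx) -(mt_affine _ _ nu_mt mx).
apply: Ex_le => //; first exact: mt_L1_indic nu_mt mx lin1.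
by move=> z; rewrite ler_wpM2l// mul1r addrC /hinge le_max lexx.
Qed.

End transports.

Lemma measurable_seq (R : realType) (s : seq R) :
  measurable ([set` s] : set (measurableTypeR R)).
Proof.
apply: countable_measurable; first by move=> t; exact: measurable_set1.
exact/finite_set_countable/finite_seq.
Qed.

Lemma indic_seq (R : realType) (s : seq R) (x : R) : uniq s ->
  \1_[set` s] x = \sum_(y <- s) \1_[set y] x :> R.
Proof.
elim: s => [|y s IH] /=; first by rewrite big_nil indicE set_nil in_set0.
move=> /andP[ys us]; rewrite big_cons -IH// !indicE -natrD; congr (_%:R).
have -> : (x \in [set y]) = (x == y) by apply/idP/eqP; rewrite inE.
rewrite !mem_setE in_cons.
by have [->|//] := eqVneq x y; rewrite (negbTE ys).
Qed.

Section hinge_order.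
Variables (R : realType) (I : set R) (l1 l2 : prob1 R).
Hypotheses (l1_mean : L1 l1 (fun x => x : R)) (l2_mean : L1 l2 (fun x => x : R)).
Variables (pi nu : prob2 R).
Hypotheses (pi_mt : martingale_transport I l1 l2 pi).
Hypotheses (nu_mt : martingale_transport I l1 l2 nu).
Variable Gam : set (RR R).
Hypothesis pi_Gam : carries pi Gam.
Variable gs : seq R.
Hypothesis gs_uniq : uniq gs.

Let G : set (measurableTypeR R) := [set` gs].
(** As a union of open intervals it is open, so the endpoints of its components lie outside it,
    where hinges are compared fibre by fibre. *)
Let O : set R := [set y | exists2 x, x \in gs & hull Gam x y].

Hypothesis sep : forall x y, Gam (x, y) -> x \notin gs -> ~ O y.

Let mG : measurable G. Proof. exact: measurable_seq. Qed.

Lemma hinge_le_off (t : R) : ~ O t ->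
  Ex pi (fun z => \1_G z.1 * hinge t z.2) <=
  Ex nu (fun z => \1_G z.1 * hinge t z.2).
Proof.
move=> Ot; have mx (x : R) : measurable ([set x] : set (measurableTypeR R)).
  exact: measurable_set1.
have h1 := L1_hinge t l2_mean.
have E (mu : prob2 R) : martingale_transport I l1 l2 mu ->
    Ex mu (fun z => \1_G z.1 * hinge t z.2) =
    \sum_(x <- gs) Ex mu (fun z => \1_[set x] z.1 * hinge t z.2).
  move=> mu_mt; rewrite -Ex_sum; last first.
    by move=> x; exact: mt_L1_indic mu_mt (mx x) h1.
  by apply: Ex_eq => z; rewrite indic_seq// mulr_suml.
rewrite !E// big_seq [leRHS]big_seq; apply: ler_sum => x xgs.
apply: (hinge_le_pt l1_mean l2_mean pi_mt nu_mt pi_Gam) => Hx.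
by apply: Ot; exists x.
Qed.

(* All the mass that pi puts on O comes from G. *)
Lemma transported_mass_le (psi : measurableTypeR R -> R) :
  (forall y, 0 <= psi y) -> (forall y, ~ O y -> psi y = 0) -> L1 l2 psi ->
  Ex nu (fun z => \1_G z.1 * psi z.2) <= Ex pi (fun z => \1_G z.1 * psi z.2).
Proof.
move=> psi0 psiO psi1.
have [pi1 Epi] := mt_L1_comp_snd pi_mt psi1.
have [nu1 Enu] := mt_L1_comp_snd nu_mt psi1.
have piG := mt_L1_indic pi_mt mG psi1.
have -> : Ex pi (fun z => \1_G z.1 * psi z.2) = Ex pi (fun z => psi z.2).
  apply: Ex_ae; [exact: L1_measurable piG|exact: L1_measurable pi1|].
  apply: (ae_carried pi_Gam) => -[x y] Gz /=; rewrite indicE.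
  have [|xG] := boolP (x \in _); first by rewrite mul1r.
  rewrite psiO ?mulr0//; apply: (sep Gz); apply: contra xG => xgs.
  by rewrite inE.
rewrite Epi -Enu; apply: Ex_le => //; first exact: mt_L1_indic nu_mt mG psi1.
by move=> z; rewrite indicE; case: (_ \in _); rewrite ?mul1r// mul0r.
Qed.

(* a and b are the endpoints of the component of O containing t (one of them may
   be infinite): the right-hand side is the chord of the hinge over [a, b]. *)
Lemma hinge_decomposition (t : R) : O t ->
  (forall y, O y) \/
  exists (c al be a b : R), [/\ 0 <= al, 0 <= be, ~ O a /\ ~ O b,
    (forall y, hinge t y <= c + al * hinge a y + be * hinge b y) &
    (forall y, ~ O y -> hinge t y = c + al * hinge a y + be * hinge b y)].
Proof.
move=> Ot; pose Al := [set u | u <= t /\ ~ O u]; pose Ar := [set u | t <= u /\ ~ O u].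
(* If the supremum were inside an open hull, so would be a point of [Al] close to it. *)
have supN : Al !=set0 -> exists a, [/\ a < t, ~ O a & forall y, ~ O y -> y <= t -> y <= a].
  move=> Al0; have Alub : has_ubound Al by exists t => u [].
  have NOa : ~ O (sup Al).
    move=> [x xgs [y1 [y2 [G1 G2 /andP[y1a ay2]]]]].
    have [|u [ut Ou] lu] := @sup_adherent _ Al (sup Al - y1) _ (conj Al0 Alub).
      by rewrite subr_gt0.
    apply: (Ou); exists x => //; exists y1, y2; split=> //.
    move: lu; rewrite opprB addrC subrK => ->/=.
    by apply: le_lt_trans ay2; apply: (ub_le_sup Alub); split.
  exists (sup Al); split=> //; last first.
    by move=> y Oy yt; apply: (ub_le_sup Alub); split.
  rewrite lt_neqAle; apply/andP; split; first by apply/eqP => E; rewrite E in NOa.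
  by apply: ge_sup => // u [].
have infN : Ar !=set0 -> exists b, [/\ t < b, ~ O b & forall y, ~ O y -> t <= y -> b <= y].
  move=> Ar0; have Arlb : has_lbound Ar by exists t => u [].
  have NOb : ~ O (inf Ar).
    move=> [x xgs [y1 [y2 [G1 G2 /andP[y1b by2]]]]].
    have [|u [ut Ou] lu] := @inf_adherent _ Ar (y2 - inf Ar) _ (conj Ar0 Arlb).
      by rewrite subr_gt0.
    apply: (Ou); exists x => //; exists y1, y2; split=> //.
    move: lu; rewrite addrC subrK => ->; rewrite andbT.
    by apply: lt_le_trans y1b _; apply: (ge_inf Arlb); split.
  exists (inf Ar); split=> //; last first.
    by move=> y Oy yt; apply: (ge_inf Arlb); split.
  rewrite lt_neqAle; apply/andP; split; first by apply/eqP => E; rewrite -E in NOb.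
  by apply: lb_le_inf => // u [].
have H (u v : R) : hinge u v = v - u /\ u <= v \/ hinge u v = 0 /\ v <= u.
  by have [?|/ltW ?] := leP u v; [left; rewrite hingeE|right; rewrite hinge0].
(* Either endpoint may be missing. If both are, [O] is the whole line. If one is, the chord becomes
   a ray, of slope 0 towards the left or 1 towards the right, and the missing endpoint is replaced
   by the other one with coefficient 0. *)
have [/eqP Al0|/set0P/supN[a [at_ Oa aP]]] := boolP (Al == set0);
  have [/eqP Ar0|/set0P/infN[b [tb Ob bP]]] := boolP (Ar == set0).
- left=> y; apply: contrapT => Oy; have [yt|/ltW ty] := leP y t.
    have Ay : Al y by split.
    by rewrite Al0 in Ay.
  have Ay : Ar y by split.
  by rewrite Ar0 in Ay.
- right; exists (b - t), 0, 1, b, b; split=> //.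
    move=> y; rewrite mul0r addr0 mul1r.
    by have [[-> ?]|[-> ?]] := H t y; have [[-> ?]|[-> ?]] := H b y; lra.
  move=> y Oy; rewrite mul0r addr0 mul1r; have [yt|/ltW ty] := leP y t.
    have Ay : Al y by split.
    by rewrite Al0 in Ay.
  have yb := bP y Oy ty.
  by rewrite !hingeE//; lra.
- right; exists 0, 1, 0, a, a; split=> //.
    move=> y; rewrite mul0r addr0 mul1r add0r.
    by have [[-> ?]|[-> ?]] := H t y; have [[-> ?]|[-> ?]] := H a y; lra.
  move=> y Oy; rewrite mul0r addr0 mul1r add0r; have [yt|/ltW ty] := leP y t.
    by rewrite !hinge0//; exact: aP.
  have Ay : Ar y by split.
  by rewrite Ar0 in Ay.
- right; have ba : 0 < b - a by lra.
  (* The slope of the chord from height 0 at [a] to height [b - t] at [b]; the coefficient [1 - th]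
     raises the slope to 1 beyond [b]. *)
  pose th := (b - t) / (b - a); have thE : th * (b - a) = b - t by rewrite divfK// gt_eqF.
  have th0 : 0 <= th by rewrite divr_ge0//; lra.
  have th1 : 0 <= 1 - th by rewrite -(pmulr_lge0 _ ba) mulrBl thE; lra.
  exists 0, th, (1 - th), a, b; split=> //.
    move=> y; rewrite add0r.
    have [[-> ?]|[-> ?]] := H t y; have [[-> ?]|[-> ?]] := H b y;
      have [[-> ?]|[-> ?]] := H a y; nra.
  move=> y Oy; rewrite add0r; have [yt|/ltW ty] := leP y t.
    by rewrite !hinge0 ?mulr0 ?addr0//; [lra|exact: aP].
  have yb := bP y Oy ty.
  by rewrite !hingeE//; [nra|lra].
Qed.

(** For [t] in [O] the hinge is a constant plus a nonnegative combination of hinges with kinks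
    outside [O], minus some [psi >= 0] vanishing off [O]. Over [G], [pi] is smaller on those hinges
    and larger on [psi], since all its mass on [O] comes from [G]. If [O] is the whole line, [G]
    carries [l1] and both sides equal the integral against [l2]. *)
Lemma hinge_le (t : R) :
  Ex pi (fun z => \1_G z.1 * hinge t z.2) <=
  Ex nu (fun z => \1_G z.1 * hinge t z.2).
Proof.
have [Ot|] := pselect (O t); last exact: hinge_le_off.
have h1 u := L1_hinge u l2_mean.
have G1 : L1 l1 (\1_G : measurableTypeR R -> R) by exact: L1_indic.
have [allO|[c [al [be [a [b [al0 be0 [Oa Ob] hle heq]]]]]]] := hinge_decomposition Ot.
  have [pi1 Epi] := mt_L1_comp_snd pi_mt (h1 t).
  have [nu1 Enu] := mt_L1_comp_snd nu_mt (h1 t).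
  have [piG EpiG] := mt_L1_comp_fst pi_mt G1.
  have [nuG EnuG] := mt_L1_comp_fst nu_mt G1.
  have full (mu : prob2 R) : martingale_transport I l1 l2 mu ->
      {ae mu, forall z : RR R, \1_G z.1 = 1 :> R} ->
      Ex mu (fun z => \1_G z.1 * hinge t z.2) = Ex l2 (hinge t).
    move=> mu_mt aeG; have [mu1 <-] := mt_L1_comp_snd mu_mt (h1 t).
    apply: Ex_ae; last by apply: filterS aeG => z ->; rewrite mul1r.
      exact: L1_measurable (mt_L1_indic mu_mt mG (h1 t)).
    exact: L1_measurable mu1.
  have aepi : {ae pi, forall z : RR R, \1_G z.1 = 1 :> R}.
    apply: (ae_carried pi_Gam) => -[x y] Gz; rewrite indicE mem_set//=.
    by apply/negPn/negP => xG; exact: (sep Gz xG).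
  rewrite !full//.
  have G0 (z : RR R) : 0 <= 1 - \1_G z.1 :> R.
    by rewrite indicE; case: (_ \in _); rewrite ?subrr ?subr0.
  have : Ex nu (fun z => 1 - \1_G z.1) = 0.
    rewrite (ExB (L1_cst nu 1) nuG) EnuG -EpiG Ex_cst.
    rewrite (_ : Ex pi _ = 1) ?subrr// -[RHS](Ex_cst pi 1).
    apply: Ex_ae => //; exact: L1_measurable piG.
  move=> /(Ex_ge0_eq0 (L1B (L1_cst nu 1) nuG) G0).
  by apply: filterS => z /eqP; rewrite subr_eq0 => /eqP.
pose psi y := c + al * hinge a y + be * hinge b y - hinge t y.
have psi1 : L1 l2 psi.
  exact: L1B (L1D (L1D (L1_cst l2 c) (L1Z al (h1 a))) (L1Z be (h1 b))) (h1 t).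
have E (mu : prob2 R) : martingale_transport I l1 l2 mu ->
    Ex mu (fun z => \1_G z.1 * hinge t z.2) = c * Ex l1 \1_G
      + al * Ex mu (fun z => \1_G z.1 * hinge a z.2)
      + be * Ex mu (fun z => \1_G z.1 * hinge b z.2)
      - Ex mu (fun z => \1_G z.1 * psi z.2).
  move=> mu_mt; have [muG <-] := mt_L1_comp_fst mu_mt G1.
  have Ha := mt_L1_indic mu_mt mG (h1 a); have Hb := mt_L1_indic mu_mt mG (h1 b).
  have Hpsi := mt_L1_indic mu_mt mG psi1.
  have S1 := L1D (L1Z c muG) (L1Z al Ha); have S2 := L1D S1 (L1Z be Hb).
  rewrite -(ExZ c muG) -(ExZ al Ha) -(ExZ be Hb) -(ExD (L1Z c muG) (L1Z al Ha)).
  rewrite -(ExD S1 (L1Z be Hb)) -(ExB S2 Hpsi).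
  by apply: Ex_eq => z; rewrite /psi /=; ring.
rewrite (E pi)// (E nu)//; apply: lerB; last first.
  apply: transported_mass_le => //.
    by move=> y; rewrite subr_ge0.
  by move=> y Oy; rewrite /psi -heq// subrr.
by rewrite lerD// ?lerD2l ler_wpM2l//; exact: hinge_le_off.
Qed.

End hinge_order.

Lemma Ex_cvg d (T : measurableType d) (R : realType)
    (mu : {finite_measure set T -> \bar R}) (F : nat -> T -> R) (f h : T -> R) :
  (forall n, measurable_fun setT (F n)) -> measurable_fun setT f -> L1 mu h ->
  {ae mu, forall t, forall n, `|F n t| <= h t} ->
  {ae mu, forall t, F n t @[n --> \oo] --> f t} ->
  L1 mu f /\ Ex mu (F n) @[n --> \oo] --> Ex mu f.
Proof.
move=> mF mf h1 Fh Ff.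
have [] := @dominated_convergence _ _ _ mu setT measurableT
  (fun n => EFin \o F n) (EFin \o f) (EFin \o h) _ _ _ h1 _.
- by move=> n; exact/measurable_EFinP.
- exact/measurable_EFinP.
- apply: filterS Ff => t /= Ft _; apply: cvg_EFin; first exact: nearW.
  exact: Ft.
- by apply: filterS Fh => t /= Ft n _; rewrite lee_fin.
move=> f1 _ cvg; split=> //.
apply: (fine_cvg (f := fun n => (\int[mu]_t (F n t)%:E)%E)).
by rewrite -(ExE f1); exact: cvg.
Qed.

Lemma Ex_le_ae d (T : measurableType d) (R : realType)
    (mu : {finite_measure set T -> \bar R}) (f g : T -> R) :
  L1 mu f -> L1 mu g -> {ae mu, forall t, f t <= g t} -> Ex mu f <= Ex mu g.
Proof.
move=> f1 g1 fg; have mfg : measurable_fun setT (fun t => Num.min (f t) (g t)).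
  by apply: measurable_minr; [exact: L1_measurable f1|exact: L1_measurable g1].
have fgE : {ae mu, forall t, Num.min (f t) (g t) = f t}.
  by apply: filterS fg => t /min_idPl.
rewrite -(Ex_ae mfg (L1_measurable f1) fgE); apply: Ex_le => //.
  exact: L1_ae fgE.
by move=> t; rewrite ge_min lexx orbT.
Qed.

(** * Maxima of finitely many tangents *)

Section tangents.
Variables (R : realType) (I : set R) (phi p : R -> R).
Hypothesis tangent_le : forall x y, I x -> I y -> phi x + p x * (y - x) <= phi y.

Definition tangent (x y : R) : R := (phi x - p x * x) + p x * y.

(* For s increasing, tangent x + tangent_steps x s is the maximum of the tangents
   to phi at the points of x :: s, on the interval I; written as an affine map
   plus positive parts of affine maps, it can be compared through hinges. *)
Fixpoint tangent_steps (x : R) (s : seq R) (y : R) : R :=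
  if s is x' :: s' then
    Num.max ((phi x' - p x' * x' - (phi x - p x * x)) + (p x' - p x) * y) 0 + tangent_steps x' s' y
  else 0.

Lemma tangent_stepE (x x' y : R) :
  (phi x' - p x' * x' - (phi x - p x * x)) + (p x' - p x) * y =
  tangent x' y - tangent x y.
Proof. by rewrite /tangent; ring. Qed.

Lemma tangent_steps_ge0 x s y : 0 <= tangent_steps x s y.
Proof. by elim: s x => //= x' s IH x; rewrite addr_ge0// le_max lexx orbT. Qed.

Lemma tangent_steps_ge (x : R) (s : seq R) (z y : R) : z \in x :: s ->
  tangent z y <= tangent x y + tangent_steps x s y.
Proof.
elim: s x => [|x' s IH] x; first by rewrite inE => /eqP ->; rewrite /= addr0.
rewrite inE => /predU1P[->|zs]; first by rewrite lerDl tangent_steps_ge0.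
apply: le_trans (IH _ zs) _; rewrite /= tangent_stepE addrA lerD2r.
by rewrite -lerBlDl le_max lexx.
Qed.

Lemma tangent_slope_le (x x' : R) : I x -> I x' -> x <= x' -> p x <= p x'.
Proof.
move=> Ix Ix'; rewrite le_eqVlt => /predU1P[->//|xx'].
have := tangent_le Ix Ix'; have := tangent_le Ix' Ix => H1 H2.
have d0 : 0 < x' - x by rewrite subr_gt0.
by rewrite -(ler_pM2r d0); lra.
Qed.

Lemma tangent_le_right (x x' y : R) : I x -> I x' -> x <= x' -> x' <= y ->
  tangent x y <= tangent x' y.
Proof.
move=> Ix Ix' xx' x'y; rewrite /tangent; have := tangent_le Ix Ix'.
have : 0 <= (p x' - p x) * (y - x').
  by rewrite mulr_ge0 ?subr_ge0// tangent_slope_le.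
lra.
Qed.

Lemma tangent_le_left (x x' y : R) : I x -> I x' -> x <= x' -> y <= x ->
  tangent x' y <= tangent x y.
Proof.
move=> Ix Ix' xx' yx; rewrite /tangent; have := tangent_le Ix' Ix.
have : 0 <= (p x' - p x) * (x - y).
  by rewrite mulr_ge0 ?subr_ge0// tangent_slope_le.
lra.
Qed.

Lemma tangent_steps_left (x : R) (s : seq R) (y : R) :
  I x -> (forall z, z \in s -> I z) -> path <=%R x s -> y <= x ->
  tangent_steps x s y = 0.
Proof.
elim: s x => //= x' s IH x Ix Is /andP[xx' ps] yx.
have Ix' : I x' by apply: Is; rewrite inE eqxx.
rewrite IH//; last 2 first.
- by move=> z zs; apply: Is; rewrite inE zs orbT.
- exact: le_trans xx'.
rewrite addr0 tangent_stepE; apply/max_idPr.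
by rewrite subr_le0; exact: tangent_le_left.
Qed.

(** At a given [y], a positive step replaces the tangent at [x] by the one at [x']. If a step
    vanishes, either [y] is left of [x'] and all later steps vanish too, or the two tangents agree
    at [y] and the recursion continues from [x']. *)
Lemma tangent_steps_le (x : R) (s : seq R) (y : R) :
  I x -> (forall z, z \in s -> I z) -> path <=%R x s -> I y ->
  tangent x y + tangent_steps x s y <= phi y.
Proof.
have tan_le z : I z -> I y -> tangent z y <= phi y.
  by move=> Iz Iy; have := tangent_le Iz Iy; rewrite /tangent; lra.
elim: s x => [|x' s IH] x Ix Is; first by move=> _ Iy; rewrite addr0 tan_le.
move=> /= /andP[xx' ps] Iy.
have Ix' : I x' by apply: Is; rewrite inE eqxx.
have Is' z : z \in s -> I z by move=> zs; apply: Is; rewrite inE zs orbT.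
rewrite tangent_stepE addrA; have [le|lt] := leP (tangent x' y - tangent x y) 0.
  rewrite addr0; have [x'y|yx'] := leP x' y.
    have -> : tangent x y = tangent x' y.
      apply/eqP; rewrite eq_le tangent_le_right//=.
      by move: le; rewrite subr_le0.
    exact: IH.
  by rewrite tangent_steps_left// ?addr0 ?tan_le// ltW.
by rewrite [tangent x y + _]addrC subrK; exact: IH.
Qed.

End tangents.

(** * From hinges to strictly convex functions *)

Section convex_order.
Variables (R : realType) (I : set R) (l1 l2 : prob1 R).
Hypotheses (I_open : open I) (I_itv : is_interval I).
Hypotheses (l1_mean : L1 l1 (fun x => x : R)) (l2_mean : L1 l2 (fun x => x : R)).
Variables (pi nu : prob2 R).
Hypotheses (pi_mt : martingale_transport I l1 l2 pi).
Hypotheses (nu_mt : martingale_transport I l1 l2 nu).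
Variable G : set (measurableTypeR R).
Hypothesis mG : measurable G.
Hypothesis hinge_le : forall t : R,
  Ex pi (fun z => \1_G z.1 * hinge t z.2) <=
  Ex nu (fun z => \1_G z.1 * hinge t z.2).

(** The positive part is an affine function plus a nonnegative multiple of the hinge at the zero
    [- (c / d)]; for [d < 0] the affine function is [c + d * y] itself, and for [d = 0] there is no
    kink. Affine terms do not distinguish [pi] from [nu]. *)
Lemma posaffine_le (c d : R) :
  Ex pi (fun z => \1_G z.1 * Num.max (c + d * z.2) 0) <=
  Ex nu (fun z => \1_G z.1 * Num.max (c + d * z.2) 0).
Proof.
have h1 u := L1_hinge u l2_mean.
have decomp (a b k t : R) : 0 <= k ->
    (forall y, Num.max (c + d * y) 0 = (a + b * y) + k * hinge t y) ->
    Ex pi (fun z => \1_G z.1 * Num.max (c + d * z.2) 0) <=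
    Ex nu (fun z => \1_G z.1 * Num.max (c + d * z.2) 0).
  move=> k0 maxE.
  have aff1 := L1D (L1_cst l2 a) (L1Z b l2_mean).
  have E (mu : prob2 R) : martingale_transport I l1 l2 mu ->
      Ex mu (fun z => \1_G z.1 * Num.max (c + d * z.2) 0) =
      Ex l1 (fun x => \1_G x * (a + b * x)) +
        k * Ex mu (fun z => \1_G z.1 * hinge t z.2).
    move=> mu_mt; have Hh := mt_L1_indic mu_mt mG (h1 t).
    have Ha := mt_L1_indic mu_mt mG aff1.
    rewrite -(mt_affine l1_mean l2_mean a b mu_mt mG) -(ExZ k Hh).
    rewrite -(ExD Ha (L1Z k Hh)).
    by apply: Ex_eq => z; rewrite maxE mulrDr [in RHS]mulrCA.
  by rewrite (E pi)// (E nu)// lerD2l ler_wpM2l.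
have [d0|d0|d0] := ltgtP d 0.
- apply: (decomp c d (- d) (- (c / d))); first by rewrite oppr_ge0 ltW.
  move=> y; have dE : d * (c / d) = c by rewrite mulrC divfK// lt_eqF.
  have [yt|ty] := leP y (- (c / d)).
    rewrite hinge0// mulr0 addr0; apply/max_idPl.
    by have : d * (- (c / d)) <= d * y; [rewrite ler_nM2l|lra].
  rewrite hingeE ?ltW//.
  have : d * y < d * (- (c / d)) by rewrite ltr_nM2l.
  by move=> H; rewrite (max_idPr _); lra.
- apply: (decomp 0 0 d (- (c / d))); first exact: ltW.
  move=> y; have dE : d * (c / d) = c by rewrite mulrC divfK// gt_eqF.
  have [yt|ty] := leP y (- (c / d)).
    rewrite hinge0// mulr0 mul0r !addr0; apply/max_idPr.
    by have : d * y <= d * (- (c / d)); [rewrite ler_pM2l|lra].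
  rewrite hingeE ?ltW//.
  have : d * (- (c / d)) < d * y by rewrite ltr_pM2l.
  by move=> H; rewrite (max_idPl _); lra.
- apply: (decomp (Num.max c 0) 0 0 0) => // y.
  by rewrite d0 !mul0r !addr0.
Qed.

Lemma tangent_steps_order (phi p : R -> R) (x : R) (s : seq R) :
  let M (y : measurableTypeR R) : R := tangent phi p x y + tangent_steps phi p x s y in
  L1 l2 M /\ Ex pi (fun z => \1_G z.1 * M z.2) <= Ex nu (fun z => \1_G z.1 * M z.2).
Proof.
have steps (x0 : R) : L1 l2 (fun y : measurableTypeR R => tangent_steps phi p x0 s y) /\
    Ex pi (fun z => \1_G z.1 * tangent_steps phi p x0 s z.2) <=
    Ex nu (fun z => \1_G z.1 * tangent_steps phi p x0 s z.2).
  elim: s x0 => [|x' s' IH] x0 /=.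
    split; first exact: (L1_cst l2 0).
    have E0 (mu : prob2 R) : Ex mu (fun z => \1_G z.1 * 0) = 0.
      by rewrite -[RHS](Ex_cst mu); apply: Ex_eq => z; rewrite mulr0.
    by rewrite !E0.
  have [S1 Sle] := IH x'.
  set c := phi x' - p x' * x' - (phi x0 - p x0 * x0); set d := p x' - p x0.
  have P1 := L1_posaffine c d l2_mean.
  split; first exact: L1D P1 S1.
  have E (mu : prob2 R) : martingale_transport I l1 l2 mu ->
      Ex mu (fun z => \1_G z.1 * (Num.max (c + d * z.2) 0 + tangent_steps phi p x' s' z.2)) =
      Ex mu (fun z => \1_G z.1 * Num.max (c + d * z.2) 0) +
      Ex mu (fun z => \1_G z.1 * tangent_steps phi p x' s' z.2).
    move=> mu_mt; rewrite -(ExD (mt_L1_indic mu_mt mG P1) (mt_L1_indic mu_mt mG S1)).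
    by apply: Ex_eq => z; rewrite mulrDr.
  by rewrite (E pi)// (E nu)// lerD// posaffine_le.
have [S1 Sle] := steps x => M.
set c := phi x - p x * x.
have A1 := L1D (L1_cst l2 c) (L1Z (p x) l2_mean).
split; first exact: L1D A1 S1.
have E (mu : prob2 R) : martingale_transport I l1 l2 mu ->
    Ex mu (fun z => \1_G z.1 * M z.2) = Ex l1 (fun y => \1_G y * (c + p x * y)) +
      Ex mu (fun z => \1_G z.1 * tangent_steps phi p x s z.2).
  move=> mu_mt; rewrite -(mt_affine l1_mean l2_mean c (p x) mu_mt mG).
  rewrite -(ExD (mt_L1_indic mu_mt mG A1) (mt_L1_indic mu_mt mG S1)).
  by apply: Ex_eq => z; rewrite mulrDr.
by rewrite (E pi)// (E nu)// lerD2l.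
Qed.

(** [phi] is the pointwise limit, from below, of maxima of tangents. Dominated convergence is needed
    for [pi] only: for [nu] it is enough that the maxima stay below [phi]. *)
Lemma convex_le (phi : R -> R) : strictly_convex_on I phi ->
  L1 l2 (phi \_ I : measurableTypeR R -> R) ->
  Ex pi (fun z => \1_G z.1 * (phi \_ I) z.2) <=
  Ex nu (fun z => \1_G z.1 * (phi \_ I) z.2).
Proof.
move=> phi_conv phi1.
have piphi := mt_L1_indic pi_mt mG phi1; have nuphi := mt_L1_indic nu_mt mG phi1.
have [I0|/set0P[c Ic]] := eqVneq I set0.
  have E0 (mu : prob2 R) : Ex mu (fun z => \1_G z.1 * (phi \_ I) z.2) = 0.
    rewrite -[RHS](Ex_cst mu); apply: Ex_eq => z.
    by rewrite patchE I0 in_set0 mulr0.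
  by rewrite !E0.
have /choice[p pP] : forall x, exists q, I x ->
    forall y, I y -> phi x + q * (y - x) <= phi y.
  move=> x; have [Ix|Ix] := pselect (I x); last by exists 0.
  have [q qP] := strictly_convex_subgradient I_open phi_conv Ix.
  by exists q.
have tan_le x y : I x -> I y -> phi x + p x * (y - x) <= phi y by move=> Ix Iy; exact: pP.
pose M (s : seq R) (y : measurableTypeR R) : R :=
  if s is x :: s' then tangent phi p x y + tangent_steps phi p x s' y else 0.
(* The points of tangency are [c] and the rationals of [I] met so far. [c] keeps the list nonempty,
   and its tangent bounds all maxima from below, which gives the dominating function. *)
pose qs n : seq R := sort <=%R (c :: [seq ratr r | r <- pmap unpickle (iota 0 n)
  & `[< I (ratr r) >]]).
have qsI n z : z \in qs n -> I z.
  rewrite mem_sort inE => /predU1P[->//|/mapP[r]].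
  by rewrite mem_filter => /andP[/asboolP Ir _] ->.
have c_qs n : c \in qs n by rewrite mem_sort inE eqxx.
have M_ge n z y : z \in qs n -> tangent phi p z y <= M (qs n) y.
  by rewrite /M; case: (qs n) => // x s; exact: tangent_steps_ge.
have M_le n y : I y -> M (qs n) y <= phi y.
  move=> Iy; have : sorted <=%R (qs n) by apply: sort_sorted; exact: le_total.
  have := c_qs n; have := qsI n; rewrite /M; case: (qs n) => // x s qI _ /= ps.
  apply: (tangent_steps_le tan_le) => //; first by apply: qI; rewrite inE eqxx.
  by move=> z zs; apply: qI; rewrite inE zs orbT.
have M_order n : L1 l2 (M (qs n)) /\
    Ex pi (fun z => \1_G z.1 * M (qs n) z.2) <= Ex nu (fun z => \1_G z.1 * M (qs n) z.2).
  rewrite /M; have := c_qs n; case: (qs n) => // x s _.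
  exact: tangent_steps_order.
have M_cvg y : I y -> M (qs n) y @[n --> \oo] --> phi y.
  move=> Iy; apply/cvgrPdist_lt => e e0.
  have [y0 Iy0 y0y] := open_gtP I_open Iy.
  have slope_le : p y0 <= p y by apply: (tangent_slope_le tan_le) => //; exact: ltW.
  (* A rational between [y0] and [y] has its slope between [p y0] and [p y], so its tangent misses
     [phi y] by at most [p y - p y0] times the distance to [y]. The added 1 makes [k] positive. *)
  pose k := p y - p y0 + 1; have k0 : 0 < k by rewrite /k; lra.
  have [q [q1 q2]] : exists q : rat, Num.max y0 (y - e / k) < ratr q /\ ratr q < y.
    by apply: rat_between; rewrite gt_max y0y ltrBlDr ltrDl divr_gt0.
  move: q1; rewrite gt_max => /andP[y0q yq].
  have Iq : I (ratr q) by apply: (I_itv Iy0 Iy); rewrite !ltW.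
  have tan_near : phi y - e < tangent phi p (ratr q) y.
    have H1 := tan_le y (ratr q) Iy Iq.
    have H2 : p y0 <= p (ratr q) by apply: (tangent_slope_le tan_le) => //; exact: ltW.
    have H3 : k * (y - ratr q) < e.
      by rewrite mulrC -ltr_pdivlMr//; move: yq; lra.
    have H4 : 0 < y - ratr q by rewrite subr_gt0.
    have H5 : (p y - p (ratr q)) * (y - ratr q) <= k * (y - ratr q).
      by rewrite ler_pM2r//; rewrite /k; lra.
    by rewrite /tangent; move: H1 H3 H5; lra.
  near=> n; have nq : (pickle q < n)%N by near: n; exact: nbhs_infty_gt.
  have q_qs : (ratr q : R) \in qs n.
    rewrite mem_sort inE; apply/orP; right; apply/mapP; exists q => //.
    rewrite mem_filter; apply/andP; split; first exact/asboolP.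
    by rewrite mem_pmap; apply/mapP; exists (pickle q);
      [rewrite mem_iota|rewrite pickleK].
  have := M_ge n _ y q_qs; have := M_le n y Iy => H1 H2.
  by rewrite ger0_norm ?subr_ge0//; move: tan_near H2; lra.
have aeI (mu : prob2 R) : martingale_transport I l1 l2 mu ->
    {ae mu, forall z : RR R, I z.2}.
  move=> /mt_carries[mII II0]; exists (~` (I `*` I)); split=> //.
    exact: measurableC.
  by move=> z /= Iz [].
have i01 (z : RR R) : 0 <= (\1_G z.1 : R) <= 1.
  by rewrite indicE ler0n lern1 leq_b1.
have tan1 : L1 l2 (tangent phi p c : measurableTypeR R -> R).
  exact: L1D (L1_cst l2 _) (L1Z (p c) l2_mean).
have [tanpi _] := mt_L1_comp_snd pi_mt tan1; have [phipi _] := mt_L1_comp_snd pi_mt phi1.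
have [_ cvgM] : L1 pi (fun z => \1_G z.1 * (phi \_ I) z.2) /\
    Ex pi (fun z => \1_G z.1 * M (qs n) z.2) @[n --> \oo] -->
    Ex pi (fun z => \1_G z.1 * (phi \_ I) z.2).
  apply: (Ex_cvg _ _ (L1D (L1_norm tanpi) (L1_norm phipi))).
  - by move=> n; exact: L1_measurable (mt_L1_indic pi_mt mG (M_order n).1).
  - exact: L1_measurable piphi.
  - apply: filterS (aeI _ pi_mt) => z Iz n.
    rewrite normrM -[leRHS]mul1r ler_pM//.
      by have /andP[G0 G1] := i01 z; rewrite ger0_norm.
    rewrite patchE mem_set// ler_norml; have := M_ge n c z.2 (c_qs n).
    have := M_le n z.2 Iz; have := ler_norm (phi z.2).
    have := ler_norm (- tangent phi p c z.2); rewrite normrN.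
    have := normr_ge0 (phi z.2); have := normr_ge0 (tangent phi p c z.2).
    by move=> *; apply/andP; split; lra.
  - apply: filterS (aeI _ pi_mt) => z Iz.
    rewrite patchE mem_set//; apply: cvgMr; exact: M_cvg.
rewrite -(cvg_lim (@Rhausdorff _) cvgM).
apply: limr_le; first by apply/cvg_ex; exists (Ex pi (fun z => \1_G z.1 * (phi \_ I) z.2)).
apply: nearW => n; have [Mn1 Mn_le] := M_order n.
apply: le_trans Mn_le _; apply: Ex_le_ae => //; first exact: (mt_L1_indic nu_mt mG Mn1).
apply: filterS (aeI _ nu_mt) => z Iz; have /andP[G0 _] := i01 z.
by rewrite ler_wpM2l// patchE mem_set// M_le.
Unshelve. all: by end_near.
Qed.

End convex_order.

(** * Hinge integrals determine a transport with finitely many fibres *)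

Lemma hinge_quotient_bound (R : realType) (t y : R) (n : nat) :
  0 <= n.+1%:R * (hinge t y - hinge (t + n.+1%:R^-1) y) <= 1.
Proof.
have n0 : 0 < n.+1%:R :> R by rewrite ltr0n.
have e0 : 0 < n.+1%:R^-1 :> R by rewrite invr_gt0.
have E : n.+1%:R * n.+1%:R^-1 = 1 :> R by rewrite mulfV// gt_eqF.
move: E e0; set e := n.+1%:R^-1; set k : R := n.+1%:R => E e0.
have : 0 <= hinge t y - hinge (t + e) y <= e.
  rewrite /hinge; case: (lerP (y - t) 0) => ?; case: (lerP (y - (t + e)) 0) => ?;
  by apply/andP; split; lra.
by move=> /andP[h0 h1]; rewrite mulr_ge0 ?(ltW n0)//= -E ler_pM2l.
Qed.

(** These are difference quotients in the position of the kink, eventually constant in [n]. They are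
    0 at [y = t], hence the open ray. *)
Lemma hinge_quotient_cvg (R : realType) (t y : R) :
  n.+1%:R * (hinge t y - hinge (t + n.+1%:R^-1) y) @[n --> \oo] -->
  (\1_(`]t, +oo[%classic : set R) y : R).
Proof.
rewrite indicE; have [ty|yt] := ltP t y; last first.
  rewrite memNset; last by rewrite /= in_itv/= andbT; apply/negP; rewrite -leNgt.
  apply: cvg_near_cst; near=> n; rewrite !hinge0 ?subrr ?mulr0//.
  by rewrite (le_trans yt)// lerDl invr_ge0.
rewrite mem_set; last by rewrite /= in_itv/= ty.
apply: cvg_near_cst; near=> n.
have ny : n.+1%:R^-1 < y - t.
  near: n; have d0 : 0 < y - t by rewrite subr_gt0.
  exact: near_infty_natSinv_lt (PosNum d0).
rewrite !hingeE ?(ltW ty)//; last by rewrite -lerBrDl ltW.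
by rewrite opprB addrC !addrA subrK addrAC subrr add0r mulfV// gt_eqF.
Unshelve. all: by end_near. Qed.

Section hinges_determine.
Variables (R : realType) (I : set R) (l1 l2 : prob1 R).
Hypothesis l2_mean : L1 l2 (fun x => x : R).
Variables pi nu : prob2 R.
Hypothesis pi_mt : martingale_transport I l1 l2 pi.
Hypothesis nu_mt : martingale_transport I l1 l2 nu.

Lemma hinge_ray (mu : prob2 R) (x t : R) : martingale_transport I l1 l2 mu ->
  Ex mu (fun z => n.+1%:R * (\1_[set x] z.1 * hinge t z.2 -
      \1_[set x] z.1 * hinge (t + n.+1%:R^-1) z.2)) @[n --> \oo] -->
  fine (mu ([set x] `*` `]t, +oo[)).
Proof.
move=> mu_mt.
have mx : measurable ([set x] : set (measurableTypeR R)).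
  exact: measurable_set1.
have h1 u : L1 mu (fun z => \1_[set x] z.1 * hinge u z.2).
  exact: (mt_L1_indic mu_mt mx (L1_hinge u l2_mean)).
have mA : measurable ([set x] `*` `]t, +oo[ : set (RR R)).
  by apply: measurableX; [exact: mx|exact: measurable_itv].
rewrite -(Ex_indic _ mA).
apply: (proj2 (@Ex_cvg _ _ _ mu _ _ (cst 1) _ _ (L1_cst mu 1) _ _)).
- by move=> n; exact: L1_measurable (L1Z _ (L1B (h1 _) (h1 _))).
- exact: (L1_measurable (L1_indic mu mA)).
- apply: aeW => z n; rewrite -mulrBr mulrCA normrM.
  have /andP[q0 q1] := hinge_quotient_bound t z.2 n.
  rewrite (ger0_norm q0) (ger0_norm (_ : 0 <= \1__ z.1)) ?indicE ?ler0n//=.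
  by case: (_ \in _); rewrite ?mul1r ?mul0r ?ler01.
- apply: aeW => z.
  have -> : (\1_([set x] `*` `]t, +oo[%classic) z : R) =
      \1_[set x] z.1 * \1_(`]t, +oo[%classic) z.2.
    by rewrite !indicE -natrM mulnb in_setX.
  under eq_fun do rewrite -mulrBr mulrCA.
  by apply: cvgMr; exact: hinge_quotient_cvg.
Qed.

(** Difference quotients of the hinge integrals give equal masses over open rays, which are stable
    under intersection and generate the Borel sets. *)
Lemma hinges_atom (x : R) (B : set (measurableTypeR R)) :
  (forall t, Ex pi (fun z => \1_[set x] z.1 * hinge t z.2) =
             Ex nu (fun z => \1_[set x] z.1 * hinge t z.2)) ->
  measurable B -> pi ([set x] `*` B) = nu ([set x] `*` B).
Proof.
move=> pinu mB.
have mx : measurable ([set x] : set (measurableTypeR R)).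
  exact: measurable_set1.
have mfx : measurable (fst @^-1` [set x] : set (RR R)).
  by rewrite -[X in measurable X]setTI; exact: measurable_fst.
pose m : {mfun RR R >-> measurableTypeR R} :=
  HB.pack (snd : RR R -> _) (isMeasurableFun.Build _ _ _ _ _ measurable_snd).
have h1 (mu : prob2 R) : martingale_transport I l1 l2 mu ->
    forall u, L1 mu (fun z => \1_[set x] z.1 * hinge u z.2).
  by move=> mu_mt u; exact: (mt_L1_indic mu_mt mx (L1_hinge u l2_mean)).
have fibre (mu : prob2 R) : exists M : {measure set (measurableTypeR R) -> \bar R},
    forall C, M C = mu ([set x] `*` C).
  unshelve eexists (pushforward (mrestr mu mfx) m); first exact: measurable_snd.
  by move=> C; congr (mu _); rewrite /= setIC; apply/seteqP; split=> z [].
have [[M ME] [N NE]] := (fibre pi, fibre nu).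
rewrite -ME -NE.
apply: (@measure_unique _ R (measurableTypeR R) (RGenOInfty.G (R := R))
  (fun n => `](- n%:R), +oo[%classic) _ _ _ _ M N _ _ B mB).
- exact: RGenOInfty.measurableE.
- move=> _ _ [a ->] [b ->]; exists (Num.max a b).
  apply/seteqP; split=> y /=; rewrite !in_itv/= !andbT gt_max.
    by move=> [-> ->].
  by move=> /andP[].
- by move=> n; eexists.
- apply/seteqP; split=> // y _; exists (Num.bound `|- y|) => //=.
  rewrite in_itv/= andbT ltrNl; apply: le_lt_trans (ler_norm _) _.
  by have := archi_boundP (normr_ge0 (- y)); rewrite /Num.bound.
- move=> _ [t ->]; rewrite ME NE.
  have mA : measurable ([set x] `*` `]t, +oo[ : set (RR R)).
    by apply: measurableX; [exact: mx|exact: measurable_itv].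
  rewrite -(fineK (fin_num_measure pi _ mA)) -(fineK (fin_num_measure nu _ mA)).
  congr EFin.
  apply: (cvg_unique _ (hinge_ray (x := x) (t := t) pi_mt)) => //.
  have := hinge_ray (x := x) (t := t) nu_mt.
  under eq_fun do rewrite (ExZ _ (L1B (h1 nu nu_mt _) (h1 nu nu_mt _))) (ExB (h1 nu nu_mt _) (h1 nu nu_mt _)) -!pinu.
  under eq_fun do rewrite -(ExB (h1 pi pi_mt _) (h1 pi pi_mt _)) -(ExZ _ (L1B (h1 pi pi_mt _) (h1 pi pi_mt _))).
  by [].
- move=> k; rewrite ME ltey_eq fin_num_measure//.
  by apply: measurableX; [exact: mx|exact: measurable_itv].
Qed.

(** As [s] carries [l1], a measurable set is, up to a null set, the disjoint union of its sections
    over the points of [s]. *)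
Lemma hinges_determine (s : seq R) (A : set (RR R)) :
  l1 (~` [set` s]) = 0%E ->
  (forall x t, x \in s -> Ex pi (fun z => \1_[set x] z.1 * hinge t z.2) =
                          Ex nu (fun z => \1_[set x] z.1 * hinge t z.2)) ->
  measurable A -> pi A = nu A.
Proof.
move=> s0 pinu mA.
have mfst (B : set (measurableTypeR R)) : measurable B ->
    measurable (fst @^-1` B : set (RR R)).
  by move=> mB; rewrite -[X in measurable X]setTI; exact: measurable_fst.
have part (r : seq R) : {subset r <= s} ->
    pi (A `&` fst @^-1` [set` r]) = nu (A `&` fst @^-1` [set` r]).
  elim: r => [_|x r IH rs]; first by rewrite set_nil preimage_set0 setI0 !measure0.
  have rs' : {subset r <= s} by move=> y yr; apply: rs; rewrite inE yr orbT.
  have [xr|xr] := boolP (x \in r).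
    suff -> : [set` x :: r] = [set` r] by exact: IH.
    apply/seteqP; split=> y /=; first by rewrite inE => /predU1P[->|].
    by rewrite inE => ->; rewrite orbT.
  have split_atom (mu : prob2 R) : mu (A `&` fst @^-1` [set` x :: r]) =
      (mu ([set x] `*` xsection A x) + mu (A `&` fst @^-1` [set` r]))%E.
    rewrite -measureU; last first.
    - apply/seteqP; split=> // -[u v] /= [[-> _] [_]]; exact/negP.
    - by apply: measurableI => //; exact: (mfst _ (measurable_seq r)).
    - apply: measurableX; first exact: measurable_set1.
      exact: measurable_xsection.
    congr (mu _); apply/seteqP; split=> -[u v] /=.
    - rewrite inE => -[Auv /predU1P[ux|ur]]; last by right.
      by left; split=> //; rewrite -ux /xsection /= inE.
    - move=> [[-> ]|[Auv ur]]; last by rewrite inE ur orbT.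
      by rewrite /xsection /= inE => Axv; rewrite inE eqxx.
  rewrite !split_atom IH// hinges_atom//.
  - by move=> t; apply: pinu; apply: rs; rewrite inE eqxx.
  - exact: measurable_xsection.
have on_s (mu : prob2 R) : martingale_transport I l1 l2 mu ->
    mu A = mu (A `&` fst @^-1` [set` s]).
  move=> mu_mt; have m1 := measurableI _ _ mA (mfst _ (measurable_seq s)).
  have m2 := measurableI _ _ mA (mfst _ (measurableC (measurable_seq s))).
  rewrite -[in LHS](setIT A) -(setUv (fst @^-1` [set` s])) setIUr (measureU _ m1 m2); last first.
    by apply/seteqP; split=> // z [[_ a] [_ b]].
  suff Z : mu (A `&` fst @^-1` (~` [set` s])) = 0%E.
    by rewrite [X in (_ + X)%E]Z adde0.
  apply: (subset_measure0 m2 (mfst _ (measurableC (measurable_seq s)))); first by move=> z [].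
  by have := mt_fst mu_mt (measurableC (measurable_seq s)); rewrite s0.
by rewrite !on_s// part.
Qed.

End hinges_determine.

(** * Ranking the fibres of a curtain *)

(** Every point of [I] outside the support lies in a null interval with rational endpoints, and
    there are countably many of these. *)
Lemma msupport_seq (R : realType) (I : set R) (mu : prob1 R) :
  carries mu I -> finite_set (msupport I mu) ->
  exists s : seq R, [/\ uniq s, msupport I mu = [set` s] & mu (~` [set` s]) = 0%E].
Proof.
move=> [mI I0] /finite_seqP[s0 sE]; exists (undup s0).
have {}sE : msupport I mu = [set` undup s0].
  by rewrite sE; apply/seteqP; split=> x /=; rewrite mem_undup.
split; [exact: undup_uniq|exact: sE|].
pose N (q : rat * rat) : set (measurableTypeR R) :=
  if mu `](ratr q.1), (ratr q.2)[%classic == 0%E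
  then `](ratr q.1), (ratr q.2)[%classic else set0.
have mN q : measurable (N q).
  by rewrite /N; case: ifP => // _; exact: measurable_itv.
have N0 q : mu (N q) = 0%E by rewrite /N; case: ifP => // /eqP.
have [U [mU U0 NU]] := null_countable_union mN N0.
have mIU : measurable (~` I `|` U) by apply: measurableU => //; exact: measurableC.
apply: (subset_measure0 (measurableC (measurable_seq (undup s0))) mIU); last first.
  apply/negligibleP => //; apply: negligibleU; apply/negligibleP => //.
  exact: measurableC.
rewrite -sE => x Nx; have [Ix|] := pselect (I x); last by left.
right; apply: contrapT => Ux; apply: Nx; split=> // V oV Vx.
have /nbhs_ballP[e /= e0 eV] := open_nbhs_nbhs (conj oV Vx).
have [q1 [xq1 q1x]] : exists q : rat, x - e < ratr q /\ ratr q < x.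
  by apply: rat_between; rewrite ltrBlDr ltrDl.
have [q2 [xq2 q2x]] : exists q : rat, x < ratr q /\ ratr q < x + e.
  by apply: rat_between; rewrite ltrDl.
have qV : `](ratr q1), (ratr q2)[%classic `<=` V.
  move=> y /=; rewrite in_itv/= => /andP[y1 y2]; apply: eV.
  by rewrite /ball/= ltr_distlC; apply/andP; split; [exact: lt_trans y1|exact: lt_trans q2x].
rewrite lt0e measure_ge0 andbT; apply/eqP => V0; apply: Ux; apply: (NU (q1, q2)).
have q0 : mu `](ratr q1), (ratr q2)[%classic = 0%E.
  have mq : measurable (`](ratr q1), (ratr q2)[%classic : set (measurableTypeR R)).
    exact: measurable_itv.
  have mV : measurable (V : set (measurableTypeR R)) by exact: open_measurable.
  exact: (subset_measure0 mq mV qV V0).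
by rewrite /N /= q0 eqxx /= in_itv/= q1x xq2.
Qed.

Lemma count_ltn (T : eqType) (a b : pred T) (s : seq T) (x : T) :
  subpred a b -> x \in s -> ~~ a x -> b x -> (count a s < count b s)%N.
Proof.
move=> ab xs Nax bx; rewrite !(permP (perm_to_rem xs)) /= (negbTE Nax) bx.
by rewrite ltnS sub_count.
Qed.

Section curtain_order.
Variables (R : realType) (Gam : set (RR R)).
Hypothesis Gam_curtain : forall x x' y y1 y2 y' y1' y2' : R,
  Gam (x, y) -> Gam (x, y1) -> Gam (x, y2) ->
  Gam (x', y') -> Gam (x', y1') -> Gam (x', y2') ->
  x != x' -> ~ (y1 < y' < y2 /\ y1' < y < y2').

(* For a curtain this is a strict partial order; g has to increase along it. *)
Definition nested (x x' : R) := x != x' /\ exists2 y, Gam (x', y) & hull Gam x y.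

Lemma nested_asym (x x' y : R) : nested x x' -> Gam (x, y) -> ~ hull Gam x' y.
Proof.
move=> [xx' [y' Gy' [y1 [y2 [G1 G2 y12]]]]] Gy [y1' [y2' [G1' G2' y12']]].
exact: (Gam_curtain Gy G1 G2 Gy' G1' G2' xx').
Qed.

(** If [q1 < y1], then [y1] would lie between [q1] and [p], both in the fibre over [x'], against
    [nested_asym]; likewise for [q2] and [y2]. So the interval around [r] is contained in the one
    between [y1] and [y2]. *)
Lemma nested_trans (x x' x'' : R) : nested x x' -> nested x' x'' -> nested x x''.
Proof.
move=> N1 N2; have [xx' [p Gp [y1 [y2 [G1 G2 /andP[y1p py2]]]]]] := N1.
have [_ [r Gr [q1 [q2 [Gq1 Gq2 /andP[q1r rq2]]]]]] := N2.
split; first apply/eqP => xx''.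
  apply: (nested_asym N1 (y := r)); first by rewrite xx''.
  by exists q1, q2; rewrite q1r.
exists r => //; exists y1, y2; split=> //; apply/andP; split.
- apply: le_lt_trans q1r; rewrite leNgt; apply/negP => q1y1.
  by apply: (nested_asym N1 G1); exists q1, p; rewrite q1y1.
- apply: lt_le_trans rq2 _; rewrite leNgt; apply/negP => y2q2.
  by apply: (nested_asym N1 G2); exists p, q2; rewrite py2.
Qed.

(** Count the predecessors along the nesting, the point itself included: transitivity makes the
    count grow, strictly because [x'] is no predecessor of [x]. The factor [(size s).+1] leaves room
    for the index in [s], which breaks ties and is recovered as a remainder. *)
Lemma curtain_ranking (s : seq R) : exists g : R -> nat,
  [/\ (forall x x', x \in s -> x' \in s -> nested x x' -> (g x < g x')%N),
      {in s &, injective g}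
    & forall x, x \notin s -> g x = 0%N].
Proof.
pose r x := count (fun z => (z == x) || `[< nested z x >]) s.
pose g x := if x \in s then (r x * (size s).+1 + index x s)%N else 0%N.
exists g; split.
- move=> x x' xs x's xx'; rewrite /g xs x's.
  suff rr : (r x < r x')%N.
    apply: leq_trans (leq_addr _ _).
    apply: (@leq_trans ((r x).+1 * (size s).+1)); last by rewrite leq_mul.
    by rewrite mulSn addnC ltn_add2r ltnS index_size.
  apply: (count_ltn _ x's); last by rewrite eqxx.
    move=> z /orP[/eqP->|/asboolP zx]; apply/orP; right; apply/asboolP => //.
    exact: nested_trans zx xx'.
  rewrite negb_or eq_sym xx'.1; apply/asboolPn => -[_ [y Gy hy]].
  exact: nested_asym xx' Gy hy.
- move=> x x' xs x's; rewrite /g xs x's => /(congr1 (modn^~ (size s).+1)).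
  rewrite !modnMDl !modn_small ?ltnS ?index_size// => E.
  by rewrite -(nth_index x xs) E nth_index.
- by move=> x; rewrite /g => /negbTE ->.
Qed.

End curtain_order.

Lemma carries_setI d (T : measurableType d) (R : realType)
    (mu : {measure set T -> \bar R}) (A B : set T) :
  carries mu A -> measurable B -> mu (~` B) = 0%E -> carries mu (A `&` B).
Proof.
move=> [mA A0] mB B0; split; first exact: measurableI.
apply/negligibleP; first exact/measurableC/measurableI.
by rewrite setCI; apply: negligibleU; apply/negligibleP => //; exact: measurableC.
Qed.

Lemma layer_cake (R : realType) (s : seq R) (g : R -> nat) (K : nat) (x : R) :
  x \in s \/ g x = 0%N -> (g x <= K)%N ->
  (g x)%:R = \sum_(0 <= k < K) \1_[set` [seq y <- s | (k < g y)%N]] x :> R.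
Proof.
move=> xs gK; rewrite -[in LHS](minn_idPl gK).
elim: K {gK} => [|K IH]; first by rewrite minn0 big_nil.
rewrite big_nat_recr//= -IH indicE mem_setE mem_filter -natrD; congr (_%:R).
case: xs => [->|->]; last by rewrite ltn0 !min0n.
rewrite andbT; case: ltnP => [Kg|gK].
  by rewrite (minn_idPr Kg) addn1.
by rewrite (minn_idPl (leqW gK)) addn0.
Qed.

(** * The half-sum of two transports *)

Section mixture.
Variables (R : realType) (I : set R) (l1 l2 : prob1 R) (pi nu : prob2 R).
Hypotheses (l1_I : carries l1 I) (l2_I : carries l2 I).
Hypothesis pi_mt : martingale_transport I l1 l2 pi.
Hypothesis nu_mt : martingale_transport I l1 l2 nu.

(** The two projections of the product of [pi] and [nu], each with weight one half, give the
    measure. It serves to find one carrying set for both, whence the clause on null sets. *)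
Lemma mixture : exists chi : prob2 R,
  [/\ martingale_transport I l1 l2 chi,
      (forall h : RR R -> R, L1 pi h -> L1 nu h ->
         Ex chi h = (Ex pi h + Ex nu h) / 2)
    & forall A, measurable A -> chi A = 0%E -> pi A = 0%E /\ nu A = 0%E].
Proof.
pose Pi : probability (RR R * RR R)%type R := (pi \x nu)%E.
pose m (b : bool) (z : RR R * RR R) : RR R := if b then z.1 else z.2.
have mm b : measurable_fun setT (m b).
  by case: b; [exact: measurable_fst|exact: measurable_snd].
have w0 (b : bool) (z : RR R * RR R) : 0 <= 2^-1 :> R by rewrite invr_ge0 ler0n.
have [W WE] := transport_measures [:: true; false] mm (fun=> L1_cst Pi 2^-1) w0.
have {}WE (h : RR R -> R) : L1 pi h -> L1 nu h ->
    L1 W h /\ Ex W h = (Ex pi h + Ex nu h) / 2.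
  move=> hpi hnu.
  have [A1 A2] := L1_product hpi (L1_cst nu 2^-1).
  have [B1 B2] := L1_product (L1_cst pi 2^-1) hnu.
  have mh : measurable_fun setT h by exact: L1_measurable hpi.
  have [] := WE h mh; last first.
    move=> W1 ->; split=> //; rewrite !big_cons big_nil addr0 mulrDl.
    rewrite [X in X + _]A2 Ex_cst; congr (_ + _).
    by rewrite -[LHS]/(Ex Pi _) (Ex_eq _ (fun t => mulrC _ _)) B2 Ex_cst mulrC.
  by case=> //; apply: L1_eq B1 => z; rewrite mulrC.
have W1 : W setT = 1%E.
  have [L1W EW] := WE _ (L1_cst pi 1) (L1_cst nu 1).
  have -> : W setT = (\int[W]_z (1 * 1 : R)%:E)%E.
    by rewrite integral_cst// mulr1 mul1e.
  rewrite mulr1 -[LHS]fineK; last exact: (integrable_fin_num measurableT L1W).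
  by rewrite -/(Ex W (cst 1)) EW !Ex_cst -[RHS]/((1 : R)%:E); congr EFin; rewrite mulrDl -splitr.
have [chi chiE] := probability_of_measure W1.
have {chiE WE}chiE (h : RR R -> R) : L1 pi h -> L1 nu h ->
    L1 chi h /\ Ex chi h = (Ex pi h + Ex nu h) / 2.
  move=> hpi hnu; have [h1 hE] := WE h hpi hnu; have [c1 cE] := chiE h.
  by split; [exact: c1|rewrite cE].
have chi_set A : measurable A ->
    chi A = ((fine (pi A) + fine (nu A)) / 2)%:E.
  move=> mA; rewrite -(fineK (fin_num_measure chi _ mA)) -!Ex_indic//.
  by have [_ ->] := chiE _ (L1_indic pi mA) (L1_indic nu mA).
exists chi; split.
- apply: mt_intro => //.
  + move=> A mA; have mA' : measurable (fst @^-1` A : set (RR R)).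
      by rewrite -[X in measurable X]setTI; exact: measurable_fst.
    rewrite /pushforward chi_set//.
    have := mt_fst pi_mt mA; have := mt_fst nu_mt mA; rewrite /pushforward => -> ->.
    by rewrite -[RHS](fineK (fin_num_measure l1 _ mA)); congr EFin; rewrite mulrDl -splitr.
  + move=> A mA; have mA' : measurable (snd @^-1` A : set (RR R)).
      by rewrite -[X in measurable X]setTI; exact: measurable_snd.
    rewrite /pushforward chi_set//.
    have := mt_snd pi_mt mA; have := mt_snd nu_mt mA; rewrite /pushforward => -> ->.
    by rewrite -[RHS](fineK (fin_num_measure l2 _ mA)); congr EFin; rewrite mulrDl -splitr.
  + exact: (proj1 (chiE _ (mt_L1_fst pi_mt) (mt_L1_fst nu_mt))).
  + exact: (proj1 (chiE _ (mt_L1_snd pi_mt) (mt_L1_snd nu_mt))).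
  + move=> A mA; have bA : bdm (fun z : RR R => \1_A z.1 : R).
      exact: (bdm_comp measurable_fst (bdm_indic R mA)).
    have [_ ->] := chiE _ (L1_bdmM bA (mt_L1_fst pi_mt)) (L1_bdmM bA (mt_L1_fst nu_mt)).
    have [_ ->] := chiE _ (L1_bdmM bA (mt_L1_snd pi_mt)) (L1_bdmM bA (mt_L1_snd nu_mt)).
    by rewrite /= (mt_martingale pi_mt mA) (mt_martingale nu_mt mA).
- by move=> h hpi hnu; have [] := chiE h hpi hnu.
- move=> A mA; rewrite chi_set// => -[] E.
  have p0 : 0 <= fine (pi A) by rewrite fine_ge0.
  have n0 : 0 <= fine (nu A) by rewrite fine_ge0.
  rewrite -(fineK (fin_num_measure pi _ mA)) -(fineK (fin_num_measure nu _ mA)).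
  by split; congr EFin; clear w0; lra.
Qed.

End mixture.

(** * Layers of the ranking: maximality and uniqueness *)

Section levels.
Variables (R : realType) (I : set R) (l1 l2 : prob1 R).
Hypotheses (I_open : open I) (I_itv : is_interval I).
Hypotheses (l1_I : carries l1 I) (l2_I : carries l2 I).
Hypotheses (l1_mean : l1.-integrable I EFin) (l2_mean : l2.-integrable I EFin).
Variables (s : seq R) (g : R -> nat).
Hypotheses (s_uniq : uniq s) (s_I : forall x, x \in s -> I x).
Hypothesis s_l1 : l1 (~` [set` s]) = 0%E.
Hypothesis g_off : forall x, x \notin s -> g x = 0%N.

Let l1m : L1 l1 (fun x => x : R). Proof. exact: carried_mean l1_I l1_mean. Qed.
Let l2m : L1 l2 (fun x => x : R). Proof. exact: carried_mean l2_I l2_mean. Qed.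

(* The layers of g: g is the sum of the indicator functions of lev 1, lev 2, etc. *)
Let lev k := [seq x <- s | (k <= g x)%N].
Let top := (\max_(x <- s) g x)%N.

(** What remains of a curtain once [g] is fixed. It is the nesting condition of [R_curtain] for the
    order of [- g], so it can come either from the ranking or from part (i). *)
Definition g_ordered (Gam : set (RR R)) := forall x x' y1 y' y2 : R,
  Gam (x', y') -> Gam (x, y1) -> Gam (x, y2) -> (g x' < g x)%N ->
  ~ (y1 < y' < y2).

Lemma carries_fibres (nu : prob2 R) (Gam : set (RR R)) :
  martingale_transport I l1 l2 nu -> carries nu Gam ->
  carries nu (Gam `&` fst @^-1` [set` s]).
Proof.
move=> nu_mt nuG; apply: carries_setI nuG _ _.
  rewrite -[X in measurable X]setTI; apply: measurable_fst => //.
  exact: measurable_seq.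
by have := mt_fst nu_mt (measurableC (measurable_seq s)); rewrite s_l1.
Qed.

(** A fibre outside the layer has a smaller [g] than those inside, so it has no point in their
    hulls; this is the separation that the comparison of hinges requires. *)
Lemma level_hinge_le (pi nu : prob2 R) (Gam : set (RR R)) (k : nat) (t : R) :
  martingale_transport I l1 l2 pi -> martingale_transport I l1 l2 nu ->
  carries pi Gam -> g_ordered Gam ->
  Ex pi (fun z => \1_[set` lev k] z.1 * hinge t z.2) <=
  Ex nu (fun z => \1_[set` lev k] z.1 * hinge t z.2).
Proof.
move=> pi_mt nu_mt piG ord.
apply: (hinge_le l1m l2m pi_mt nu_mt (carries_fibres pi_mt piG)).
  exact: filter_uniq.
move=> x y [Gxy /= xs]; rewrite mem_filter xs andbT -ltnNge => gxk.
move=> [x0]; rewrite mem_filter => /andP[kg _] [y1 [y2 [[G1 _] [G2 _] y12]]].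
exact: (ord _ _ _ _ _ Gxy G1 G2 (leq_trans gxk kg) y12).
Qed.

Lemma level_sum (x : R) :
  (g x)%:R = \sum_(0 <= k < top) \1_[set` lev k.+1] x :> R.
Proof.
rewrite (layer_cake (s := s) (K := top))//.
  by have [xs|/g_off] := boolP (x \in s); [left|right].
have [xs|/g_off->//] := boolP (x \in s).
exact: (@leq_bigmax_seq _ s xpredT g).
Qed.

Lemma measurable_ranking :
  measurable_fun setT (fun x : measurableTypeR R => (g x)%:R : R).
Proof.
rewrite (_ : (fun x => _) = fun x : measurableTypeR R =>
    \sum_(0 <= k < top) \1_[set` lev k.+1] x); last exact/funext/level_sum.
by apply: measurable_sum => k; exact: (measurable_indic (measurable_seq _)).
Qed.

Lemma bounded_ranking (A : set R) : [bounded (g x)%:R : R | x in A].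
Proof.
exists top%:R; split; first exact: num_real.
move=> M topM x _; rewrite /= ger0_norm ?ler0n//.
apply: le_trans (ltW topM); rewrite ler_nat.
have [xs|/g_off->//] := boolP (x \in s).
exact: (@leq_bigmax_seq _ s xpredT g).
Qed.

Variable f : R -> R.
Hypothesis f_conc : strictly_concave_on I f.
Hypothesis f_neg : (\int[l2]_(x in I) (f^\- x)%:E < +oo)%E.

Let oppf_conv : strictly_convex_on I (\- f).
Proof.
move=> x y t Ix Iy xy t01; have := f_conc Ix Iy xy t01.
by rewrite /= => H; rewrite !mulrN -opprD ltrN2.
Qed.

Let oppf_L1 : L1 l2 ((\- f) \_ I : measurableTypeR R -> R).
Proof.
apply: (strictly_convex_L1 I_open I_itv oppf_conv l2_I l2m).
by rewrite funrposN.
Qed.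

Let f_L1 : L1 l2 (f \_ I : measurableTypeR R -> R).
Proof.
apply: L1_eq (L1N oppf_L1) => x; rewrite !patchE.
by case: ifP; rewrite ?oppr0//= opprK.
Qed.

Let rank_bdm : bdm ((fun x => (g x)%:R : R) \_ I : measurableTypeR R -> R).
Proof.
have [mI _] := l1_I; apply: restrict_bdm => //; first exact: bounded_ranking.
exact: measurable_funTS measurable_ranking.
Qed.

Let rankE x : ((fun x => (g x)%:R : R) \_ I) x = (g x)%:R.
Proof.
rewrite patchE; case: ifPn => //; rewrite notin_setE => Ix.
by rewrite g_off//; apply/negP => /s_I.
Qed.

Lemma integral_ranking (nu : prob2 R) : martingale_transport I l1 l2 nu ->
  (\int[nu]_(z in I `*` I) (tensor (fun x => (g x)%:R) f z)%:E =
   (Ex nu (fun z => (g z.1)%:R * (f \_ I) z.2))%:E)%E.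
Proof.
move=> nu_mt; rewrite (integral_tensor nu_mt rank_bdm f_L1).
by congr EFin; apply: Ex_eq => z; rewrite rankE.
Qed.

Let rank_f_L1 (nu : prob2 R) : martingale_transport I l1 l2 nu ->
  L1 nu (fun z => (g z.1)%:R * (f \_ I) z.2).
Proof.
move=> nu_mt; have [f1nu _] := mt_L1_comp_snd nu_mt f_L1.
apply: L1_eq (L1_bdmM (bdm_comp measurable_fst rank_bdm) f1nu) => z.
by rewrite /= rankE.
Qed.

(** The sum over layers trades the concave [f] for the convex [- f] with a minus sign: being least
    on every layer implies being a maximizer. *)
Lemma Ex_ranking (nu : prob2 R) : martingale_transport I l1 l2 nu ->
  Ex nu (fun z => (g z.1)%:R * (f \_ I) z.2) =
  - \sum_(0 <= k < top) Ex nu (fun z => \1_[set` lev k.+1] z.1 * ((\- f) \_ I) z.2).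
Proof.
move=> nu_mt.
have levL1 k := mt_L1_indic nu_mt (measurable_seq (lev k.+1)) oppf_L1.
rewrite -mulN1r -Ex_sum// -ExZ; last exact: L1_sum.
apply: Ex_eq => z; rewrite level_sum mulN1r -mulr_suml -mulrN; congr (_ * _).
by rewrite !patchE; case: ifP; rewrite ?oppr0//= opprK.
Qed.

Lemma ordered_maximizes (pi : prob2 R) (Gam : set (RR R)) :
  martingale_transport I l1 l2 pi -> carries pi Gam -> g_ordered Gam ->
  maximizes I l1 l2 (tensor (fun x => (g x)%:R) f) pi.
Proof.
move=> pi_mt piG ord; split=> // nu nu_mt.
rewrite !integral_ranking// lee_fin !Ex_ranking// lerN2; apply: ler_sum => k _.
apply: (convex_le I_open I_itv l1m l2m pi_mt nu_mt (measurable_seq _)) => //.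
by move=> t; exact: level_hinge_le piG ord.
Qed.

Lemma maximizer_unique (pi nu : prob2 R) (A : set (RR R)) :
  {in s &, injective g} ->
  maximizes I l1 l2 (tensor (fun x => (g x)%:R) f) pi ->
  maximizes I l1 l2 (tensor (fun x => (g x)%:R) f) nu ->
  measurable A -> nu A = pi A.
Proof.
move=> g_inj [pi_mt pi_max] [nu_mt nu_max] mA.
have piE : Ex pi (fun z => (g z.1)%:R * (f \_ I) z.2) =
           Ex nu (fun z => (g z.1)%:R * (f \_ I) z.2).
  apply/le_anti/andP; split; rewrite -lee_fin -!integral_ranking//.
  - exact: nu_max.
  - exact: pi_max.
have [chi [chi_mt chiE chi0]] := mixture l1_I l2_I pi_mt nu_mt.
(* Part (i) asks for a convex second factor. Changing both signs leaves the tensor unchanged and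
   reverses the order given by [g]. *)
have chi_max : maximizes I l1 l2 (tensor (fun x => - (g x)%:R) (\- f)) chi.
  have tE : tensor (fun x => - (g x)%:R) (\- f) = tensor (fun x => (g x)%:R) f.
    by apply/funext => z; rewrite /tensor mulrNN.
  split=> // mu mu_mt; rewrite tE; apply: le_trans (pi_max _ mu_mt) _.
  by rewrite !integral_ranking// (chiE _ (rank_f_L1 pi_mt) (rank_f_L1 nu_mt)) -piE mulrDl -splitr.
have [_ [Gam [_ [mG G0] ord]]] : R_curtain I (fun a b => - (g a)%:R < - (g b)%:R :> R) l1 l2 chi.
  apply: (maximizes_R_curtain I_open I_itv l1_I l2_I l1_mean l2_mean _ _ oppf_conv _ chi_max).
  - have [M [Mr Mb]] := bounded_ranking I; exists M; split=> // N MN x Ix.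
    by rewrite /= normrN; exact: Mb.
  - by apply: measurable_funTS; apply: measurableT_comp => //; exact: measurable_ranking.
  - by rewrite funrposN.
have [pi0 nu0] := chi0 _ (measurableC mG) G0.
have {}ord : g_ordered Gam.
  move=> x x' y1 y' y2 G1 G2 G3 gx; apply: ord G1 G2 G3 _.
  by rewrite ltrN2 ltr_nat.
(* [Gam] carries both [pi] and [nu], so each of them is least on every layer. *)
have levE k t : Ex pi (fun z => \1_[set` lev k] z.1 * hinge t z.2) =
                Ex nu (fun z => \1_[set` lev k] z.1 * hinge t z.2).
  by apply/le_anti/andP; split; apply: level_hinge_le ord.
have h1 mu : martingale_transport I l1 l2 mu -> forall k t,
    L1 mu (fun z => \1_[set` lev k] z.1 * hinge t z.2).
  move=> mu_mt k t.
  exact: (mt_L1_indic mu_mt (measurable_seq (lev k)) (L1_hinge t l2m)).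
(* As [g] is injective on [s], the atom [x] is the difference of two consecutive layers. *)
have atomE (mu : prob2 R) x t : martingale_transport I l1 l2 mu -> x \in s ->
    Ex mu (fun z => \1_[set x] z.1 * hinge t z.2) =
    Ex mu (fun z => \1_[set` lev (g x)] z.1 * hinge t z.2) -
    Ex mu (fun z => \1_[set` lev (g x).+1] z.1 * hinge t z.2).
  move=> mu_mt xs; rewrite -ExB; do ?exact: h1; apply: Ex_eq => z.
  rewrite -mulrBl; congr (_ * _); rewrite !indicE !mem_setE !mem_filter.
  have -> : (z.1 \in [set x]) = (z.1 == x) by apply/idP/eqP; rewrite inE.
  have [->|zx] := eqVneq z.1 x; first by rewrite xs leqnn ltnn subr0.
  have [zs|] := boolP (z.1 \in s); last by rewrite !andbF subr0.
  rewrite !andbT; have := contra_neq (g_inj _ _ zs xs) zx.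
  by rewrite leq_eqVlt eq_sym => /negbTE -> /=; rewrite subrr.
apply/esym/(hinges_determine l2m pi_mt nu_mt s_l1) => // x t xs.
by rewrite !atomE// !levE.
Qed.

End levels.

Theorem proposition2p18 (R : realType) (I : set R)
    (I_neq0 : I !=set0) (I_open : open I) (I_itv : is_interval I)
    (l1 l2 : probability (measurableTypeR R) R)
    (l1_I : carries l1 I) (l2_I : carries l2 I)
    (l1_mean : l1.-integrable I EFin) (l2_mean : l2.-integrable I EFin) :
  (forall (g f : R -> R)
     (pi : probability (measurableTypeR R * measurableTypeR R)%type R),
     [bounded g x | x in I] ->
     measurable_fun (I : set (measurableTypeR R)) (g : _ -> measurableTypeR R) ->
     strictly_convex_on I f ->
     (\int[l2]_(x in I) (f^\+ x)%:E < +oo)%E ->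
     maximizes I l1 l2 (tensor g f) pi ->
     R_curtain I (fun a b => g a < g b) l1 l2 pi /\
     ((exists A : set R, [/\ A `<=` I, carries l1 A & set_inj A g]) ->
      curtain I l1 l2 pi))
  /\
  (finite_set (msupport I l1) ->
   forall pi : probability (measurableTypeR R * measurableTypeR R)%type R,
     curtain I l1 l2 pi ->
     forall f : R -> R,
       strictly_concave_on I f ->
       (\int[l2]_(x in I) (f^\- x)%:E < +oo)%E ->
       exists g : R -> R,
         [/\ [bounded g x | x in I],
             measurable_fun (I : set (measurableTypeR R))
               (g : _ -> measurableTypeR R),
             set_inj (msupport I l1) g,
             (forall x, I x -> ~ msupport I l1 x -> g x = 0)
           & uniquely_maximizes I l1 l2 (tensor g f) pi]).
Proof.
split=> [g f pi gb mg f_conv fp pi_max|fin pi [pi_mt [Gam [_ piG cur]]] f f_conc fn].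
  have RC := maximizes_R_curtain I_open I_itv l1_I l2_I l1_mean l2_mean gb mg f_conv fp pi_max.
  by split=> // -[A [_ cA g_inj]]; exact: R_curtain_curtain cA g_inj RC.
have [s [s_uniq sE s0]] := msupport_seq l1_I fin.
have s_I x : x \in s -> I x.
  by move=> xs; have : [set` s] x by []; rewrite -sE => -[].
have [g [g_nested g_inj g_off]] := curtain_ranking cur s.
exists (fun x => (g x)%:R); rewrite sE; split.
- exact: (bounded_ranking g_off).
- by apply: measurable_funTS; exact: (measurable_ranking g_off).
- move=> x y; rewrite !inE /= => xs ys /eqP; rewrite eqr_nat => /eqP.
  exact: g_inj.
- by move=> x _ /negP /g_off ->.
- have pi_max : maximizes I l1 l2 (tensor (fun x => (g x)%:R) f) pi.
    apply: (ordered_maximizes I_open I_itv l1_I l2_I l1_mean l2_mean s_uniq s_I s0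
      g_off f_conc fn pi_mt (carries_fibres s0 pi_mt piG)).
    move=> x x' y1 y' y2 [G' /= x's] [G1 /= xs] [G2 _] gx y12.
    (* The point [y'] would make [x'] nested in [x], and the ranking increases along nesting. *)
    have : (g x < g x')%N.
      apply: g_nested => //; split; first by apply/eqP => xx'; rewrite xx' ltnn in gx.
      by exists y' => //; exists y1, y2.
    by rewrite ltnNge ltnW.
  split=> // nu nu_max A mA.
  exact: (maximizer_unique I_open I_itv l1_I l2_I l1_mean l2_mean s_uniq s_I s0
    g_off f_conc fn g_inj pi_max nu_max mA).
Qed.
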